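(* Suppose that the operator $Q_1=\iota'\iota L_0^{-1}:H^-_{SL}(\mathcal D)\to H^-_{SL}(\mathcal D)$ is of finite order. Let $\delta L:H_{SL}(\mathcal D)\to H^-_{SL}(\mathcal D)$ be a compact linear operator such that $L_0+\delta L:H_{SL}(\mathcal D)\to H^-_{SL}(\mathcal D)$ is (continuously) invertible. Then the system of root functions of the compact operator $$P_1=\iota'\iota\,(L_0+\delta L)^{-1}:H^-_{SL}(\mathcal D)\to H^-_{SL}(\mathcal D)$$ is complete in the spaces $H^-_{SL}(\mathcal D)$, $L^2(\mathcal D)$ and $H_{SL}(\mathcal D)$.
   Context: Setting. $\mathcal D\subset\mathbb R^n$ is a bounded domain with Lipschitz boundary; functions are complex-valued. $S\subset\partial\mathcal D$ is an open connected (possibly empty) subset with piecewise smooth boundary. The functions $a_{i,j}\in L^\infty(\mathcal D)$ ($i,j=1,\dots,n$) form a Hermitian matrix with $\sum_{i,j}a_{i,j}(x)\xi_i\xi_j\ge m|\xi|^2$ for all $x\in\mathcal D$, $\xi\in\mathbb R^n\setminus\{0\}$, with a constant $m>0$. $b_1\in L^\infty(\partial\mathcal D)$ vanishes on $S$, $b_1\neq0$ a.e. on $\partial\mathcal D\setminus S$, $1/b_1\in L^1(\partial\mathcal D\setminus S)$. $a_{0,0}\ge0$ is a bounded function on $\mathcal D$ and $b_{0,0}$ a bounded function on $\partial\mathcal D$ with $b_{0,0}/b_1\ge0$. Spaces. $H^1(\mathcal D,S)$ is the subspace of $H^1(\mathcal D)$ of functions whose trace vanishes on $S$. Put $$(u,v)_{SL}=\int_{\mathcal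 D}\sum_{i,j}a_{i,j}\,\partial_ju\,\overline{\partial_iv}\,dx+(a_{0,0}u,v)_{L^2(\mathcal D)}+(b_{0,0}b_1^{-1}u,v)_{L^2(\partial\mathcal D\setminus S)},\qquad \|u\|_{SL}=\sqrt{(u,u)_{SL}}.$$ Standing assumptions: $\|\cdot\|_{SL}$ is a norm on $H^1(\mathcal D,S)$; $H_{SL}(\mathcal D)$ denotes the completion of $H^1(\mathcal D,S)$ in this norm (a Hilbert space); $H_{SL}(\mathcal D)$ is continuously embedded into $L^2(\mathcal D)$, and $\iota:H_{SL}(\mathcal D)\hookrightarrow L^2(\mathcal D)$ denotes the inclusion. $H^-_{SL}(\mathcal D)$ is the completion of $H^1(\mathcal D,S)$ in the norm $\|u\|_{H^-_{SL}}=\sup_{0\ne v\in H^1(\mathcal D,S)}|(v,u)_{L^2(\mathcal D)}|/\|v\|_{SL}$. The sesquilinear pairing $(v,u)=\lim_\nu(v,u_\nu)_{L^2(\mathcal D)}$ for $v\in H_{SL}(\mathcal D)$, $u\in H^-_{SL}(\mathcal D)$, with $H^1(\mathcal D,S)\ni u_\nu\to u$ in $H^-_{SL}(\mathcal D)$, identifies $H^-_{SL}(\mathcal D)$ (conjugate-linearly, isometrically) with the dual of $H_{SL}(\mathcal D)$. $\iota':L^2(\mathcal D)\hookrightarrow H^-_{SL}(\mathcal D)$ is the induced continuous embedding. Operator. $L_0:H_{SL}(\mathcal D)\to H^-_{SL}(\mathcal D)$ is defined by $(v,L_0u)=(v,u)_{SL}$ for all $u,v\in H_{SL}(\mathcal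 D)$; it is an isometric isomorphism. $H^-_{SL}(\mathcal D)$ carries the scalar product $(u,v)_{H^-_{SL}}:=(L_0^{-1}u,v)$, which induces its norm. Terminology. A compact operator $K$ on a Hilbert space is in the Schatten class $\mathfrak S_p$ ($0<p<\infty$) if its $s$-numbers (eigenvalues of $(K^*K)^{1/2}$) satisfy $\sum_\nu s_\nu(K)^p<\infty$; a compact operator is of finite order if it belongs to some $\mathfrak S_p$. A root function of $K$ is an element $u$ with $(K-\lambda I)^mu=0$ for some eigenvalue $\lambda$ and some natural $m$. A system is complete in a space if its elements lie in the space (under the embeddings above) and its linear span is dense. *)

(* Defs.v *)
From HB Require Import structures.
From mathcomp Require Import all_boot all_order all_algebra.
From mathcomp Require Import complex.
From mathcomp Require Import all_classical all_reals all_analysis.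
Set Implicit Arguments.
Unset Strict Implicit.
Unset Printing Implicit Defensive.
Import Order.TTheory GRing.Theory Num.Theory.
Import numFieldNormedType.Exports.
Local Open Scope classical_set_scope.
Local Open Scope ring_scope.
Local Open Scope complex_scope.

Notation borelRn R n := (g_sigma_algebraType (@open 'rV[R]_n)).

Section EuclideanSpace.
Variable R : realType.

(* 'rV[R]_n carries the sup norm; Euclidean lengths are computed here. *)
Definition enorm (n : nat) (x : 'rV[R]_n) : R :=
  Num.sqrt (\sum_(i < n) x 0 i ^+ 2).

Definition is_lebesgue (n : nat) (lam : {measure set (borelRn R n) -> \bar R}) :=
  forall a b : 'rV[R]_n, (forall i, a 0 i <= b 0 i) ->
  lam [set x : 'rV[R]_n | forall i, a 0 i <= x 0 i < b 0 i] =
  (\prod_(i < n) (b 0 i - a 0 i))%:E.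

(* The recursion V_k = (2 pi / k) V_(k-2) for the Euclidean unit ball. *)
Fixpoint ball_volume (k : nat) : R :=
  match k with
  | 0 => 1
  | 1 => 2
  | k'.+2 => 2 * pi / k'.+2%:R * ball_volume k'
  end.

Definition diam (n : nat) (A : set 'rV[R]_n) : R :=
  sup [set r | exists x y, [/\ A x, A y & r = enorm (x - y)]].

(* The case distinction matters only for k = 0 (counting measure). *)
Definition hausdorff_weight (n k : nat) (A : set 'rV[R]_n) : \bar R :=
  if `[< A = set0 >] then 0%E
  else (ball_volume k * (diam A / 2) ^+ k)%:E.

Definition hausdorff_pre (n k : nat) (delta : R) (A : set 'rV[R]_n) : \bar R :=
  ereal_inf [set s | exists F : nat -> set 'rV[R]_n,
    [/\ A `<=` \bigcup_j F j,
        forall j x y, F j x -> F j y -> enorm (x - y) <= delta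
      & s = (\sum_(0 <= j <oo) hausdorff_weight k (F j))%E]].

Definition hausdorff (n k : nat) (A : set 'rV[R]_n) : \bar R :=
  ereal_sup [set hausdorff_pre k delta A | delta in [set e : R | 0 < e]].

(* Surface measure in R^(d+1): the d-dimensional Hausdorff measure. *)
Definition is_surface_measure (d : nat)
    (sigma : {measure set (borelRn R d.+1) -> \bar R}) :=
  forall A : set (borelRn R d.+1), measurable A -> sigma A = hausdorff d A.

Definition partials (n : nat) (W : normedModType R) (s : seq 'I_n)
    (f : 'rV[R]_n -> W) : 'rV[R]_n -> W :=
  foldr (fun i (g : 'rV[R]_n -> W) => fun x => 'D_(delta_mx 0 i) g x) f s.

(* C^infinity: all iterated partial derivatives exist and are continuous. *)
Definition smooth (n : nat) (W : normedModType R) (f : 'rV[R]_n -> W) :=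
  forall s : seq 'I_n, continuous (partials s f) /\
    forall (i : 'I_n) x, derivable (partials s f) x (delta_mx 0 i).

Definition test_function (n : nat) (D : set 'rV[R]_n) (phi : 'rV[R]_n -> R) :=
  [/\ smooth (phi : 'rV[R]_n -> R^o),
      compact (closure [set x | phi x != 0])
    & closure [set x | phi x != 0] `<=` D].

Definition bdry (n : nat) (D : set 'rV[R]_n) : set 'rV[R]_n :=
  closure D `\` interior D.

(* Near each boundary point, after a rigid motion (a translation followed by
   an orthogonal matrix O), D is the strict epigraph of a Lipschitz function of
   the first d coordinates. *)
Definition lipschitz_boundary (d : nat) (D : set 'rV[R]_d.+1) :=
  forall x0, bdry D x0 ->
  exists (O : 'M[R]_d.+1) (g : 'rV[R]_d -> R) (K r : R),
    [/\ O *m O^T = 1%:M, 0 < r,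
        forall y z : 'rV[R]_d, `|g y - g z| <= K * enorm (y - z)
      & forall x, enorm (x - x0) < r ->
          let y := (x - x0) *m O in
          D x <-> g (\row_(i < d) y 0 (widen_ord (leqnSn d) i)) < y 0 ord_max].

Definition bounded_lipschitz_domain (d : nat) (D : set 'rV[R]_d.+1) :=
  [/\ D !=set0, open D, connected D, bounded_set D & lipschitz_boundary D].

Definition unit_cube (k : nat) : set 'rV[R]_k :=
  [set t | forall i, 0 <= t 0 i <= 1].

Definition smooth_piece (k n : nat) (A : set 'rV[R]_n) :=
  exists phi : 'rV[R]_k -> 'rV[R]_n,
    [/\ smooth phi,
        {in @unit_cube k &, injective phi},
        forall t v, @unit_cube k t -> v != 0 -> 'D_v phi t != 0
      & A = phi @` @unit_cube k].

(* In R^(d+1) the relative boundary of S in the hypersurface bdry D has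
   dimension d-1.  As S is relatively open in the closed set bdry D, its
   relative boundary is closure S \ S. *)
Definition piecewise_smooth_boundary (d : nat) (S : set 'rV[R]_d.+1) :=
  exists (N : nat) (A : 'I_N -> set 'rV[R]_d.+1),
    (forall k, smooth_piece d.-1 (A k)) /\
    closure S `\` S = \bigcup_(k in [set: 'I_N]) A k.

Definition admissible_part (d : nat) (D S : set 'rV[R]_d.+1) :=
  [/\ exists2 U, open U & S = U `&` bdry D,
      connected S
    & piecewise_smooth_boundary S].

End EuclideanSpace.

Section FunctionSpaces.
Variables (R : realType) (n : nat).
Implicit Types (mu : {measure set (borelRn R n) -> \bar R})
  (A : set 'rV[R]_n) (f g : 'rV[R]_n -> R[i]).

Definition cmeasurable A f :=
  measurable_fun (A : set (borelRn R n)) (fun x => complex.Re (f x)) /\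
  measurable_fun (A : set (borelRn R n)) (fun x => complex.Im (f x)).

Definition cintegral mu A f : R[i] :=
  (\int[mu]_(x in A) complex.Re (f x)) +i* (\int[mu]_(x in A) complex.Im (f x)).

Definition modulus (z : R[i]) : R := complex.Re `|z|.

Definition Linfty_fun mu A f :=
  cmeasurable A f /\
  exists M : R, {ae mu, forall x, A x -> modulus (f x) <= M}.

Definition bounded_cfun A f :=
  cmeasurable A f /\ exists M : R, forall x, A x -> modulus (f x) <= M.

Definition L1_fun mu A f :=
  cmeasurable A f /\ (\int[mu]_(x in A) (modulus (f x))%:E < +oo)%E.

Definition L2_fun mu A f :=
  cmeasurable A f /\ (\int[mu]_(x in A) (modulus (f x) ^+ 2)%:E < +oo)%E.

Definition L2_prod mu A f g : R[i] := cintegral mu A (fun x => f x * (g x)^*).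

Definition L2_cvg mu A (f_ : nat -> 'rV[R]_n -> R[i]) f :=
  (\int[mu]_(x in A) (modulus (f_ k x - f x) ^+ 2)%:E)%E @[k --> \oo] --> 0%E.

Definition weak_partial mu A (i : 'I_n) f g :=
  forall phi, test_function A phi ->
  cintegral mu A (fun x => f x * ('D_(delta_mx 0 i) phi x)%:C) =
  - cintegral mu A (fun x => g x * (phi x)%:C).

Definition weak_gradient mu A f (G : 'I_n -> 'rV[R]_n -> R[i]) :=
  forall i, L2_fun mu A (G i) /\ weak_partial mu A i f (G i).

Definition H1_fun mu A f := L2_fun mu A f /\ exists G, weak_gradient mu A f G.

(* A chosen representative of the weak gradient of f in H^1. *)
Definition gradient mu A f : 'I_n -> 'rV[R]_n -> R[i] :=
  xget (fun _ _ => 0) (weak_gradient mu A f).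

Definition csmooth f :=
  smooth (fun x => complex.Re (f x) : R^o) /\
  smooth (fun x => complex.Im (f x) : R^o).

Definition cpartial (i : 'I_n) f : 'rV[R]_n -> R[i] := fun x =>
  ('D_(delta_mx 0 i) (fun y => complex.Re (f y)) x) +i*
  ('D_(delta_mx 0 i) (fun y => complex.Im (f y)) x).

(* t is the trace of f on the boundary: the restriction map, defined on smooth
   functions, extended by continuity from H^1(A) to L^2(bdry A). *)
Definition is_trace mu sigma A f t :=
  L2_fun sigma (bdry A) t /\
  exists (f_ : nat -> 'rV[R]_n -> R[i]) (G : 'I_n -> 'rV[R]_n -> R[i]),
    [/\ forall k, csmooth (f_ k), weak_gradient mu A f G,
        L2_cvg mu A f_ f,
        forall i, L2_cvg mu A (fun k => cpartial i (f_ k)) (G i)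
      & L2_cvg sigma (bdry A) f_ t].

Definition trace mu sigma A f : 'rV[R]_n -> R[i] :=
  xget (fun _ => 0) (is_trace mu sigma A f).

Definition H1_vanishing mu sigma A (S : set 'rV[R]_n) : set ('rV[R]_n -> R[i]) :=
  [set f | H1_fun mu A f /\
    exists2 t, is_trace mu sigma A f t & {ae sigma, forall x, S x -> t x = 0}].

End FunctionSpaces.

Record SL_data (R : realType) (d : nat) := SLData {
  dom : set 'rV[R]_d.+1;
  part : set 'rV[R]_d.+1;
  coef : 'I_d.+1 -> 'I_d.+1 -> 'rV[R]_d.+1 -> R[i];
  coef0 : 'rV[R]_d.+1 -> R[i];
  bcoef1 : 'rV[R]_d.+1 -> R[i];
  bcoef0 : 'rV[R]_d.+1 -> R[i] }.

Section SturmLiouville.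
Variables (R : realType) (d : nat).
Variables (lam sigma : {measure set (borelRn R d.+1) -> \bar R}).
Variable X : SL_data R d.

Local Notation D := (dom X).
Local Notation S := (part X).
Local Notation a := (coef X).
Local Notation a00 := (coef0 X).
Local Notation b1 := (bcoef1 X).
Local Notation b00 := (bcoef0 X).
Local Notation cfun := ('rV[R]_d.+1 -> R[i]).

(* On R[i], 0 <= z means that z is real and nonnegative. *)
Record SL_assumptions : Prop := SLAssumptions {
  SL_dom : bounded_lipschitz_domain D;
  SL_part : admissible_part D S;
  SL_coef_bounded : forall i j, Linfty_fun lam D (a i j);
  SL_coef_hermitian : forall i j x, D x -> a j i x = (a i j x)^*;
  SL_coef_elliptic : exists2 m : R, 0 < m &
    forall x (xi : 'rV[R]_d.+1), D x -> xi != 0 ->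
      (m * enorm xi ^+ 2)%:C <=
      \sum_(i < d.+1) \sum_(j < d.+1) a i j x * (xi 0 i)%:C * (xi 0 j)%:C;
  SL_b1_bounded : Linfty_fun sigma (bdry D) b1;
  SL_b1_part : {ae sigma, forall x, S x -> b1 x = 0};
  SL_b1_neq0 : {ae sigma, forall x, (bdry D `\` S) x -> b1 x != 0};
  SL_b1_inv : L1_fun sigma (bdry D `\` S) (fun x => (b1 x)^-1);
  SL_a00_bounded : bounded_cfun D a00;
  SL_a00_ge0 : forall x, D x -> 0 <= a00 x;
  SL_b00_bounded : bounded_cfun (bdry D) b00;
  SL_b00_ge0 : {ae sigma, forall x, (bdry D `\` S) x -> 0 <= b00 x / b1 x}
}.

Definition H1S : set cfun := H1_vanishing lam sigma D S.

Definition SL_form (u v : cfun) : R[i] :=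
  cintegral lam D (fun x => \sum_(i < d.+1) \sum_(j < d.+1)
    a i j x * gradient lam D u j x * (gradient lam D v i x)^*)
  + L2_prod lam D (fun x => a00 x * u x) v
  + L2_prod sigma (bdry D `\` S)
      (fun x => b00 x / b1 x * trace lam sigma D u x) (trace lam sigma D v).

Definition SL_norm (u : cfun) : R := Num.sqrt (complex.Re (SL_form u u)).

(* The first two clauses say that the boundary term of (u,u)_SL is finite
   (integrals being total here) and that (u,u)_SL has a nonnegative root. *)
Record SL_norm_is_norm : Prop := SLNormIsNorm {
  SL_norm_finite : forall u, H1S u ->
    (\int[sigma]_(x in bdry D `\` S)
       (modulus (b00 x / b1 x) * modulus (trace lam sigma D u x) ^+ 2)%:E
     < +oo)%E;
  SL_form_ge0 : forall u, H1S u -> 0 <= SL_form u u;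
  SL_norm_eq0 : forall u, H1S u -> SL_norm u = 0 ->
    {ae lam, forall x, D x -> u x = 0};
  SL_norm_scale : forall (c : R[i]) u, H1S u ->
    SL_norm (fun x => c * u x) = modulus c * SL_norm u;
  SL_norm_triangle : forall u v, H1S u -> H1S v ->
    SL_norm (fun x => u x + v x) <= SL_norm u + SL_norm v
}.

Definition SL_neg_norm (u : cfun) : R :=
  sup [set r | exists v : cfun,
    [/\ H1S v, ~ {ae lam, forall x, D x -> v x = 0}
      & r = modulus (L2_prod lam D v u) / SL_norm v]].

(* V, with the canonical map j, is a completion of the linear space P of
   functions with respect to the (semi)norm N. *)
Definition is_completion (P : set cfun) (N : cfun -> R)
    (V : completeNormedModType R[i]) (j : cfun -> V) :=
  [/\ forall (c : R[i]) u v, P u -> P v ->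
        j (fun x => c * u x + v x) = c *: j u + j v,
      forall u, P u -> `|j u| = (N u)%:C
    & closure (j @` P) = setT].

Definition is_hilbert (V : completeNormedModType R[i])
    (dotV : {dot V for Num.conj}) :=
  forall u, `|u| ^+ 2 = dotV u u.

Definition is_HSL (H : completeNormedModType R[i])
    (dotH : {dot H for Num.conj}) (j : cfun -> H) :=
  [/\ is_hilbert dotH, is_completion H1S SL_norm j
    & forall u v, H1S u -> H1S v -> dotH (j u) (j v) = SL_form u v].

(* cls f is the class, modulo equality a.e., of the square-integrable f. *)
Definition is_L2 (L2 : completeNormedModType R[i])
    (dotL2 : {dot L2 for Num.conj}) (cls : cfun -> L2) :=
  [/\ is_hilbert dotL2,
      forall (c : R[i]) f g, L2_fun lam D f -> L2_fun lam D g ->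
        cls (fun x => c * f x + g x) = c *: cls f + cls g,
      forall f g, L2_fun lam D f -> L2_fun lam D g ->
        dotL2 (cls f) (cls g) = L2_prod lam D f g
    & cls @` L2_fun lam D = setT].

Definition is_HSL_neg (Hm : completeNormedModType R[i]) (jm : cfun -> Hm) :=
  is_completion H1S SL_neg_norm jm.

(* The pairing of H_SL with H^-_SL: the limit of (v, u_k) in L^2 along any
   sequence u_k in H^1(D,S) which converges to w in H^-_SL. *)
Definition pairing (H L2 Hm : completeNormedModType R[i])
    (dotL2 : {dot L2 for Num.conj}) (cls : cfun -> L2) (jm : cfun -> Hm)
    (iota : H -> L2) (v : H) (w : Hm) : R[i] :=
  xget 0 [set c | exists u_ : nat -> cfun,
    [/\ forall k, H1S (u_ k), jm (u_ k) @[k --> \oo] --> w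
      & (dotL2 (iota v) (cls (u_ k)) : R[i]^o) @[k --> \oo] --> (c : R[i]^o)]].

End SturmLiouville.

Section Operators.
Variable R : realType.

Definition compact_op (V W : normedModType R[i]) (K : V -> W) :=
  precompact (K @` [set x | `|x| <= 1]).

Definition lin_span (V : lmodType R[i]) (E : set V) : set V :=
  [set x | exists (k : nat) (c : 'I_k -> R[i]) (e : 'I_k -> V),
    (forall i, E (e i)) /\ x = \sum_(i < k) c i *: e i].

Definition has_dim (V : lmodType R[i]) (W : set V) (m : nat) :=
  exists e : 'I_m -> V,
    (forall c : 'I_m -> R[i], \sum_(i < m) c i *: e i = 0 -> forall i, c i = 0)
    /\ W = [set x | exists c : 'I_m -> R[i], x = \sum_(i < m) c i *: e i].

Definition is_adjoint (V : normedModType R[i]) (dotV : V -> V -> R[i])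
    (K K' : {linear V -> V}) :=
  continuous K' /\ forall u v, dotV (K u) v = dotV u (K' v).

(* A is the nonnegative square root of K* K. *)
Definition is_abs (V : normedModType R[i]) (dotV : V -> V -> R[i])
    (K A : {linear V -> V}) :=
  [/\ continuous A, forall u, 0 <= dotV (A u) u, is_adjoint dotV A A
    & exists2 K' : {linear V -> V}, is_adjoint dotV K K' &
      forall u, A (A u) = K' (K u)].

(* s lists the eigenvalues of (K* K)^(1/2) in nonincreasing order, the positive
   ones with their multiplicities; it is padded with zeros if there are only
   finitely many positive ones. *)
Definition s_numbers (V : normedModType R[i]) (dotV : V -> V -> R[i])
    (K : {linear V -> V}) (s : nat -> R) :=
  [/\ forall k, 0 <= s k,
      forall k l, (k <= l)%N -> s l <= s k
    & exists2 A : {linear V -> V}, is_abs dotV K A &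
      forall t : R, 0 < t -> exists idx : seq nat,
        [/\ uniq idx, forall k, k \in idx <-> s k = t
          & has_dim [set u | A u = t%:C *: u] (size idx)]].

Definition schatten (V : normedModType R[i]) (dotV : V -> V -> R[i]) (p : R)
    (K : V -> V) :=
  compact_op K /\
  exists2 K1 : {linear V -> V}, K =1 K1 &
  exists2 s, s_numbers dotV K1 s &
    (\sum_(0 <= k <oo) (s k `^ p)%:E < +oo)%E.

Definition finite_order (V : normedModType R[i]) (dotV : V -> V -> R[i])
    (K : V -> V) :=
  exists2 p : R, 0 < p & schatten dotV p K.

Definition is_eigenvalue (V : lmodType R[i]) (K : V -> V) (l : R[i]) :=
  exists2 u, u != 0 & K u = l *: u.

Definition root_functions (V : lmodType R[i]) (K : V -> V) : set V :=
  [set u | exists (l : R[i]) (m : nat),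
    is_eigenvalue K l /\ iter m (fun w => K w - l *: w) u = 0].

(* Completeness, in a space V embedded by e, of a system E of elements of W. *)
Definition complete_in (V : normedModType R[i]) (W : lmodType R[i])
    (e : V -> W) (E : set W) :=
  E `<=` range e /\ closure (lin_span (e @^-1` E)) = setT.

End Operators.

(* Main.v *)
(* Write [P = P1], [Q = Q1], [delta = dL L0^-1], so that [P (1 + delta) = Q], with
   [Q] compact, symmetric and positive on [H^-_SL]. Let [M] be the closed span of
   the root functions of [P], [N] its orthogonal complement and [E] the projector
   onto [N]. Instead of estimating the resolvent of a Volterra operator by
   complex analysis, we produce a root function outside [M] when [N] is nonzero:
   it suffices to solve [x = z E Q x - E delta x] with a unit vector [x] of [N].

   Let [e_k] be the eigenvectors of [E Q] on [N], with eigenvalues [q_k]; min-max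
   gives [q_k <= s_k (Q)], hence [sum q_k^h <= K] for some [h = 2^(a+1)]. On the
   span of [e_0, ..., e_n], the shift by a large [t] turns the equation into the
   matrix eigenvalue problem [R y = mu (1 + F) y] with [R = diag (q_k / (1 + t q_k))]
   and [F] as small as we please, uniformly in [n]. Hoelder's inequality for traces
   of words in [R] and contractions bounds [sum |mu_k|^h] from above, and bounds
   [|sum mu_k^(2h)| = |tr ((1 + F)^-1 R)^(2h)|] from below by half of [tr R^(2h)];
   so some [mu] stays away from [0] as [n] grows, and compactness gives [x]. *)
Require Import Defs.
From HB Require Import structures.
From mathcomp Require Import all_boot all_order all_algebra.
From mathcomp Require Import complex.
From mathcomp Require Import all_classical all_reals all_analysis.
From mathcomp Require Import spectral sesquilinear.
From mathcomp Require Import ring lra zify.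
Set Implicit Arguments.
Unset Strict Implicit.
Unset Printing Implicit Defensive.
Import Order.TTheory GRing.Theory Num.Theory.
Import numFieldNormedType.Exports.
Local Open Scope classical_set_scope.
Local Open Scope ring_scope.
Local Open Scope complex_scope.

(** * Traces of words in positive matrices and contractions *)

Section HoelderTrace.
Local Open Scope sesquilinear_scope.
Variable C : numClosedFieldType.

(** [(1 + F)^-1 R] is not normal and could a priori be nearly nilpotent, so its eigenvalues are
    reached only through traces, and every bound must be free of the dimension [n]. This works
    because errors are measured against [tr R^(2h)] itself, and because two exponents are compared:
    [sum |mu|^(2h) <= max |mu|^h * sum |mu|^h], where the last sum is at most [2^h K] and the left
    side is at least a fixed fraction of the [2h]-th power of the first entry of [R], which is the
    same for all [n]. The exponent is a power of two because Hoelder's inequality for words is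
    proved by halving their length. The admissible size of [F] depends on [h] alone; the shift by
    [t] provides it, as [delta] is small far out in the eigenbasis and [(1 + t A)^-1] damps the
    finitely many remaining directions.

    A separate obstacle is that the scalar product of [H^-_SL] is transported from [H_SL] by
    [L0inv]: its norm must be compared with the given one. The bounded inverse theorem is used twice
    for this, first on [Linv], then on [L0]. *)

Definition hsnorm2 m n (A : 'M[C]_(m, n)) : C := \sum_i \sum_j `|A i j| ^+ 2.

Lemma hsnorm2_ge0 m n (A : 'M[C]_(m, n)) : 0 <= hsnorm2 A.
Proof. by apply: sumr_ge0 => i _; apply: sumr_ge0 => j _; rewrite exprn_ge0. Qed.

Lemma hsnorm2E m n (A : 'M[C]_(m, n)) : hsnorm2 A = \tr (A^t* *m A).
Proof.
rewrite /hsnorm2 exchange_big /mxtrace; apply: eq_bigr => j _.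
rewrite mxE; apply: eq_bigr => i _; by rewrite !mxE normCK mulrC.
Qed.

Lemma hsnorm2_col m n (A : 'M[C]_(m, n)) : hsnorm2 A = \sum_j hsnorm2 (col j A).
Proof.
rewrite /hsnorm2 exchange_big; apply: eq_bigr => j _; apply: eq_bigr => i _.
by rewrite big_ord1 mxE.
Qed.

Lemma hsnorm2_eq0 m n (A : 'M[C]_(m, n)) : hsnorm2 A = 0 -> A = 0.
Proof.
move=> h; apply/matrixP => i j; rewrite mxE.
have /eqP := h; rewrite psumr_eq0; last by move=> k _; apply: sumr_ge0 => l _; rewrite exprn_ge0.
move=> /allP/(_ i (mem_index_enum _)) /=; rewrite psumr_eq0; last by move=> l _; rewrite exprn_ge0.
by move=> /allP/(_ j (mem_index_enum _)) /=; rewrite expf_eq0 /= normr_eq0 => /eqP.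
Qed.

Lemma amgm (x y : C) : 0 <= x -> 0 <= y -> x * y <= (x ^+ 2 + y ^+ 2) / 2.
Proof.
move=> x0 y0; rewrite ler_pdivlMr ?ltr0n // -subr_ge0.
have -> : x ^+ 2 + y ^+ 2 - x * y * 2 = (x - y) ^+ 2.
  by rewrite sqrrB mulr_natr addrAC.
by rewrite real_exprn_even_ge0 // rpredB // ger0_real.
Qed.

(** Cauchy-Schwarz for the Hilbert-Schmidt product, with the arithmetic mean in place of the
    geometric one; nothing is lost for words, where both terms are bounded by the same [K]. *)
Lemma mxtrace_mul_le m n (A : 'M[C]_(m, n)) (B : 'M[C]_(n, m)) :
  `|\tr (A *m B)| <= (hsnorm2 A + hsnorm2 B) / 2.
Proof.
have -> : hsnorm2 B = \sum_i \sum_j `|B j i| ^+ 2 by rewrite /hsnorm2 exchange_big.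
rewrite -big_split mulr_suml /= (le_trans (ler_norm_sum _ _ _)) //.
apply: ler_sum => i _; rewrite mxE -big_split mulr_suml /=.
rewrite (le_trans (ler_norm_sum _ _ _)) //; apply: ler_sum => j _.
by rewrite normrM amgm.
Qed.

Section Square.
Variable n : nat.
Implicit Types (A B U P X : 'M[C]_n).

(** An operator norm bound, tested on matrices of every width so that it applies directly inside
    Hilbert-Schmidt norms of products; by [mxbounded_col] columns suffice. *)
Definition mxbounded (b : C) B :=
  forall p (A : 'M[C]_(n, p)), hsnorm2 (B *m A) <= b ^+ 2 * hsnorm2 A.

Lemma mxbounded_col b B :
  (forall x : 'cV[C]_n, hsnorm2 (B *m x) <= b ^+ 2 * hsnorm2 x) -> mxbounded b B.
Proof.
move=> h p A; rewrite hsnorm2_col (hsnorm2_col A) mulr_sumr.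
by apply: ler_sum => j _; rewrite colE -mulmxA -colE.
Qed.

Lemma mxbounded1 : mxbounded 1 1%:M.
Proof. by move=> p A; rewrite mul1mx expr1n mul1r. Qed.

(** For [Y = B^t* A] one has [hsnorm2 Y = tr (A^t* B Y)], at most the mean of [hsnorm2 A] and
    [hsnorm2 (B Y) <= hsnorm2 Y]; half of [hsnorm2 Y] is then absorbed on the left. *)
Lemma contraction_adj B : mxbounded 1 B -> mxbounded 1 (B^t*).
Proof.
move=> hB p A; set Y := B^t* *m A; rewrite expr1n mul1r.
have hY : hsnorm2 Y = \tr (A^t* *m (B *m Y)).
  by rewrite hsnorm2E {1}/Y trmx_mul map_mxM trmxCK mulmxA.
have := mxtrace_mul_le (A^t*) (B *m Y); rewrite -hY ger0_norm ?hsnorm2_ge0 //.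
have -> : hsnorm2 (A^t*) = hsnorm2 A.
  by rewrite hsnorm2E trmxCK mxtrace_mulC -hsnorm2E.
have := hB _ Y; rewrite expr1n mul1r => h1 h2.
have h3 : hsnorm2 Y <= (hsnorm2 A + hsnorm2 Y) / 2.
  by apply: (le_trans h2); rewrite ler_pM2r ?invr_gt0 ?ltr0n // lerD2l.
move: h3; rewrite ler_pdivlMr ?ltr0n // mulr_natr mulr2n lerD2r //.
Qed.

(** Positivity is recorded by a spectral decomposition, from which powers and their traces are read
    off. *)
Definition psdmx P := exists2 U, U \is unitarymx &
  exists2 d : 'rV[C]_n, (forall i, 0 <= d 0 i) & P = U^t* *m diag_mx d *m U.


Lemma expmx_conj U (d : 'rV[C]_n) k : U \is unitarymx ->
  (U^t* *m diag_mx d *m U) ^+ k = U^t* *m diag_mx (\row_i d 0 i ^+ k) *m U.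
Proof.
move=> hU; elim: k => [|k IHk].
  rewrite expr0 (_ : diag_mx _ = 1%:M) ?mulmx1.
    by rewrite -invmx_unitary // mulVmx ?unitarymx_unit.
  by apply/matrixP => i j; rewrite !mxE expr0.
rewrite exprS IHk -mulmxE !mulmxA mulmxtVK //; congr (_ *m _); rewrite -!mulmxA.
congr (_ *m _); rewrite mulmx_diag; congr diag_mx; apply/rowP => i.
by rewrite !mxE exprS.
Qed.

Lemma mxtrace_psd U (d : 'rV[C]_n) : U \is unitarymx ->
  \tr (U^t* *m diag_mx d *m U) = \sum_i d 0 i.
Proof.
move=> hU; rewrite mxtrace_mulC mulmxA (unitarymxP hU) mul1mx mxtrace_diag.
by [].
Qed.

Lemma psdmx_sqr P : psdmx P -> psdmx (P ^+ 2).
Proof.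
move=> [U hU [d d0 ->]]; exists U => //; exists (\row_i d 0 i ^+ 2).
  by move=> i; rewrite mxE exprn_ge0.
by rewrite expmx_conj.
Qed.

Lemma psdmx_trX_ge0 P k : psdmx P -> 0 <= \tr (P ^+ k).
Proof.
move=> [U hU [d d0 ->]]; rewrite expmx_conj // mxtrace_psd //.
by apply: sumr_ge0 => i _; rewrite mxE exprn_ge0.
Qed.

Lemma diag_adj (d : 'rV[C]_n) : (forall i, 0 <= d 0 i) -> (diag_mx d)^t* = diag_mx d.
Proof.
move=> d0; rewrite tr_diag_mx map_diag_mx; congr diag_mx; apply/rowP => i.
by rewrite !mxE; exact: geC0_conj.
Qed.

Lemma psdmx_adj P : psdmx P -> P^t* = P.
Proof.
move=> [U hU [d d0 ->]].
by rewrite !trmx_mul !map_mxM trmxCK diag_adj // !mulmxA.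
Qed.

Lemma hsnorm2_conj U p (A : 'M[C]_(n, p)) : U \is unitarymx ->
  hsnorm2 (U *m A) = hsnorm2 A.
Proof.
by move=> hU; rewrite !hsnorm2E trmx_mul map_mxM -mulmxA (mulmxA _ U) -{2}[U]trmxCK
  (unitarymxP _) ?trmxC_unitary // mul1mx.
Qed.

(** A unitary [U] diagonalises [X^t* X], so the columns of [Z = X U^t*] are orthogonal with squared
    lengths [s]. Rescaling them gives [W], a partial isometry, without any invertibility of [X]. *)
Lemma polar_decomposition X : exists W P,
  [/\ mxbounded 1 W, psdmx P, X = W *m P & P ^+ 2 = X^t* *m X].
Proof.
set A := X^t* *m X.
have hA : A \is hermsymmx.
  by apply/is_hermitianmxP; rewrite expr0 scale1r /A trmx_mul map_mxM trmxCK.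
have /orthomx_spectralP := hermitian_normalmx hA.
set U := spectralmx A; set s := spectral_diag A.
have hU : U \is unitarymx := spectral_unitarymx A.
rewrite invmx_unitary // => eA.
set Z := X *m U^t*.
have eZ : Z^t* *m Z = diag_mx s.
  rewrite /Z trmx_mul map_mxM trmxCK !mulmxA -(mulmxA U) -/A eA !mulmxA.
  by rewrite (unitarymxP hU) mul1mx mulmxtVK.
have s0 i : 0 <= s 0 i.
  have /matrixP/(_ i i) := eZ; rewrite [in RHS]mxE eqxx mulr1n => <-.
  by rewrite mxE sumr_ge0 // => k _; rewrite !mxE mulrC -normCK exprn_ge0.
pose d : 'rV[C]_n := \row_i sqrtC (s 0 i).
(* Since [0^-1 = 0], this is the pseudo-inverse of [d]. *)
pose d' : 'rV[C]_n := \row_i (sqrtC (s 0 i))^-1.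
have d0 i : 0 <= d 0 i by rewrite mxE sqrtC_ge0.
have d'0 i : 0 <= d' 0 i by rewrite mxE invr_ge0 sqrtC_ge0.
have XE : X = Z *m U by rewrite /Z mulmxKtV.
have hZ p (D : 'M[C]_(n, p)) : hsnorm2 (Z *m D) = \tr (D^t* *m (diag_mx s *m D)).
  by rewrite hsnorm2E trmx_mul map_mxM -eZ !mulmxA.
exists (Z *m diag_mx d' *m U), (U^t* *m diag_mx d *m U); split.
- move=> p B; rewrite expr1n mul1r -(hsnorm2_conj B hU) -2!mulmxA.
  move: (U *m B) => D; rewrite hZ.
  have -> : \tr ((diag_mx d' *m D)^t* *m (diag_mx s *m (diag_mx d' *m D))) =
    hsnorm2 (diag_mx (\row_i (s 0 i != 0)%:R) *m D).
    rewrite hsnorm2E !trmx_mul !map_mxM !diag_adj //; last first.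
      by move=> i; rewrite mxE ler0n.
    rewrite -!mulmxA; congr (\tr (_ *m _)); rewrite !mulmxA !mulmx_diag.
    congr (_ *m _); congr diag_mx; apply/rowP => i; rewrite !mxE.
    have [->|sn] := eqVneq (s 0 i) 0; first by rewrite sqrtC0 invr0 !mulr0.
    have q0 : sqrtC (s 0 i) != 0 by rewrite sqrtC_eq0.
    rewrite -[in X in _ * X * _](sqrtCK (s 0 i)) expr2 mulrA mulVf // mul1r mulfV //.
    by rewrite mulr1.
  rewrite /hsnorm2; apply: ler_sum => i _; apply: ler_sum => j _.
  rewrite mul_diag_mx !mxE; case: eqVneq => _; last by rewrite mul1r.
  by rewrite mul0r normr0 expr0n exprn_ge0.
- by exists U => //; exists d.
- set e := (\row_j (d' 0 j * d 0 j) : 'rV[C]_n).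
  have -> : Z *m diag_mx d' *m U *m (U^t* *m diag_mx d *m U) = Z *m diag_mx e *m U.
    by rewrite -mulmx_diag !mulmxA mulmxtVK.
  have -> : Z *m diag_mx e = Z; last exact: XE.
  (* [e] is the indicator of [s 0 i != 0]; a column of [Z] discarded by it has squared length
     [s 0 i = 0], so [diag_mx s] annihilates the difference. *)
  apply/esym/eqP; rewrite -subr_eq0; apply/eqP; apply: hsnorm2_eq0.
  rewrite -{1}(mulmx1 Z) -mulmxBr hZ.
  rewrite mulmxBr mulmx1 mulmx_diag (_ : diag_mx s - _ = 0) ?mulmx0 ?mxtrace0 //.
  apply/matrixP => i j; rewrite !mxE.
  have [->|sn] := eqVneq (s 0 i) 0; first by rewrite mul0r subrr.
  by rewrite mulVf ?sqrtC_eq0 // mulr1 subrr.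
- rewrite expmx_conj // eA; congr (_ *m diag_mx _ *m _); apply/rowP => i.
by rewrite !mxE sqrtCK.
Qed.

Lemma prod_pairs (F : nat -> 'M[C]_n) m :
  \prod_(i < m.*2) F i = \prod_(i < m) (F i.*2 * F i.*2.+1).
Proof.
elim: m => [|m IH]; first by rewrite !big_ord0.
by rewrite doubleS !big_ord_recr /= IH mulrA.
Qed.

(* Doubling: group consecutive factors as [R B R' = W P] (polar decomposition);
   the trace of [P ^+ h] is itself a word in [R ^+ 2] and [R' ^+ 2]. *)
Lemma mxtrace_word_le a (K : C) (B P : nat -> 'M[C]_n) :
  let h := (2 ^ a.+1)%N in
  (forall i, (i < h)%N -> [/\ mxbounded 1 (B i), psdmx (P i) & \tr (P i ^+ h) <= K]) ->
  `|\tr (\prod_(i < h) (B i * P i))| <= K.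
Proof.
elim: a B P => [|a IH] B P h H.
  have {}H i : (i < 2)%N -> hsnorm2 (B i * P i) <= K.
    move=> /H [hB hP]; apply: le_trans; apply: (le_trans (hB _ _)).
    by rewrite expr1n mul1r hsnorm2E psdmx_adj // expr2.
  rewrite /h !big_ord_recr big_ord0 /= mul1r (le_trans (mxtrace_mul_le _ _)) //.
  rewrite ler_pdivrMr ?ltr0n // mulr_natr mulr2n lerD // H //.
have hE : h = (2 ^ a.+1).*2 by rewrite /h expnS mul2n.
set m := (2 ^ a.+1)%N in IH hE *.
have mE : m = (2 ^ a).*2 by rewrite /m expnS mul2n.
have hlt i : (i < m)%N -> (i.*2 < h)%N /\ (i.*2.+1 < h)%N.
  move=> lim; have : (i.*2.+1 < h)%N by rewrite hE -doubleS leq_double.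
  by move=> hi; split => //; apply: leq_trans hi.
rewrite hE (prod_pairs (fun i => B i * P i)).
have /choice [WP hWP] : forall i : nat, exists WP : 'M[C]_n * 'M[C]_n,
    [/\ mxbounded 1 WP.1, psdmx WP.2, P i.*2 * B i.*2.+1 * P i.*2.+1 = WP.1 *m WP.2
      & WP.2 ^+ 2 = (P i.*2 * B i.*2.+1 * P i.*2.+1)^t* *m (P i.*2 * B i.*2.+1 * P i.*2.+1)].
  move=> i; have [W [Q []]] := polar_decomposition (P i.*2 * B i.*2.+1 * P i.*2.+1).
  by exists (W, Q).
have -> : \prod_(i < m) (B i.*2 * P i.*2 * (B i.*2.+1 * P i.*2.+1)) =
          \prod_(i < m) (B i.*2 * (WP i).1 * (WP i).2).
  apply: eq_bigr => i _; have [_ _ e _] := hWP i.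
  by rewrite -!mulrA; congr (_ * _); rewrite !mulrA e.
apply: (IH (fun i => B i.*2 * (WP i).1) (fun i => (WP i).2)) => i lim.
have [hW hQ e e2] := hWP i; have [h1 h2] := hlt i lim.
have [B1 P1 K1] := H _ h1; have [B2 P2 K2] := H _ h2.
split=> //.
  move=> p A; rewrite -mulmxE -mulmxA (le_trans (B1 _ _)) // expr1n mul1r.
  by rewrite (le_trans (hW _ _)) ?expr1n ?mul1r.
move: e2; set R1 := P i.*2 in P1 K1 *; set R2 := P i.*2.+1 in P2 K2 *.
set Bi := B i.*2.+1 in B2 *.
rewrite -!mulmxE !trmx_mul !map_mxM (psdmx_adj P1) (psdmx_adj P2) => e2.
(* The square of the positive factor is [R2 Z]. Moving [R2] to the end by cyclicity of the trace
   leaves powers of [Bi^t* R1^2 Bi R2^2]: a word of length [m] whose positive letters are squares,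
   and [(R^2)^m = R^h] returns the hypothesis on traces. *)
pose Z := Bi^t* *m R1 *m R1 *m Bi *m R2.
have trE k : \tr ((R2 *m Z) ^+ k.+1) = \tr ((Z *m R2) ^+ k.+1).
  have -> : (R2 *m Z) ^+ k.+1 = R2 *m ((Z *m R2) ^+ k *m Z).
    elim: k => [|k IHk]; first by rewrite expr1 expr0 mul1mx.
    by rewrite exprS IHk exprS -!mulmxE !mulmxA.
  by rewrite mxtrace_mulC -mulmxA mulmxE -exprSr.
have trP : \tr ((WP i).2 ^+ m) = \tr ((Z *m R2) ^+ (2 ^ a)).
  rewrite mE -mul2n exprM e2 (_ : R2 *m (Bi^t* *m R1) *m _ = R2 *m Z).
    by rewrite -(prednK (expn_gt0 2 a)) trE.
  by rewrite /Z !mulmxA.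
pose BB (k : nat) := if odd k then Bi else Bi^t*.
pose PP (k : nat) := if odd k then R2 ^+ 2 else R1 ^+ 2.
have e3 : (Z *m R2) ^+ (2 ^ a) = \prod_(k < m) (BB k * PP k).
  rewrite mE (prod_pairs (fun k => BB k * PP k)) -[X in _ ^+ X]card_ord -prodr_const.
  apply: eq_bigr => k _; rewrite /BB /PP /= odd_double /= !expr2 /Z -!mulmxE !mulmxA.
  by [].
rewrite -(ger0_norm (psdmx_trX_ge0 m hQ)) trP.
rewrite e3; apply: IH => k _; rewrite /BB /PP; case: ifP => _; split => //.
- exact: psdmx_sqr.
- by rewrite -exprM mul2n -hE.
- exact: contraction_adj.
- exact: psdmx_sqr.
- by rewrite -exprM mul2n -hE.
Qed.


Lemma mxbounded_scale b c B : mxbounded b B -> mxbounded (`|c| * b) (c *: B).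
Proof.
move=> hB p A; rewrite -scalemxAl exprMn -mulrA.
have -> : hsnorm2 (c *: (B *m A)) = `|c| ^+ 2 * hsnorm2 (B *m A).
  rewrite /hsnorm2 mulr_sumr; apply: eq_bigr => i _; rewrite mulr_sumr.
  by apply: eq_bigr => j _; rewrite mxE normrM exprMn.
by rewrite ler_wpM2l ?exprn_ge0.
Qed.

Lemma mxbounded_le b c B : 0 <= b -> b <= c -> mxbounded b B -> mxbounded c B.
Proof.
move=> b0 bc hB p A; rewrite (le_trans (hB _ _)) // ler_wpM2r ?hsnorm2_ge0 //.
by rewrite lerXn2r // nnegrE // (le_trans b0).
Qed.

Lemma prod_scale (b : nat -> C) (F : nat -> 'M[C]_n) m :
  \prod_(i < m) (b i *: F i) = (\prod_(i < m) b i) *: \prod_(i < m) F i.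
Proof.
elim: m => [|m IH]; first by rewrite !big_ord0 scale1r.
by rewrite !big_ord_recr /= IH -!mulmxE -scalemxAl -scalemxAr scalerA.
Qed.

Lemma mxtrace_word_scale_le a (K : C) (b : nat -> C) (B P : nat -> 'M[C]_n) :
  let h := (2 ^ a.+1)%N in
  (forall i, (i < h)%N ->
     [/\ 0 < b i, mxbounded (b i) (B i), psdmx (P i) & \tr (P i ^+ h) <= K]) ->
  `|\tr (\prod_(i < h) (B i * P i))| <= (\prod_(i < h) b i) * K.
Proof.
move=> h H.
have -> : \prod_(i < h) (B i * P i) = \prod_(i < h) (b i *: ((b i)^-1 *: B i * P i)).
  apply: eq_bigr => i _; have [b0 _ _ _] := H _ (ltn_ord i).
  by rewrite -!mulmxE -scalemxAl scalerA divff ?gt_eqF // scale1r.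
rewrite (prod_scale b (fun i => (b i)^-1 *: B i * P i)) mxtraceZ normrM.
rewrite ger0_norm; last by apply: prodr_ge0 => i _; have [/ltW] := H _ (ltn_ord i).
rewrite ler_wpM2l //; first by apply: prodr_ge0 => i _; have [/ltW] := H _ (ltn_ord i).
apply: (mxtrace_word_le (B := fun i => (b i)^-1 *: B i)) => i /H[b0 hB hP hK].
split=> //; have := mxbounded_scale (b i)^-1 hB.
by rewrite ger0_norm ?invr_ge0 ?ltW // mulVf ?gt_eqF.
Qed.

Lemma prod_telescope (X Y : nat -> 'M[C]_n) m :
  let Z i k := if (k < i)%N then X k else if k == i then X k - Y k else Y k in
  \prod_(k < m) X k - \prod_(k < m) Y k = \sum_(i < m) \prod_(k < m) Z i k.
Proof.
move=> Z; elim: m => [|m IH]; first by rewrite !big_ord0 subrr.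
rewrite [RHS]big_ord_recr [X in X - _]big_ord_recr [X in _ - X]big_ord_recr /=.
have -> : \prod_(k < m.+1) Z m k = \prod_(k < m) X k * (X m - Y m).
  rewrite big_ord_recr /= {2}/Z ltnn eqxx; congr (_ * _).
  by apply: eq_bigr => k _; rewrite /Z ltn_ord.
have -> : \sum_(i < m) \prod_(k < m.+1) Z i k = \sum_(i < m) \prod_(k < m) Z i k * Y m.
  apply: eq_bigr => i _; rewrite big_ord_recr /= {2}/Z.
  by rewrite ltnNge (ltnW (ltn_ord i)) /= gtn_eqF.
rewrite -mulr_suml -IH mulrBr mulrBl addrC addrA subrK.
by [].
Qed.

(** Replacing [A R] by [R] one letter at a time gives [h] words with a single letter [(A - 1) R];
    Hoelder bounds each by a multiple of [tr (R^h)] itself. Such a relative error does not depend on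
    the size of the matrices. *)
Lemma trace_perturbation a (A R : 'M[C]_n) (e : C) :
  let h := (2 ^ a.+1)%N in
  psdmx R -> 0 < e -> mxbounded 2 A -> mxbounded e (A - 1%:M) ->
  `|\tr ((A *m R) ^+ h) - \tr (R ^+ h)| <= (h%:R * 2 ^+ h * e) * \tr (R ^+ h).
Proof.
move=> h hR e0 hA hE; rewrite -raddfB /=.
have -> : (A *m R) ^+ h - R ^+ h = \prod_(i < h) (A *m R) - \prod_(i < h) R.
  by rewrite !prodr_const !card_ord.
rewrite (prod_telescope (fun=> A *m R) (fun=> R)) raddf_sum.
rewrite (le_trans (ler_norm_sum _ _ _)) //.
have -> : h%:R * 2 ^+ h * e * \tr (R ^+ h) = \sum_(i < h) (2 ^+ h * e * \tr (R ^+ h)).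
  by rewrite sumr_const card_ord -[RHS]mulr_natl !mulrA.
apply: ler_sum => i _.
pose B k : 'M[C]_n := if (k < i)%N then A else if (k == i)%N then A - 1%:M else 1%:M.
pose b (k : nat) : C := if k == i :> nat then e else 2.
set W := \prod_(k < h) _.
have {W}-> : W = \prod_(k < h) (B k * R).
  apply: eq_bigr => k _; rewrite /B; case: ifP => // _; case: ifP => // _;
    by rewrite -?mulmxE ?mulmxBl mul1mx.
have hb k : 0 < b k by rewrite /b; case: ifP => //; rewrite ltr0n.
have /le_trans -> // : `|\tr (\prod_(k < h) (B k * R))| <= (\prod_(k < h) b k) * \tr (R ^+ h).
  apply: (@mxtrace_word_scale_le a _ b B (fun=> R)) => k _; split => //.
  rewrite /b /B; case: ltngtP => // _.
  by apply: (mxbounded_le _ _ mxbounded1); rewrite ?ler01 ?ler1n.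
rewrite ler_wpM2r ?psdmx_trX_ge0 // (bigD1 i) //= {1}/b eqxx mulrC.
rewrite ler_wpM2r ?(ltW e0) //.
rewrite (eq_bigr (fun=> 2)) => [|k /negPf ki]; last by rewrite /b; move: ki; rewrite -val_eqE /= => ->.
(* Only [h - 1] letters contribute a factor [2]; the exponent is rounded up to [h]. *)
rewrite prodr_const; apply: ler_weXn2l; first by rewrite ler1n.
by rewrite (leq_trans (max_card _)) // card_ord.
Qed.

Lemma trig_mulmx (S T : 'M[C]_n) : is_trig_mx S -> is_trig_mx T ->
  is_trig_mx (S *m T) /\ forall i, (S *m T) i i = S i i * T i i.
Proof.
move=> /is_trig_mxP hS /is_trig_mxP hT; split.
  apply/is_trig_mxP => i j ij; rewrite mxE big1 // => k _.
  have [ik|ki] := ltnP i k; first by rewrite hS ?mul0r.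
  by rewrite (hT k j) ?mulr0 // (leq_ltn_trans ki).
move=> i; rewrite mxE (bigD1 i) //= big1 ?addr0 // => k /negPf ki.
have [ik|ik|/val_inj/esym/eqP] := ltngtP i k; last by rewrite ki.
  by rewrite hS ?mul0r.
by rewrite (hT k i) ?mulr0.
Qed.

Lemma trig_exp (T : 'M[C]_n) k : is_trig_mx T ->
  is_trig_mx (T ^+ k) /\ forall i, (T ^+ k) i i = T i i ^+ k.
Proof.
move=> hT; elim: k => [|k [IH1 IH2]].
  by split=> [|i]; rewrite expr0 ?scalar_mx_is_trig // mxE eqxx.
have [h1 h2] := trig_mulmx hT IH1; rewrite exprS -mulmxE; split => // i.
by rewrite h2 IH2 exprS.
Qed.

Lemma expmx_unitary_conj U (T : 'M[C]_n) k : U \is unitarymx ->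
  (U^t* *m T *m U) ^+ k = U^t* *m T ^+ k *m U.
Proof.
move=> hU; elim: k => [|k IHk].
  by rewrite !expr0 mulmx1 -invmx_unitary // mulVmx ?unitarymx_unit.
by rewrite !exprS IHk -!mulmxE !mulmxA mulmxtVK.
Qed.

(** In the Schur basis a diagonal matrix of phases turns each [T i i ^+ h] into its modulus, so the
    sum is the trace of [Phi (A R)^h]. That is a word with [Phi] absorbed in its first letter, and
    Hoelder applies. *)
Lemma sum_eigenvalues_le a (A R U T : 'M[C]_n) (K : C) :
  let h := (2 ^ a.+1)%N in
  U \is unitarymx -> is_trig_mx T -> A *m R = U^t* *m T *m U ->
  psdmx R -> mxbounded 2 A -> \tr (R ^+ h) <= K ->
  \sum_i `|T i i| ^+ h <= 2 ^+ h * K.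
Proof.
move=> h hU hT eT hR hA hK.
have [hTh dTh] := trig_exp h hT.
(* The phase of a zero eigenvalue is set to [1], which keeps [Phi] unitary. *)
pose c : 'rV[C]_n := \row_i (if T i i == 0 then 1 else `|T i i ^+ h| / T i i ^+ h).
pose Phi := U^t* *m diag_mx c *m U.
have cnorm i : `|c 0 i| = 1.
  rewrite mxE; case: eqVneq => [|t0]; first by rewrite normr1.
  by rewrite normrM normfV normr_id divff // normr_eq0 expf_eq0 negb_and t0 orbT.
have hPhi : mxbounded 1 Phi.
  move=> p B; rewrite expr1n mul1r /Phi -!mulmxA hsnorm2_conj ?trmxC_unitary //.
  rewrite -[leRHS](hsnorm2_conj _ hU) /hsnorm2.
  apply: ler_sum => i _; apply: ler_sum => j _.
  by rewrite mul_diag_mx mxE normrM cnorm mul1r.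
have e1 : \sum_i `|T i i| ^+ h = \tr (Phi *m (A *m R) ^+ h).
  rewrite eT expmx_unitary_conj // /Phi !mulmxA mulmxtVK // mxtrace_mulC !mulmxA.
  rewrite (unitarymxP hU) mul1mx /mxtrace; apply: eq_bigr => i _.
  rewrite mul_diag_mx !mxE dTh; case: eqVneq => [->|t0].
    by rewrite mul1r normr0 !expr0n.
  by rewrite normrX -mulrA mulVf ?mulr1 // expf_eq0 negb_and t0 orbT.
have e2 : 0 <= \sum_i `|T i i| ^+ h by apply: sumr_ge0 => i _; rewrite exprn_ge0.
rewrite -(ger0_norm e2) e1.
pose B (k : nat) := if k == 0%N then Phi *m A else A.
have -> : Phi *m (A *m R) ^+ h = \prod_(k < h) (B k * R).
  rewrite /h -(prednK (expn_gt0 2 a.+1)) big_ord_recl exprS -!mulmxE !mulmxA.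
  congr (_ *m _); rewrite -[X in _ ^+ X](card_ord (2 ^ a.+1).-1) -prodr_const.
  by apply: eq_bigr.
have /le_trans -> // : `|\tr (\prod_(k < h) (B k * R))| <= (\prod_(k < h) 2) * K.
  apply: (@mxtrace_word_scale_le a K (fun=> 2) B (fun=> R)) => k _.
  split => //; rewrite /B; case: eqP => // _ p D; rewrite -mulmxA (le_trans (hPhi _ _)) //.
  by rewrite expr1n mul1r.
by rewrite prodr_const card_ord.
Qed.

(** [T - T i i] is triangular with a zero on its diagonal, hence singular; the transpose appears
    because [det0P] yields row vectors. *)
Lemma trig_eigenvector (G U T : 'M[C]_n) i :
  U \is unitarymx -> is_trig_mx T -> G = U^t* *m T *m U ->
  exists2 y : 'cV[C]_n, y != 0 & G *m y = T i i *: y.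
Proof.
move=> hU hT eG.
have d0 : \det (T - (T i i)%:M) = 0.
  rewrite det_trig; last first.
    apply/is_trig_mxP => k l kl; rewrite !mxE (is_trig_mxP hT) // -val_eqE /= ltn_eqF //.
    by rewrite mulr0n subr0.
  by rewrite (bigD1 i) //= !mxE eqxx mulr1n subrr mul0r.
have /eqP/det0P[v v0 hv] : \det (T - (T i i)%:M)^T = 0 by rewrite det_tr.
exists (U^t* *m v^T).
  apply: contraNneq v0 => e; have : U *m (U^t* *m v^T) = 0 by rewrite e mulmx0.
  by rewrite mulmxA (unitarymxP hU) mul1mx => /(congr1 trmx); rewrite trmxK trmx0 => ->.
have e : T *m v^T = T i i *: v^T.
  apply/eqP; rewrite -subr_eq0 -[T i i *: _]mul_scalar_mx -mulmxBl.
  by rewrite -[X in X *m _]trmxK -trmx_mul hv trmx0.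
by rewrite eG !mulmxA mulmxtVK // -mulmxA e scalemxAr.
Qed.

(* With [A = (1 + F)^-1], the eigenvalues of [A R] satisfy
   [sum |mu|^h <= 2^h K] and [|tr (A R)^(2h)| >= tr R^(2h) / 2]; they cannot
   all be small. *)
Lemma pencil_eigenvalue a (r : 'rV[C]_n) (F : 'M[C]_n) (K e : C) (i0 : 'I_n) :
  let h := (2 ^ a.+1)%N in
  (forall i, 0 <= r 0 i) -> 0 < r 0 i0 -> \sum_i r 0 i ^+ h <= K ->
  0 < e -> e <= 2^-1 -> (h.*2)%:R * 2 ^+ h.*2 * (2 * e) <= 2^-1 -> mxbounded e F ->
  exists mu (y : 'cV[C]_n),
    [/\ y != 0, diag_mx r *m y = mu *: (y + F *m y)
      & r 0 i0 ^+ h.*2 / (4 * 2 ^+ h * K) <= `|mu| ^+ h].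
Proof.
move=> h; set H := h.*2 => r0 ri0 hK e0 e12 he hF.
have n0 : (0 < n)%N by case: n i0 {r F r0 ri0 hK hF} => [[]|].
pose R := diag_mx r.
have hR : psdmx R.
  exists 1%:M; first by apply/unitarymxP; rewrite trmx1 map_mx1 mulmx1.
  by exists r => //; rewrite trmx1 map_mx1 mulmx1 mul1mx.
have Rk k : \tr (R ^+ k) = \sum_i r 0 i ^+ k.
  have [hT dT] := trig_exp k (diag_mx_is_trig r).
  by apply: eq_bigr => i _; rewrite dT mxE eqxx mulr1n.
have e2 : e ^+ 2 <= 4^-1.
  rewrite (_ : 4^-1 = (2^-1 : C) ^+ 2); last by rewrite exprVn -natrX.
  by rewrite lerXn2r // nnegrE ?ltW ?invr_gt0 ?ltr0n.
have sum2 p (x y : 'M[C]_(n, p)) : hsnorm2 (x - y) <= 2 * (hsnorm2 x + hsnorm2 y).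
  rewrite /hsnorm2 -big_split mulr_sumr; apply: ler_sum => i _.
  rewrite -big_split mulr_sumr; apply: ler_sum => j _; rewrite !mxE /=.
  have h1 := ler_normB (x i j) (y i j).
  apply: (le_trans (_ : _ <= (`|x i j| + `|y i j|) ^+ 2)).
    by rewrite lerXn2r // nnegrE // addr_ge0.
  have := amgm (normr_ge0 (x i j)) (normr_ge0 (y i j)).
  rewrite ler_pdivlMr ?ltr0n //; move: `|x i j| `|y i j| => u v h2.
  have -> : (u + v) ^+ 2 = (u ^+ 2 + v ^+ 2) + u * v * 2 by ring.
  have -> : 2 * (u ^+ 2 + v ^+ 2) = (u ^+ 2 + v ^+ 2) + (u ^+ 2 + v ^+ 2) by ring.
  by rewrite lerD2l.
(* From [|x|^2 <= 2 |x + F x|^2 + 2 |F x|^2] and [e^2 <= 1/4], half of [|x|^2] is absorbed. Hence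
   [1 + F] is invertible and its inverse [A] has norm at most [2]. *)
have h1F p (x : 'M[C]_(n, p)) : hsnorm2 x <= 4 * hsnorm2 (x + F *m x).
  have := sum2 _ (x + F *m x) (F *m x); rewrite addrK mulrDr => h1.
  have h2 : 2 * hsnorm2 (F *m x) <= 2^-1 * hsnorm2 x.
    rewrite (_ : 2^-1 = 2 * 4^-1 :> C); last first.
      by rewrite (_ : 4 = 2 * 2 :> C) ?invfM ?mulVKf ?pnatr_eq0 // -natrM.
    rewrite -mulrA ler_pM2l ?ltr0n // (le_trans (hF _ _)) // ler_wpM2r //.
    exact: hsnorm2_ge0.
  have := le_trans h1 (lerD (lexx _) h2); rewrite -lerBlDr -{1}[hsnorm2 x]mul1r -mulrBl.
  rewrite (_ : 1 - 2^-1 = 2^-1 :> C); last first.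
    by rewrite {1}(splitr 1) mul1r addrK.
  by rewrite -ler_pdivlMl ?invr_gt0 ?ltr0n // invrK mulrA -natrM.
have unitF : (1%:M + F) \in unitmx.
  rewrite unitmxE unitfE -det_tr; apply/negP => /det0P[v v0 hv].
  have hv' : (1%:M + F) *m v^T = 0 by rewrite -[X in X *m _]trmxK -trmx_mul hv trmx0.
  have := h1F _ v^T; rewrite -{2}[v^T]mul1mx -mulmxDl hv'.
  rewrite [X in _ * X](_ : _ = 0) ?mulr0; last first.
    by apply: big1 => i _; apply: big1 => j _; rewrite mxE normr0 expr0n.
  move=> le0; have : hsnorm2 v^T = 0 by apply/eqP; rewrite eq_le le0 hsnorm2_ge0.
  by move/hsnorm2_eq0/(congr1 trmx); rewrite trmxK trmx0 => /eqP; rewrite (negPf v0).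
pose A := invmx (1%:M + F).
have AF : A + F *m A = 1%:M by rewrite -{1}[A]mul1mx -mulmxDl mulmxV.
have hA : mxbounded 2 A.
  move=> p x; rewrite -natrX; have := h1F _ (A *m x).
  by rewrite mulmxA -mulmxDl AF mul1mx.
have hA1 : mxbounded (2 * e) (A - 1%:M).
  have -> : A - 1%:M = - (A *m F).
    apply/eqP; rewrite subr_eq addrC -subr_eq opprK; apply/eqP.
    by rewrite -{1}[A]mulmx1 -mulmxDr mulVmx.
  move=> p x; rewrite mulNmx -mulmxA exprMn -mulrA.
  have -> : hsnorm2 (- (A *m (F *m x))) = hsnorm2 (A *m (F *m x)).
    by apply: eq_bigr => i _; apply: eq_bigr => j _; rewrite mxE normrN.
  rewrite (le_trans (hA _ _)) // ler_pM2l ?exprn_gt0 ?ltr0n //.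
have [U hU] := Schur (A *m R) n0.
rewrite /similar_to /= conjymx //; set T := _ *m _ *m _ => hT.
have eT : A *m R = U^t* *m T *m U.
  by rewrite /T !mulmxA mulmxKtV // -[U^t* *m U]/(_) -invmx_unitary // mulVmx
    ?unitarymx_unit // mul1mx.
have hK' : \tr (R ^+ h) <= K by rewrite Rk.
have S1 := sum_eigenvalues_le hU hT eT hR hA hK'.
have K0 : 0 < K.
  apply: lt_le_trans hK; rewrite (bigD1 i0) //= ltr_wpDr ?exprn_gt0 //.
  by apply: sumr_ge0 => i _; rewrite exprn_ge0.
(* [th * 2^h K] is a quarter of [r 0 i0 ^+ H]. If no eigenvalue exceeded this threshold,
   [tr (A R)^H] would be at most a quarter of [tr (R^H)] in modulus, while the perturbation bound
   puts it within half of [tr (R^H)] from [tr (R^H)]. *)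
set th := _ / _.
have [/existsP[i hi]|] := boolP [exists i, th <= `|T i i| ^+ h].
  have [y y0 hy] := trig_eigenvector i hU hT eT.
  exists (T i i), y; split => //.
  have /(congr1 (mulmx (1%:M + F))) := hy.
  rewrite -scalemxAr -mulmxA mulmxA [X in X *m _]mulmxDl mul1mx AF mul1mx => ->.
  by rewrite mulmxDl mul1mx.
rewrite negb_exists => /forallP hlt.
have {}hlt i : `|T i i| ^+ h <= th.
  have := hlt i; rewrite -real_ltNge ?ger0_real ?exprn_ge0 // => [/ltW //|].
  by rewrite /th divr_ge0 ?mulr_ge0 ?exprn_ge0 ?ler0n // ltW.
have HE : H = (2 ^ a.+2)%N by rewrite [RHS]expnS mul2n.
have S2 : `|\tr ((A *m R) ^+ H)| <= r 0 i0 ^+ H / 4.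
  have -> : \tr ((A *m R) ^+ H) = \sum_i T i i ^+ H.
    have [_ dT] := trig_exp H hT.
    rewrite eT expmx_unitary_conj // mxtrace_mulC mulmxA (unitarymxP hU) mul1mx.
    by apply: eq_bigr.
  rewrite (le_trans (ler_norm_sum _ _ _)) //.
  apply: (@le_trans _ _ (th * \sum_i `|T i i| ^+ h)).
    rewrite mulr_sumr; apply: ler_sum => i _.
    by rewrite normrX /H -addnn exprD ler_wpM2r ?exprn_ge0.
  apply: (le_trans (ler_wpM2l _ S1)).
    by rewrite /th divr_ge0 ?mulr_ge0 ?exprn_ge0 ?ler0n // ltW.
  have Y0 : (2 : C) ^+ h != 0 by rewrite expf_neq0 ?pnatr_eq0.
  rewrite /th; move: (2 ^+ h) (r 0 i0 ^+ H) Y0 => Y X Y0.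
  suff -> : X / (4 * Y * K) * (Y * K) = X / 4 by [].
  by field; rewrite Y0 gt_eqF.
have e20 : 0 < 2 * e by rewrite mulr_gt0 ?ltr0n.
have := trace_perturbation a.+1 hR e20 hA hA1; rewrite -HE => S3.
have trH0 : r 0 i0 ^+ H <= \tr (R ^+ H).
  rewrite Rk (bigD1 i0) //= lerDl; apply: sumr_ge0 => i _; exact: exprn_ge0.
have trH1 : 0 < \tr (R ^+ H) by apply: lt_le_trans trH0; rewrite exprn_gt0.
have S4 : \tr (R ^+ H) <= 2^-1 * \tr (R ^+ H) + \tr (R ^+ H) / 4.
  rewrite -{1}(ger0_norm (ltW trH1)) -{1}(subrK (\tr ((A *m R) ^+ H)) (\tr (R ^+ H))).
  rewrite (le_trans (ler_normD _ _)) // lerD //.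
    rewrite distrC (le_trans S3) // ler_pM2r //.
  by rewrite (le_trans S2) // ler_pM2r ?invr_gt0 ?ltr0n.
exfalso; move: S4; rewrite -subr_ge0.
have -> : 2^-1 * \tr (R ^+ H) + \tr (R ^+ H) / 4 - \tr (R ^+ H) = - (\tr (R ^+ H) / 4).
  by field.
by rewrite oppr_ge0 => /(lt_le_trans (divr_gt0 trH1 (ltr0n _ 4))); rewrite ltxx.
Qed.

End Square.
End HoelderTrace.

(** * Inner products and orthogonal projections *)

Section Modulus.
Variable R : realType.
Implicit Types z w : R[i].

Lemma modulusE z : `|z| = (modulus z)%:C.
Proof. by rewrite /modulus normc_def. Qed.

Lemma modulus_ge0 z : 0 <= modulus z.
Proof. by rewrite /modulus normc_def sqrtr_ge0. Qed.

Lemma modulusM z w : modulus (z * w) = modulus z * modulus w.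
Proof. by apply: complexI; rewrite rmorphM /= -!modulusE normrM. Qed.

Lemma modulusD z w : modulus (z + w) <= modulus z + modulus w.
Proof. by rewrite -lecR rmorphD /= -!modulusE ler_normD. Qed.

Lemma modulusN z : modulus (- z) = modulus z.
Proof. by rewrite /modulus normrN. Qed.

Lemma modulusC (x : R) : modulus x%:C = `|x|.
Proof. by apply: complexI; rewrite -modulusE normc_def /= expr0n /= addr0 sqrtr_sqr. Qed.

Lemma modulus_eq0 z : modulus z = 0 -> z = 0.
Proof. by move=> h; apply/eqP; rewrite -normr_eq0 modulusE h. Qed.

Lemma sqr_modulus z : modulus z ^+ 2 = complex.Re (z * conjc z).
Proof.
rewrite -sqr_normc modulusE -rmorphXn /=. by [].
Qed.

Lemma mulc_conj z : z * conjc z = (modulus z ^+ 2)%:C.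
Proof. by rewrite -sqr_normc modulusE rmorphXn. Qed.

Lemma Re_le_modulus z : `|complex.Re z| <= modulus z.
Proof. by rewrite -lecR -modulusE normc_ge_Re. Qed.

Lemma conjcM_real (x : R) z : conjc (x%:C * z) = x%:C * conjc z.
Proof. by case: z => a b; simpc. Qed.

Lemma Re_conj z : complex.Re (conjc z) = complex.Re z.
Proof. by case: z. Qed.

Lemma ReD z w : complex.Re (z + w) = complex.Re z + complex.Re w.
Proof. by case: z; case: w. Qed.

Lemma ReN z : complex.Re (- z) = - complex.Re z.
Proof. by case: z. Qed.

Lemma ReZ (x : R) z : complex.Re (x%:C * z) = x * complex.Re z.
Proof. by case: z => a b /=; rewrite mul0r subr0. Qed.

End Modulus.

Section RealSequences.
Variable R : realType.
Implicit Types f g : nat -> R.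

Lemma squeeze0 f g : (forall n, 0 <= f n <= g n) -> g @ \oo --> (0 : R) -> f @ \oo --> (0 : R).
Proof.
move=> h hg; apply: (squeeze_cvgr _ (@cvg_cst R _ _ _ _) hg).
by apply: nearW.
Qed.

Lemma cvg0P f : f @ \oo --> (0 : R) <->
  forall e, 0 < e -> exists N, forall n, (N <= n)%N -> `|f n| < e.
Proof.
split=> [/cvgrPdist_lt h e e0|h].
  have [N _ hN] := h e e0; exists N => n /hN /=; by rewrite sub0r normrN.
apply/cvgrPdist_lt => e e0; have [N hN] := h e e0.
by exists N => // n /= /hN; rewrite sub0r normrN.
Qed.

Lemma cvg0_subseq f (phi : nat -> nat) : {homo phi : m n / (m < n)%N} ->
  f @ \oo --> (0 : R) -> (f \o phi) @ \oo --> (0 : R).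
Proof.
move=> hp /cvg0P hf; apply/cvg0P => e /hf[N hN]; exists N => n Nn /=.
apply: hN; apply: (leq_trans Nn); elim: n {Nn} => // n IH.
by apply: leq_ltn_trans IH _; exact: hp.
Qed.

Lemma cvg0_invn : (fun n => n.+1%:R^-1 : R) @ \oo --> (0 : R).
Proof. exact: cvg_harmonic. Qed.

Lemma cvg0D f g : f @ \oo --> (0 : R) -> g @ \oo --> (0 : R) ->
  (fun n => f n + g n) @ \oo --> (0 : R).
Proof. by move=> hf hg; rewrite -[0 in X in _ --> X]addr0; exact: cvgD. Qed.

Lemma cvg0Ml (c : R) f : f @ \oo --> (0 : R) -> (fun n => c * f n) @ \oo --> (0 : R).
Proof. by move=> hf; rewrite -[0 in X in _ --> X](mulr0 c); exact: (cvgM (cvg_cst c)). Qed.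

End RealSequences.

Section InnerProduct.
Variables (R : realType) (V : lmodType R[i]).
Implicit Types (x y z : V) (u v : nat -> V) (Y : V -> Prop).

(** The scalar product is kept independent of any norm carried by the type: on [H^-_SL] it will be
    [dotH (L0inv u) (L0inv v)], whose norm is compared with the given one only later. *)
Record inner_product (ip : V -> V -> R[i]) : Prop := InnerProduct {
  ip_linear : forall a x y z, ip (a *: x + y) z = a * ip x z + ip y z;
  ip_sym : forall x y, ip y x = conjc (ip x y);
  ip_gt0 : forall x, x != 0 -> 0 < ip x x }.

Variable ip : V -> V -> R[i].
Hypothesis hip : inner_product ip.

Definition sqn x : R := complex.Re (ip x x).
Definition nrm x : R := Num.sqrt (sqn x).

Lemma ip0l z : ip 0 z = 0.
Proof.
have := ip_linear hip 1 0 0 z; rewrite scaler0 add0r mul1r => /eqP.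
by rewrite -subr_eq0 opprD addrA subrr sub0r oppr_eq0 => /eqP.
Qed.

Lemma ipDl x y z : ip (x + y) z = ip x z + ip y z.
Proof. by rewrite -[x]scale1r (ip_linear hip) mul1r scale1r. Qed.

Lemma ipZl a x z : ip (a *: x) z = a * ip x z.
Proof. by rewrite -[a *: x]addr0 (ip_linear hip) ip0l addr0. Qed.

Lemma ipNl x z : ip (- x) z = - ip x z.
Proof. by rewrite -scaleN1r ipZl mulN1r. Qed.

Lemma ipBl x y z : ip (x - y) z = ip x z - ip y z.
Proof. by rewrite ipDl ipNl. Qed.

Lemma ip0r z : ip z 0 = 0.
Proof. by rewrite (ip_sym hip) ip0l rmorph0. Qed.

Lemma ipDr x y z : ip z (x + y) = ip z x + ip z y.
Proof. by rewrite (ip_sym hip) ipDl rmorphD /= -!(ip_sym hip). Qed.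

Lemma ipZr a x z : ip z (a *: x) = conjc a * ip z x.
Proof. by rewrite (ip_sym hip) ipZl rmorphM /= -(ip_sym hip). Qed.

Lemma ipNr x z : ip z (- x) = - ip z x.
Proof. by rewrite (ip_sym hip) ipNl rmorphN /= -(ip_sym hip). Qed.

Lemma ipBr x y z : ip z (x - y) = ip z x - ip z y.
Proof. by rewrite ipDr ipNr. Qed.

Lemma ip_suml (I : Type) (r : seq I) (P : pred I) (F : I -> V) z :
  ip (\sum_(i <- r | P i) F i) z = \sum_(i <- r | P i) ip (F i) z.
Proof. by apply: (big_morph (ip^~ z)) => [x y|]; [exact: ipDl | exact: ip0l]. Qed.

Lemma ip_sumr (I : Type) (r : seq I) (P : pred I) (F : I -> V) z :
  ip z (\sum_(i <- r | P i) F i) = \sum_(i <- r | P i) ip z (F i).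
Proof. by apply: (big_morph (ip z)) => [x y|]; [exact: ipDr | exact: ip0r]. Qed.

Lemma ip_sqn x : ip x x = (sqn x)%:C.
Proof.
have : 0 <= ip x x.
  have [->|x0] := eqVneq x 0; first by rewrite ip0l.
  exact: ltW (ip_gt0 hip x0).
by rewrite lecE /sqn => /andP[/eqP + _]; case: (ip x x) => a b /= ->.
Qed.

Lemma sqn_ge0 x : 0 <= sqn x.
Proof.
rewrite -lecR -ip_sqn; have [->|x0] := eqVneq x 0; first by rewrite ip0l.
exact: ltW (ip_gt0 hip x0).
Qed.

Lemma sqn_eq0 x : sqn x = 0 -> x = 0.
Proof.
move=> h; apply/eqP; apply: contraTT isT => /(ip_gt0 hip).
by rewrite ip_sqn h ltxx.
Qed.

Lemma nrm_ge0 x : 0 <= nrm x. Proof. exact: sqrtr_ge0. Qed.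

Lemma sqr_nrm x : nrm x ^+ 2 = sqn x.
Proof. by rewrite sqr_sqrtr // sqn_ge0. Qed.

Lemma nrm_eq0 x : nrm x = 0 -> x = 0.
Proof. by move=> h; apply: sqn_eq0; rewrite -sqr_nrm h expr0n. Qed.

Lemma nrm0 : nrm 0 = 0. Proof. by rewrite /nrm /sqn ip0l sqrtr0. Qed.

Lemma nrm_gt0 x : x != 0 -> 0 < nrm x.
Proof. by rewrite lt0r nrm_ge0 andbT; apply: contra => /eqP/nrm_eq0/eqP. Qed.

Lemma ip_nrm x : ip x x = (nrm x ^+ 2)%:C.
Proof. by rewrite sqr_nrm ip_sqn. Qed.

Lemma sqnD x y : sqn (x + y) = sqn x + sqn y + 2 * complex.Re (ip x y).
Proof.
rewrite /sqn ipDl !ipDr !ReD (ip_sym hip y x) Re_conj. ring.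
Qed.

Lemma sqnZ a x : sqn (a *: x) = modulus a ^+ 2 * sqn x.
Proof. by rewrite /sqn ipZl ipZr mulrA mulc_conj ReZ. Qed.

Lemma nrmZ a x : nrm (a *: x) = modulus a * nrm x.
Proof.
by rewrite /nrm sqnZ sqrtrM ?sqr_ge0 // sqrtr_sqr ger0_norm // modulus_ge0.
Qed.

Lemma nrmN x : nrm (- x) = nrm x.
Proof. by rewrite -scaleN1r nrmZ modulusN (modulusC 1) normr1 mul1r. Qed.

Lemma nrmBC x y : nrm (x - y) = nrm (y - x).
Proof. by rewrite -opprB nrmN. Qed.

Lemma sqnN x : sqn (- x) = sqn x.
Proof. by rewrite -!sqr_nrm nrmN. Qed.

Lemma sqnB x y : sqn (x - y) = sqn x + sqn y - 2 * complex.Re (ip x y).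
Proof. by rewrite sqnD sqnN ipNr ReN mulrN. Qed.

Lemma cauchy_schwarz x y : modulus (ip x y) <= nrm x * nrm y.
Proof.
have [->|y0] := eqVneq y 0; first by rewrite ip0r nrm0 mulr0 (modulusC 0) normr0.
have ny := nrm_gt0 y0.
rewrite -(@ler_pXn2r _ 2) ?nnegrE ?modulus_ge0 ?mulr_ge0 ?nrm_ge0 // exprMn !sqr_nrm.
have sy : 0 < sqn y by rewrite -sqr_nrm exprn_gt0.
have := sqn_ge0 ((sqn y)%:C *: x - ip x y *: y).
rewrite sqnB !sqnZ ipZl ipZr -[in X in 2 * X](mulrC (ip x y)) ReZ -sqr_modulus.
rewrite modulusC ger0_norm ?sqn_ge0 //.
have -> : sqn y ^+ 2 * sqn x + modulus (ip x y) ^+ 2 * sqn y -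
   2 * (sqn y * modulus (ip x y) ^+ 2) = sqn y * (sqn x * sqn y - modulus (ip x y) ^+ 2).
  by ring.
by rewrite pmulr_rge0 // subr_ge0.
Qed.

Lemma nrmD x y : nrm (x + y) <= nrm x + nrm y.
Proof.
rewrite -(@ler_pXn2r _ 2) ?nnegrE ?addr_ge0 ?nrm_ge0 // sqrrD !sqr_nrm sqnD.
have h1 := cauchy_schwarz x y.
have h2 := le_trans (ler_norm _) (Re_le_modulus (ip x y)).
lra.
Qed.

Lemma nrmB x y : nrm (x - y) <= nrm x + nrm y.
Proof. by rewrite -(nrmN y) nrmD. Qed.

Lemma nrm_dist x y : `|nrm x - nrm y| <= nrm (x - y).
Proof.
rewrite ler_norml; have h1 := nrmD (x - y) y; have h2 := nrmD (y - x) x.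
rewrite subrK in h1; rewrite subrK nrmBC in h2; lra.
Qed.

Lemma pythagoras x y : ip x y = 0 -> sqn (x + y) = sqn x + sqn y.
Proof. by move=> h; rewrite sqnD h mulr0 addr0. Qed.

Lemma ip_eq0C x y : ip x y = 0 -> ip y x = 0.
Proof. by move=> h; rewrite (ip_sym hip) h rmorph0. Qed.

Definition tends u l := (fun n => nrm (u n - l)) @ \oo --> (0 : R).

Lemma tends_cst l : tends (fun=> l) l.
Proof. by rewrite /tends subrr nrm0; exact: cvg_cst. Qed.

Lemma tendsZ a u l : tends u l -> tends (fun n => a *: u n) (a *: l).
Proof.
move=> hu; apply: squeeze0 (cvg0Ml (modulus a) hu) => n.
by rewrite nrm_ge0 -scalerBr nrmZ lexx.
Qed.

Lemma tendsB u v l m : tends u l -> tends v m -> tends (fun n => u n - v n) (l - m).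
Proof.
move=> hu hv; apply: squeeze0 (cvg0D hu hv) => n.
by rewrite nrm_ge0 opprD addrACA -opprD nrmB.
Qed.

Lemma tends_subseq u l (phi : nat -> nat) :
  {homo phi : m n / (m < n)%N} -> tends u l -> tends (u \o phi) l.
Proof. by move=> hp hu; have := cvg0_subseq hp hu. Qed.

Lemma cvg0_cst (c : R) : (fun _ : nat => c) @ \oo --> (0 : R) -> c = 0.
Proof.
move=> /cvg0P h; apply/eqP; apply: contraTT isT => c0.
have [|N /(_ N (leqnn _))] := h `|c|; first by rewrite normr_gt0.
by rewrite ltxx.
Qed.

Lemma cvg0_const_le (f : nat -> R) (c : R) :
  (forall n, 0 <= c <= f n) -> f @ \oo --> (0 : R) -> c = 0.
Proof. by move=> h hf; apply: cvg0_cst; apply: squeeze0 h hf. Qed.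

Lemma tends_unique u l m : tends u l -> tends u m -> l = m.
Proof.
move=> hl hm; apply/eqP; rewrite -subr_eq0; apply/eqP/nrm_eq0.
apply: cvg0_const_le (cvg0D hl hm) => n; rewrite nrm_ge0 (nrmBC (u n) l) /=.
by rewrite (_ : l - m = (l - u n) + (u n - m)) ?nrmD // addrA subrK.
Qed.

Lemma ip_lim u l z (c : R[i]) : tends u l ->
  (fun n => modulus (ip (u n) z - c)) @ \oo --> (0 : R) -> ip l z = c.
Proof.
move=> hu hc; apply/eqP; rewrite -subr_eq0; apply/eqP/modulus_eq0.
apply: cvg0_const_le (cvg0D (cvg0Ml (nrm z) hu) hc) => n; rewrite modulus_ge0 /=.
have -> : ip l z - c = ip (l - u n) z + (ip (u n) z - c) by rewrite ipBl addrA subrK.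
rewrite (le_trans (modulusD _ _)) // lerD2r // mulrC nrmBC; exact: cauchy_schwarz.
Qed.

Lemma ip_lim_cst u l z c : tends u l -> (forall n, ip (u n) z = c) -> ip l z = c.
Proof.
move=> hu h; apply: ip_lim hu _.
rewrite (_ : (fun n => _) = fun=> 0); first exact: cvg_cst.
by apply/funext => n; rewrite h subrr (modulusC 0) normr0.
Qed.

Lemma nrm_lim u l c : tends u l -> (forall n, nrm (u n) = c) -> nrm l = c.
Proof.
move=> hu h; apply/eqP; rewrite -subr_eq0 -normr_eq0; apply/eqP.
apply: cvg0_const_le hu => n; rewrite normr_ge0 /= -(h n) nrmBC; exact: nrm_dist.
Qed.

Definition cauchy_seq u := forall e, 0 < e ->
  exists N, forall m n, (N <= m)%N -> (N <= n)%N -> nrm (u m - u n) < e.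

Lemma tends_cauchy u l : tends u l -> cauchy_seq u.
Proof.
move=> /cvg0P h e e0; have [|N hN] := h (e / 2); first by rewrite divr_gt0.
exists N => m n /hN hm /hN hn; have := nrmD (u m - l) (l - u n).
rewrite addrA subrK (nrmBC l); move: hm hn; rewrite !ger0_norm ?nrm_ge0 //; lra.
Qed.

Lemma tends_bounded u l : tends u l -> exists M, forall n, nrm (u n) <= M.
Proof.
move=> h; suff [M hM] : exists M, forall n, nrm (u n - l) <= M.
  by exists (M + nrm l) => n; rewrite -{1}(subrK l (u n)) (le_trans (nrmD _ _)) // lerD2r.
move/cvg0P: h => /(_ 1 ltr01) [N hN].
exists (1 + \sum_(i < N) nrm (u i - l)) => n.
have [Nn|nN] := leqP N n.
  have := hN n Nn; rewrite ger0_norm ?nrm_ge0 // => /ltW h1.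
  by rewrite (le_trans h1) // lerDl sumr_ge0 // => i _; exact: nrm_ge0.
rewrite (bigD1 (Ordinal nN)) //=.
set s := \sum_(_ < _ | _) _.
have s0 : 0 <= s by apply: sumr_ge0 => i _; exact: nrm_ge0.
lra.
Qed.

Definition hcomplete := forall u, cauchy_seq u -> exists l, tends u l.

Record closed_subspace Y : Prop := ClosedSubspace {
  cs0 : Y 0;
  cs_lin : forall a x y, Y x -> Y y -> Y (a *: x + y);
  cs_lim : forall u l, (forall n, Y (u n)) -> tends u l -> Y l }.

Lemma csD Y x y : closed_subspace Y -> Y x -> Y y -> Y (x + y).
Proof. by move=> hY hx hy; rewrite -[x]scale1r; exact: (cs_lin hY). Qed.

Lemma csZ Y a x : closed_subspace Y -> Y x -> Y (a *: x).
Proof. by move=> hY hx; rewrite -[_ *: _]addr0; apply: (cs_lin hY) => //; exact: cs0. Qed.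

Lemma csN Y x : closed_subspace Y -> Y x -> Y (- x).
Proof. by move=> hY hx; rewrite -scaleN1r; exact: csZ. Qed.

Lemma csB Y x y : closed_subspace Y -> Y x -> Y y -> Y (x - y).
Proof. by move=> hY hx hy; apply: csD => //; exact: csN. Qed.

Definition orth Y x := forall y, Y y -> ip x y = 0.

Lemma orth_closed Y : closed_subspace (orth Y).
Proof.
split=> [y _|a x y hx hy z hz|u l hu hl z hz].
- exact: ip0l.
- by rewrite (ip_linear hip) hx // hy // mulr0 addr0.
- by apply: ip_lim_cst hl _ => n; exact: hu.
Qed.

Lemma closed_subspaceI Y Z : closed_subspace Y -> closed_subspace Z ->
  closed_subspace (fun x => Y x /\ Z x).
Proof.
move=> hY hZ; split; first by split; exact: cs0.
  by move=> a x y [? ?] [? ?]; split; exact: cs_lin.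
by move=> u l hu hl; split; [apply: (cs_lim hY) hl|apply: (cs_lim hZ) hl] => n; have [] := hu n.
Qed.

(** The parallelogram law makes a minimising sequence for the distance to [Y] Cauchy; the first
    variation at the minimiser gives orthogonality. *)
Lemma projection Y x : hcomplete -> closed_subspace Y -> exists2 y, Y y & orth Y (x - y).
Proof.
move=> hc hY; pose D := [set sqn (x - y) | y in [set y | Y y]].
have lbD : lbound D 0 by move=> _ [y _ <-]; exact: sqn_ge0.
have hD : has_inf D by split; [exists (sqn (x - 0)); exists 0 => //; exact: (cs0 hY)|exists 0].
have infle y : Y y -> inf D <= sqn (x - y).
  by move=> hy; apply: ge_inf; [exists 0|exists y].
have /choice [v hv] : forall n, exists y, Y y /\ sqn (x - y) < inf D + n.+1%:R^-1.
  move=> n; have [|_ [y hy <-] h] := @inf_adherent _ D (n.+1%:R^-1) _ hD.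
    by rewrite invr_gt0 ltr0n.
  by exists y.
have dist m n : sqn (v m - v n) <= 2 * m.+1%:R^-1 + 2 * n.+1%:R^-1.
  have [hm dm] := hv m; have [hn dn] := hv n.
  have hmid : Y ((2^-1)%:C *: (v m + v n)) by apply: csZ => //; exact: csD.
  have := infle _ hmid.
  have e1 : sqn (v m - v n) + 4 * sqn (x - (2^-1)%:C *: (v m + v n)) =
     2 * sqn (x - v m) + 2 * sqn (x - v n).
    have -> : v m - v n = (x - v n) - (x - v m) by rewrite opprB [RHS]addrC addrA subrK.
    have -> : x - (2^-1)%:C *: (v m + v n) = (2^-1)%:C *: ((x - v m) + (x - v n)).
      rewrite addrACA -opprD scalerBr; congr (_ - _).
      rewrite scalerDr -scalerDl -rmorphD /= (_ : 2^-1 + 2^-1 = 1) ?scale1r //; by field.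
    rewrite sqnZ modulusC (sqnB (x - v n)) (sqnD (x - v m)) (ip_sym hip (x - v m)) Re_conj.
    by rewrite ger0_norm; [field | rewrite invr_ge0 ler0n].
  move: dm dn e1; move: (m.+1%:R^-1) (n.+1%:R^-1) (inf D) => a b c.
  move: (sqn _) (sqn (x - v m)) (sqn (x - v n)) (sqn (x - _ *: _)) => s1 s2 s3 s4; lra.
have [] := hc v.
  move=> e e0; have ep : 0 < e ^+ 2 / 4 by rewrite divr_gt0 // exprn_gt0.
  have [N hN] := (cvg0P _).1 (@cvg0_invn R) _ ep.
  exists N => m n hm hn; rewrite -(@ltr_pXn2r _ 2) ?nnegrE ?nrm_ge0 ?(ltW e0) // sqr_nrm.
  apply: (le_lt_trans (dist m n)).
  have := hN m hm; have := hN n hn; rewrite !ger0_norm ?invr_ge0 ?ler0n //.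
  by move: (m.+1%:R^-1) (n.+1%:R^-1) => a b; lra.
move=> y hy; have Yy : Y y by apply: (cs_lim hY) hy => n; have [] := hv n.
have ymin : sqn (x - y) <= inf D.
  rewrite leNgt; apply/negP => hlt.
  have hs : (fun n => nrm ((x - v n) - (x - y))) @ \oo --> (0 : R).
    by apply: tendsB (tends_cst x) hy.
  have h2 : (fun n => nrm (x - v n - (x - y)) * (nrm (x - v n - (x - y)) + 2 * nrm (x - y))
      + n.+1%:R^-1) @ \oo --> (0 : R).
    apply: cvg0D; last exact: cvg0_invn.
    rewrite -[0 in X in _ --> X](mul0r (0 + 2 * nrm (x - y))).
    by apply: cvgM => //; apply: cvgD => //; exact: cvg_cst.
  have : sqn (x - y) - inf D = 0; last by lra.
  apply: cvg0_const_le h2 => n; apply/andP; split; first lra.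
  have [_ h3] := hv n; set w := x - v n in h3 *; set w' := x - y in h3 *.
  have h4 := nrm_dist w w'; rewrite -!sqr_nrm in h3 *.
  move: h3 h4 (nrm_ge0 w) (nrm_ge0 w') (nrm_ge0 (w - w')); rewrite ler_norml.
  move: (n.+1%:R^-1) (nrm w) (nrm w') (nrm (w - w')) (inf D) => d a b c D'.
  move=> h3 /andP[h4 h5] a0 b0 c0.
  have := mulr_ge0 (_ : 0 <= c + (a - b)) (addr_ge0 a0 b0).
  have := mulr_ge0 c0 (_ : 0 <= b + c - a).
  move=> /(_ ltac:(lra)) p1 /(_ ltac:(lra)) p2; nra.
exists y => // z hz; set w := x - y.
have winf (y' : V) : Y y' -> sqn w <= sqn (w - y').
  by move=> hy'; rewrite (le_trans ymin) // /w -addrA -opprD infle //; exact: csD.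
clearbody w.
have key (t : R) : 0 <= modulus (ip w z) ^+ 2 * (t ^+ 2 * sqn z - 2 * t).
  have : sqn w <= sqn (w - (t%:C * ip w z) *: z) by apply: winf; exact: csZ.
  rewrite sqnB sqnZ ipZr modulusM modulusC conjcM_real -mulrA ReZ.
  rewrite [conjc _ * _]mulrC -sqr_modulus exprMn real_normK ?num_real //; lra.
apply/modulus_eq0/eqP; rewrite -sqrf_eq0 eq_le sqr_ge0 andbT leNgt; apply/negP => h.
have z0 := sqn_ge0 z; have s1 : 0 < sqn z + 1 by lra.
(* The value [t = 1 / (sqn z + 1)] makes [t^2 sqn z - 2 t] negative, also for [z = 0]. *)
have := key (sqn z + 1)^-1; rewrite pmulr_rge0 // leNgt => /negP; apply.
set s := (sqn z + 1)^-1; have s0 : 0 < s by rewrite invr_gt0.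
have hs : s * (sqn z + 1) = 1 by rewrite mulVf // gt_eqF.
have -> : s ^+ 2 * sqn z - 2 * s = s * (s * (sqn z + 1)) - s ^+ 2 - 2 * s by ring.
by rewrite hs; nra.
Qed.

End InnerProduct.

(** * Compact operators *)

Section LinearMaps.
Variables (R : realType) (V W : lmodType R[i]).
Implicit Types (x y : V) (K : V -> W).

Lemma linop0 K : linear K -> K 0 = 0.
Proof.
move=> hK; have := hK (-1) 0 0; rewrite scaler0 addr0 scaleN1r => ->.
by rewrite addrC subrr.
Qed.

Lemma linopD K x y : linear K -> K (x + y) = K x + K y.
Proof. by move=> hK; rewrite -[x]scale1r hK !scale1r. Qed.

Lemma linopZ K a x : linear K -> K (a *: x) = a *: K x.
Proof. by move=> hK; rewrite -[a *: x]addr0 hK linop0 // addr0. Qed.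

Lemma linopN K x : linear K -> K (- x) = - K x.
Proof. by move=> hK; rewrite -scaleN1r linopZ // scaleN1r. Qed.

Lemma linopB K x y : linear K -> K (x - y) = K x - K y.
Proof. by move=> hK; rewrite linopD // linopN. Qed.

Lemma linop_sum K (I : Type) (r : seq I) (P : pred I) (F : I -> V) : linear K ->
  K (\sum_(i <- r | P i) F i) = \sum_(i <- r | P i) K (F i).
Proof. by move=> hK; apply: (big_morph K) => [x y|]; [exact: linopD | exact: linop0]. Qed.

End LinearMaps.

Section CompactOperators.
Variables (R : realType) (V : lmodType R[i]) (ip : V -> V -> R[i]).
Hypothesis hip : inner_product ip.
Hypothesis hc : hcomplete ip.
Implicit Types (x y z : V) (u v : nat -> V) (K : V -> V).
Local Notation nrm := (nrm ip).
Local Notation tends := (tends ip).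

Definition seq_compact K := forall u, (forall n, nrm (u n) <= 1) ->
  exists phi : nat -> nat, {homo phi : m n / (m < n)%N} /\ exists l, tends (K \o u \o phi) l.

Lemma nrmZr (t : R) x : 0 <= t -> nrm (t%:C *: x) = t * nrm x.
Proof. by move=> t0; rewrite nrmZ // modulusC ger0_norm. Qed.

Lemma nrm_normalize x : x != 0 -> nrm (((nrm x)^-1)%:C *: x) = 1.
Proof.
move=> x0; rewrite nrmZr ?invr_ge0 ?nrm_ge0 // mulVf // gt_eqF //; exact: nrm_gt0.
Qed.

Lemma compact_bounded K : linear K -> seq_compact K ->
  exists2 M, 0 < M & forall x, nrm (K x) <= M * nrm x.
Proof.
move=> hK cK; apply: contrapT => hM.
have /choice [u hu] : forall n : nat, exists x, nrm x <= 1 /\ n%:R < nrm (K x).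
  move=> n; apply: contrapT => hn; apply: hM; exists n.+1%:R => // x.
  have [->|x0] := eqVneq x 0; first by rewrite linop0 // nrm0 // mulr0.
  rewrite leNgt; apply/negP => h; apply: hn.
  exists (((nrm x)^-1)%:C *: x); split; first by rewrite nrm_normalize.
  have nx := nrm_gt0 hip x0.
  rewrite linopZ // nrmZr ?invr_ge0 ?(ltW nx) // mulrC ltr_pdivlMr //.
  by apply: le_lt_trans h; rewrite ler_pM2r // ler_nat.
have [|phi [hphi [l hl]]] := cK u; first by move=> n; have [] := hu n.
have [M HM] := tends_bounded hip hl.
have M0 : 0 <= M by apply: le_trans (HM 0%N); exact: nrm_ge0.
have [N hN] : exists N : nat, M < N%:R.
  by exists (Num.truncn M).+1; rewrite truncnS_gt.
have := HM N; rewrite leNgt /= => /negP; apply.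
have [_] := hu (phi N); apply: lt_trans; apply: lt_le_trans hN _.
rewrite ler_nat; elim: N => // n IH; apply: (leq_ltn_trans IH); exact: hphi.
Qed.

Lemma seq_compact_bounded K (M : R) u : linear K -> seq_compact K ->
  (forall n, nrm (u n) <= M) ->
  exists phi : nat -> nat, {homo phi : m n / (m < n)%N} /\ exists l, tends (K \o u \o phi) l.
Proof.
move=> hK cK hu.
have M0 : 0 <= M by apply: le_trans (hu 0%N); exact: nrm_ge0.
have M1 : 0 < M + 1 by lra.
have [|phi [hphi [l hl]]] := cK (fun n => ((M + 1)^-1)%:C *: u n).
  move=> n; rewrite nrmZr ?invr_ge0 ?(ltW M1) // mulrC ler_pdivrMr // mul1r.
  by apply: le_trans (hu n) _; lra.
exists phi; split => //; exists ((M + 1)%:C *: l).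
have := tendsZ hip (M + 1)%:C hl; congr tends; apply/funext => n /=.
by rewrite linopZ // scalerA -rmorphM /= divff ?scale1r // gt_eqF.
Qed.

Lemma tends_op K u l : linear K -> seq_compact K -> tends u l -> tends (K \o u) (K l).
Proof.
move=> hK cK hu; have [M M0 hM] := compact_bounded hK cK.
apply: squeeze0 (cvg0Ml M hu) => n /=.
by rewrite nrm_ge0 -linopB // hM.
Qed.

(** Boundedness makes the kernel of [f] closed; the representing vector is a multiple of the
    component [w], orthogonal to the kernel, of some [x0] outside it. *)
Lemma riesz_representation (f : V -> R[i]) (M : R) :
  (forall a x y, f (a *: x + y) = a * f x + f y) ->
  (forall x, modulus (f x) <= M * nrm x) -> exists z, forall x, f x = ip x z.
Proof.
move=> hf hM.
have f0 : f 0 = 0.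
  by have := hf (-1) 0 0; rewrite scaler0 addr0 mulN1r => ->; rewrite addrC subrr.
have fZ a x : f (a *: x) = a * f x by rewrite -[a *: x]addr0 hf f0 addr0.
have fB x y : f (x - y) = f x - f y by rewrite addrC -scaleN1r hf mulN1r addrC.
have hY : closed_subspace ip (fun x => f x = 0).
  split => // [a x y hx hy|u l hu hl]; first by rewrite hf hx hy mulr0 addr0.
  apply: modulus_eq0; apply: cvg0_const_le (cvg0Ml M hl) => n.
  rewrite modulus_ge0 /= -[f l]subr0 -(hu n) -fB (le_trans (hM _)) //.
  by rewrite nrmBC.
have [[x0 hx0]|hall] := pselect (exists x0, f x0 <> 0); last first.
  exists 0 => x; rewrite ip0r //; apply: contrapT => h; apply: hall; by exists x.
have [y hy hw] := projection hip x0 hc hY; set w := x0 - y in hw.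
have fw : f w != 0 by rewrite /w fB hy subr0; apply/eqP.
have w0 : w != 0 by apply: contraNneq fw => ->; rewrite f0.
have iw : ip w w != 0 by rewrite gt_eqF // (ip_gt0 hip).
exists (conjc (f w / ip w w) *: w) => x.
rewrite ipZr // conjcK.
have : ip (x - (f x / f w) *: w) w = 0.
  by apply: ip_eq0C => //; apply: hw; rewrite fB fZ divfK // subrr.
rewrite ipBl // ipZl // => /eqP; rewrite subr_eq0 => /eqP ->.
by field; rewrite fw.
Qed.

Section Shifted.
Variables (K : V -> V) (lam : R[i]).
Hypotheses (hK : linear K) (cK : seq_compact K) (lam0 : lam != 0).
Let B x := K x - lam *: x.

Lemma linear_shift : linear B.
Proof. by move=> a x y; rewrite /B hK scalerDr scalerBr !scalerA [lam * a]mulrC opprD addrACA. Qed.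

Lemma tends_shift u l : tends u l -> tends (B \o u) (B l).
Proof. by move=> hu; apply: tendsB => //; [exact: tends_op | exact: tendsZ]. Qed.

(** Otherwise unit vectors [u n] in [Z] have [B (u n)] tending to [0]; along a subsequence [K (u n)]
    converges, hence so does [u n = lam^-1 (K (u n) - B (u n))], to a unit vector of [Z] killed by
    [B]. *)
Lemma shift_bounded_below Z : closed_subspace ip Z ->
  (forall x, Z x -> B x = 0 -> x = 0) ->
  exists2 c, 0 < c & forall x, Z x -> c * nrm x <= nrm (B x).
Proof.
move=> hZ injB; apply: contrapT => hno.
have /choice [u hu] : forall n : nat, exists x, [/\ Z x, nrm x = 1 & nrm (B x) <= n.+1%:R^-1].
  move=> n; apply: contrapT => hn; apply: hno; exists n.+1%:R^-1 => // x Zx.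
  have [->|x0] := eqVneq x 0; first by rewrite nrm0 // mulr0 nrm_ge0.
  rewrite leNgt; apply/negP => h; apply: hn.
  have nx := nrm_gt0 hip x0.
  exists (((nrm x)^-1)%:C *: x); split; first exact: (csZ _ hZ).
    by rewrite nrm_normalize.
  rewrite (linopZ _ _ linear_shift) nrmZr ?invr_ge0 ?(ltW nx) // mulrC ler_pdivrMr //.
  exact: ltW.
have [|phi [hphi [l hl]]] := cK (u := u); first by move=> n; have [_ -> _] := hu n.
have hB : tends (B \o u \o phi) 0.
  apply: (tends_subseq (u := B \o u) hphi); apply: squeeze0 (@cvg0_invn R) => n /=.
  by rewrite subr0 nrm_ge0; have [] := hu n.
have hlim : tends (u \o phi) (lam^-1 *: l).
  have := tendsZ hip lam^-1 (tendsB hip hl hB); rewrite subr0; congr tends.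
  apply/funext => n /=; rewrite /B opprB addrC subrK scalerA mulVf // scale1r.
  by [].
have Zl : Z (lam^-1 *: l) by apply: (cs_lim hZ) hlim => n; have [] := hu (phi n).
have : nrm (lam^-1 *: l) = 1 by apply: (nrm_lim hip hlim) => n; have [] := hu (phi n).
rewrite (injB _ Zl) ?nrm0 // => [/esym/eqP|]; first by rewrite oner_eq0.
exact: (tends_unique hip (tends_shift hlim) hB).
Qed.

(** Preimages are taken orthogonal to the kernel of [B] in [Y]; there [B] is bounded below, so they
    form a Cauchy sequence when their images do. *)
Lemma shift_closed_range Y : closed_subspace ip Y ->
  closed_subspace ip (fun y => exists2 x, Y x & B x = y).
Proof.
move=> hY; split.
- by exists 0; [exact: (cs0 hY)|rewrite (linop0 linear_shift)].
- move=> a _ _ [x hx <-] [y hy <-]; exists (a *: x + y); first exact: (cs_lin hY).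
  exact: linear_shift.
move=> w l hw hl; pose Ker x := Y x /\ B x = 0.
have hKer : closed_subspace ip Ker.
  split; first by split; [exact: (cs0 hY)|exact: (linop0 linear_shift)].
    move=> a x y [? h1] [? h2]; split; first exact: (cs_lin hY).
    by rewrite linear_shift h1 h2 scaler0 addr0.
  move=> u m hu hm; split; first by apply: (cs_lim hY) hm => n; have [] := hu n.
  apply: (tends_unique hip (tends_shift hm)).
  rewrite (_ : B \o u = fun=> 0); first exact: tends_cst.
  by apply/funext => n /=; have [] := hu n.
pose Z x := Y x /\ orth ip Ker x.
have hZ : closed_subspace ip Z by apply: closed_subspaceI => //; exact: orth_closed.
have [c c0 hcc] : exists2 c, 0 < c & forall x, Z x -> c * nrm x <= nrm (B x).
  apply: shift_bounded_below => // x [Yx ox] Bx.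
  have := ox x (conj Yx Bx); rewrite ip_nrm // => /(congr1 (@complex.Re R)) /= h.
  by apply: (nrm_eq0 hip); apply/eqP; rewrite -sqrf_eq0; apply/eqP.
have /choice [u hu] : forall n, exists x, Z x /\ B x = w n.
  move=> n; have [x hx <-] := hw n; have [y [Yy By] hy] := projection hip x hc hKer.
  exists (x - y); split; first by split => //; exact: (csB hY).
  by rewrite (linopB _ _ linear_shift) By subr0.
have [] := hc (u := u).
  move=> e e0; have [N hN] := tends_cauchy hip hl (mulr_gt0 c0 e0).
  exists N => m n hm hn; rewrite -(ltr_pM2l c0) (le_lt_trans (hcc _ _)) //.
    by apply: (csB hZ) => //; have [] := hu m; have [] := hu n.
  by rewrite (linopB _ _ linear_shift); have [_ ->] := hu m; have [_ ->] := hu n; exact: hN.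
move=> x hx; exists x; first by apply: (cs_lim hY) hx => n; have [[]] := hu n.
apply: (tends_unique hip (tends_shift hx)); move: hl; congr tends.
by apply/funext => n /=; have [] := hu n.
Qed.

(* If the ranges [B^k M] strictly decreased, unit vectors of [B^k M]
   orthogonal to [B^(k+1) M] would have images under [K] at mutual distance
   at least [|lam|]. *)
Lemma shift_descent M : closed_subspace ip M -> (forall x, M x -> M (K x)) ->
  exists k, forall x, M x -> exists2 z, M z & iter k B x = iter k.+1 B z.
Proof.
move=> hM KM; apply: contrapT => hno.
pose Y k y := exists2 x, M x & iter k B x = y.
have hY k : closed_subspace ip (Y k).
  elim: k => [|k IH].
    have -> : Y 0%N = M; last by [].
    apply/funext => x; apply/propext; split=> [[y My <-//]|Mx]; by exists x.
  have -> : Y k.+1 = (fun y => exists2 x, Y k x & B x = y); last exact: shift_closed_range.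
  apply/funext => y; apply/propext; split => [[x Mx <-]|[_ [x Mx <-] <-]].
    by exists (iter k B x) => //; exists x.
  by exists x.
have BM x : M x -> M (B x) by move=> Mx; apply: (csB hM) => //; [exact: KM|exact: (csZ _ hM)].
have Yle k l x : (k <= l)%N -> Y l x -> Y k x.
  move=> /subnK <- [z Mz <-]; exists (iter (l - k) B z); last by rewrite -iterD addnC.
  by elim: (l - k)%N => //= n IH; exact: BM.
have BY k x : Y k x -> Y k.+1 (B x) by move=> [z Mz <-]; exists z.
have /choice [e he] : forall k, exists x, [/\ Y k x, nrm x = 1 & orth ip (Y k.+1) x].
  move=> k; apply: contrapT => hk; apply: hno; exists k => x Mx.
  have [y [z Mz <-] oy] := projection hip (iter k B x) hc (hY k.+1).
  exists z => //; apply/eqP; rewrite -subr_eq0; apply: contraT => w0; case: hk.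
  set w := iter k B x - _ in oy w0; exists (((nrm w)^-1)%:C *: w); split.
  - apply: (csZ _ (hY k)) => //; apply: (csB (hY k)) => //; first by exists x.
    by apply: (Yle k k.+1) => //; exists z.
  - exact: nrm_normalize.
  - exact: (csZ _ (orth_closed hip _)).
have [|phi [hphi [l hl]]] := cK (u := e); first by move=> n; have [_ -> _] := he n.
have m0 : 0 < modulus lam.
  rewrite lt0r modulus_ge0 andbT; apply: contra lam0 => /eqP/modulus_eq0 ->; exact: eqxx.
have [N hN] := tends_cauchy hip hl m0.
have := hN N N.+1 (leqnn N) (leqnSn N); rewrite ltNge => /negP; apply => /=.
have hlt : (phi N < phi N.+1)%N by exact: hphi.
move: (phi N) (phi N.+1) hlt => k m hlt.
have [Yk nk ok] := he k; have [Ym _ _] := he m.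
(* For [k < m] the bracket lies in [Y k.+1], to which [e k] is orthogonal, so Pythagoras leaves at
   least [|lam|]. *)
have -> : K (e k) - K (e m) = lam *: e k + (B (e k) - (B (e m) + lam *: e m)).
  by rewrite /B subrK addrA [lam *: _ + _]addrC subrK.
rewrite -(@ler_pXn2r _ 2) ?nnegrE ?nrm_ge0 ?modulus_ge0 // sqr_nrm // pythagoras //.
  by rewrite sqnZ // -sqr_nrm // nk expr1n mulr1 lerDl sqn_ge0.
rewrite ipZl // ok ?mulr0 //; apply: (csB (hY k.+1)) => //; first exact: BY.
apply: (csD (hY k.+1)) => //; first by apply: (Yle k.+1 m.+1); [exact: ltnW|exact: BY].
by apply: (csZ _ (hY k.+1)) => //; exact: (Yle k.+1 m).
Qed.

End Shifted.

(* The norm of [A] on [W] is an eigenvalue with eigenvector the limit of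
   [A (A (u n))] along a maximising sequence. *)
Lemma attain_norm A W : linear A -> seq_compact A -> closed_subspace ip W ->
  (forall x, W x -> W (A x)) ->
  (forall x y, W x -> W y -> ip (A x) y = ip x (A y)) ->
  (forall x, W x -> 0 <= ip (A x) x) ->
  exists t : R, [/\ 0 <= t, forall x, W x -> nrm (A x) <= t * nrm x
    & 0 < t -> exists x, [/\ W x, nrm x = 1 & A x = t%:C *: x]].
Proof.
move=> hA cA hW AW symA posA.
have [M M0 hM] := compact_bounded hA cA.
pose D := [set t | exists x, [/\ W x, nrm x <= 1 & t = nrm (A x)]].
have hD : has_sup D.
  split; first by exists 0, 0; rewrite linop0 // nrm0 //; split => //; exact: (cs0 hW).
  exists M => _ [x [_ hx ->]]; apply: (le_trans (hM x)).
  by rewrite -[leRHS]mulr1 ler_pM2l.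
set t := sup D.
have t0 : 0 <= t.
  apply: sup_ubound; first by have [] := hD.
  by exists 0; rewrite linop0 // nrm0 //; split => //; exact: (cs0 hW).
have ht x : W x -> nrm (A x) <= t * nrm x.
  move=> Wx; have [->|x0] := eqVneq x 0; first by rewrite linop0 // nrm0 // mulr0.
  have nx := nrm_gt0 hip x0; rewrite -ler_pdivrMr // mulrC.
  rewrite -(nrmZr (A x)) ?invr_ge0 ?(ltW nx) // -linopZ //.
  apply: sup_ubound; first by have [] := hD.
  by exists (((nrm x)^-1)%:C *: x); split; [exact: (csZ _ hW)|rewrite nrm_normalize|].
exists t; split => // tp.
have /choice [u hu] : forall n : nat, exists x, [/\ W x, nrm x <= 1 & t - n.+1%:R^-1 < nrm (A x)].
  move=> n; have [|_ [x [Wx nx ->]] h] := @sup_adherent _ D (n.+1%:R^-1) _ hD; last by exists x.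
  by rewrite invr_gt0 ltr0n.
(* Expanding the square gives [|A^2 u|^2 + t^4 |u|^2 - 2 t^2 |A u|^2 <= t^2 (t^2 - |A u|^2)], and
   [|A u| > t - 1 / (n + 1)]. *)
have diff n : sqn ip (A (A (u n)) - (t ^+ 2)%:C *: u n) <= 2 * t ^+ 3 * n.+1%:R^-1.
  have [Wu nu hn] := hu n.
  have h1 := ht _ (AW _ Wu).
  rewrite sqnB // sqnZ // modulusC ger0_norm ?sqr_ge0 // ipZr // conjc_real ReZ.
  rewrite symA //; last exact: AW.
  have -> : complex.Re (ip (A (u n)) (A (u n))) = nrm (A (u n)) ^+ 2.
    by rewrite ip_nrm.
  rewrite -!sqr_nrm //.
  have := nrm_ge0 ip (u n); have := nrm_ge0 ip (A (u n)); have := nrm_ge0 ip (A (A (u n))).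
  move: h1 nu hn; move: (nrm (u n)) (nrm (A (u n))) (nrm (A (A (u n)))) => a b c.
  have d0 : 0 < n.+1%:R^-1 :> R by rewrite invr_gt0 ltr0n.
  move: (n.+1%:R^-1) d0 => d d0 h1 nu hn c0 b0 a0.
  have h2 : c ^+ 2 <= t ^+ 2 * b ^+ 2 by rewrite -exprMn lerXn2r // nnegrE mulr_ge0.
  have h3 : a ^+ 2 <= 1 by rewrite expr_le1.
  have h4 : t ^+ 2 - 2 * t * d <= b ^+ 2.
    have [htd|htd] := leP d t; last by nra.
    have : (t - d) ^+ 2 <= b ^+ 2 by rewrite lerXn2r // ?nnegrE //; lra.
    nra.
  have h5 : 0 <= t ^+ 2 by rewrite sqr_ge0.
  have h6 := ler_wpM2l h5 h4.
  have h7 : t ^+ 2 ^+ 2 * a ^+ 2 <= t ^+ 2 ^+ 2 by rewrite ler_piMr // sqr_ge0.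
  rewrite (_ : 2 * t ^+ 3 * d = t ^+ 2 * (2 * t * d)); last by ring.
  nra.
have [M2 HM2] : exists M2, forall n, nrm (A (u n)) <= M2.
  exists M => n; have [_ nu _] := hu n; apply: (le_trans (hM _)).
  by rewrite -[leRHS]mulr1 ler_pM2l.
have [phi [hphi [l hl]]] := seq_compact_bounded hA cA HM2.
have hdiff : tends (fun n => A (A (u n)) - (t ^+ 2)%:C *: u n) 0.
  apply/cvg0P => e e0; have ep : 0 < e ^+ 2 / (2 * t ^+ 3).
    by rewrite divr_gt0 ?mulr_gt0 ?exprn_gt0.
  have [N hN] := (cvg0P _).1 (@cvg0_invn R) _ ep; exists N => n Nn.
  rewrite subr0 ger0_norm ?nrm_ge0 // -(@ltr_pXn2r _ 2) ?nnegrE ?nrm_ge0 ?(ltW e0) //.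
  rewrite sqr_nrm // (le_lt_trans (diff n)) // mulrC -ltr_pdivlMr ?mulr_gt0 ?exprn_gt0 //.
  by have := hN n Nn; rewrite ger0_norm ?invr_ge0 ?ler0n.
have t2 : (t ^+ 2)%:C != 0 :> R[i].
  by rewrite -(rmorph0 (real_complex R)) (inj_eq (@complexI R)) gt_eqF // exprn_gt0.
set x := ((t ^+ 2)%:C)^-1 *: l.
have hx : tends (u \o phi) x.
  have := tendsZ hip ((t ^+ 2)%:C)^-1 (tendsB hip hl (tends_subseq hphi hdiff)).
  rewrite subr0; congr tends; apply/funext => n /=.
  by rewrite opprB addrC subrK scalerA mulVf // scale1r.
have Wx : W x by apply: (cs_lim hW) hx => n; have [] := hu (phi n).
have A2x : A (A x) = (t ^+ 2)%:C *: x.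
  rewrite scalerA divff // scale1r; apply: (tends_unique hip _ hl).
  exact: (tends_op hA cA (tends_op hA cA hx)).
clearbody x.
have nx1 : nrm x <= 1.
  rewrite leNgt; apply/negP => h; have e0 : 0 < nrm x - 1 by lra.
  have [N /(_ N (leqnn N))] := (cvg0P _).1 hx _ e0.
  rewrite ger0_norm ?nrm_ge0 // /= => h1; have [_ h2 _] := hu (phi N).
  by have := nrm_dist hip x (u (phi N)); rewrite ler_norml nrmBC //; lra.
(* Eventually [A (u n)] is longer than [t / 2], so boundedness of [A] keeps [u n] away from [0]. *)
have x0 : x != 0.
  apply/eqP => x0; have e0 : 0 < t / (2 * M) by rewrite divr_gt0 // mulr_gt0.
  have [N1 h1] := (cvg0P _).1 hx _ e0.
  have [N2 h2] := (cvg0P _).1 (@cvg0_invn R) _ (divr_gt0 tp (ltr0n R 2)).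
  pose n := maxn N1 N2; have := h1 n (leq_maxl _ _).
  rewrite x0 /= subr0 ger0_norm ?nrm_ge0 // => h3.
  have [_ _ h4] := hu (phi n).
  have h5 : (phi n).+1%:R^-1 <= n.+1%:R^-1 :> R.
    rewrite lef_pV2 ?posrE ?ltr0n // ler_nat ltnS.
    by elim: (n) => // k IH; apply: (leq_ltn_trans IH); exact: hphi.
  have := h2 n (leq_maxr _ _); rewrite ger0_norm ?invr_ge0 ?ler0n // => h6.
  have := hM (u (phi n)); move: h3; rewrite ltr_pdivlMr ?mulr_gt0 //.
  move: h4 h5 h6; move: (_^-1) (n.+1%:R^-1) => p q; lra.
(* [z = A x - t x] satisfies [A z = - t z] because [A^2 x = t^2 x]; positivity of [A] on [W] then
   forces [z = 0]. *)
have eqz : A x - t%:C *: x = 0.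
  set z := A x - _; have Wz : W z by apply: (csB hW) => //; [exact: AW|exact: (csZ _ hW)].
  have Az : A z = - (t%:C *: z).
    rewrite /z linopB // linopZ // A2x scalerBr opprB scalerA -rmorphM /= -expr2.
    by rewrite addrC.
  have := posA _ Wz; rewrite Az ipNl // ipZl // ip_nrm // -rmorphM -rmorphN lecR.
  rewrite oppr_ge0 pmulr_rle0 // => h; apply: (nrm_eq0 hip).
  by apply/eqP; rewrite -sqrf_eq0 eq_le h sqr_ge0.
have Ax : A x = t%:C *: x by apply/eqP; rewrite -subr_eq0 eqz.
exists (((nrm x)^-1)%:C *: x); split; first exact: (csZ _ hW).
  exact: nrm_normalize.
by rewrite linopZ // Ax !scalerA mulrC.
Qed.

End CompactOperators.

(** * Completeness of root vectors of weakly perturbed positive operators *)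

Section ComplexSequences.
Variable R : realType.

Lemma modulus_le_ReIm (z : R[i]) : modulus z <= `|complex.Re z| + `|complex.Im z|.
Proof.
rewrite /modulus normc_def /= -(@ler_pXn2r _ 2) ?nnegrE ?sqrtr_ge0 ?addr_ge0 //.
rewrite sqr_sqrtr ?addr_ge0 ?sqr_ge0 // -(real_normK (num_real (complex.Re z))).
rewrite -(real_normK (num_real (complex.Im z))).
have := normr_ge0 (complex.Re z); have := normr_ge0 (complex.Im z); nra.
Qed.

Lemma Im_le_modulus (z : R[i]) : `|complex.Im z| <= modulus z.
Proof.
rewrite /modulus normc_def /= -(@ler_pXn2r _ 2) ?nnegrE ?sqrtr_ge0 //.
by rewrite real_normK ?num_real // sqr_sqrtr ?addr_ge0 ?sqr_ge0 // lerDr sqr_ge0.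
Qed.

Lemma bounded_subseq (f : nat -> R) (M : R) : (forall n, `|f n| <= M) ->
  exists phi : nat -> nat, {homo phi : m n / (m < n)%N} /\
  exists l, (fun n => `|f (phi n) - l|) @ \oo --> (0 : R).
Proof.
move=> hM; have [|phi hphi hcv] := @bolzano_weierstrass R f.
  exists M; split; first exact: num_real.
  by move=> x Mx n _; apply: le_trans (hM n) (ltW Mx).
exists phi; split; last first.
  exists (limn (f \o phi)).
  apply/cvg0P => e e0; have /cvgrPdist_lt/(_ e e0)[N _ hN] := hcv.
  by exists N => n Nn; rewrite normr_id distrC; exact: hN.
move=> m n mn; have := hphi n m; rewrite leqNgt mn /=.
by move=> h; rewrite ltnNge -leEnat h.
Qed.

Lemma cbounded_subseq (f : nat -> R[i]) (M : R) : (forall n, modulus (f n) <= M) ->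
  exists phi : nat -> nat, {homo phi : m n / (m < n)%N} /\
  exists l, (fun n => modulus (f (phi n) - l)) @ \oo --> (0 : R).
Proof.
move=> hM.
have [|phi [hphi [a ha]]] := @bounded_subseq (fun n => complex.Re (f n)) M.
  by move=> n; exact: le_trans (Re_le_modulus _) (hM n).
have [|psi [hpsi [b hb]]] := @bounded_subseq (fun n => complex.Im (f (phi n))) M.
  by move=> n; exact: le_trans (Im_le_modulus _) (hM _).
exists (phi \o psi); split; first by move=> m n mn /=; apply: hphi; exact: hpsi.
exists (a +i* b); have ha' := cvg0_subseq hpsi ha.
apply: squeeze0 (cvg0D ha' hb) => n; rewrite modulus_ge0 /=.
by apply: (le_trans (modulus_le_ReIm _)); case: (f _).
Qed.

End ComplexSequences.

(** * Compression of a positive compact operator: eigenvectors and finite sections *)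

Section Keldysh.
Variables (R : realType) (V : lmodType R[i]) (ip : V -> V -> R[i]).
Hypothesis hip : inner_product ip.
Hypothesis hc : hcomplete ip.
Implicit Types (x y z v : V).
Local Notation nrm := (nrm ip).
Local Notation sqn := (sqn ip).
Local Notation tends := (tends ip).
Variables (Q : V -> V) (N : V -> Prop) (E : V -> V).
Hypotheses (Qlin : linear Q) (Qcompact : seq_compact ip Q).
Hypotheses (Qsym : forall x y, ip (Q x) y = ip x (Q y))
  (Qge0 : forall x, 0 <= ip (Q x) x) (Qinj : forall x, ip (Q x) x = 0 -> x = 0).
Hypotheses (hN : closed_subspace ip N) (Elin : linear E) (EN : forall x, N (E x))
  (Eip : forall x y, N y -> ip (E x) y = ip x y).

Let A x := E (Q x).

Lemma E_id x : N x -> E x = x.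
Proof.
move=> Nx; apply/eqP; rewrite -subr_eq0; apply/eqP/(sqn_eq0 hip).
by rewrite /sqn ipBl // Eip ?subrr //; apply: (csB hN).
Qed.

Lemma nrmE x : nrm (E x) <= nrm x.
Proof.
have [h|h] := ltP (nrm x) (nrm (E x)); last by [].
have e : (nrm (E x) ^+ 2)%:C = ip x (E x) by rewrite -ip_nrm // Eip.
have := cauchy_schwarz hip x (E x); rewrite -e modulusC ger0_norm ?sqr_ge0 //.
have := nrm_ge0 ip x; nra.
Qed.

Lemma tendsE (u : nat -> V) l : tends u l -> tends (E \o u) (E l).
Proof.
move=> hu; apply: squeeze0 hu => n /=.
by rewrite nrm_ge0 -linopB // nrmE.
Qed.

Lemma Alin : linear A. Proof. by move=> a x y; rewrite /A Qlin Elin. Qed.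

Lemma Acompact : seq_compact ip A.
Proof.
move=> u /Qcompact[phi [hphi [l hl]]]; exists phi; split => //.
by exists (E l); exact: (tendsE hl).
Qed.

Lemma Asym x y : N x -> N y -> ip (A x) y = ip x (A y).
Proof. by move=> Nx Ny; rewrite Eip // Qsym (ip_sym hip (A y)) Eip // -(ip_sym hip). Qed.

Lemma Aip x : N x -> ip (A x) x = ip (Q x) x. Proof. exact: Eip. Qed.

Lemma A_eq0 x : N x -> A x = 0 -> x = 0.
Proof. by move=> Nx Ax; apply: Qinj; rewrite -Aip // Ax ip0l. Qed.

(** The sequence is always infinite: once the positive eigenvalues are exhausted it continues with
    [q n = 0] and [e n = 0], so no dimension has to be tracked. The last clause expresses the
    maximality of [q n] and yields the monotonicity of [q]. *)
Definition orthogonal_eigenseq (e : nat -> V) (q : nat -> R) :=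
  [/\ forall n, [/\ N (e n), A (e n) = (q n)%:C *: e n & 0 <= q n],
      forall i j, i != j -> ip (e i) (e j) = 0,
      forall n, 0 < q n -> nrm (e n) = 1,
      forall n, q n = 0 -> e n = 0
    & forall n x, N x -> (forall i, (i < n)%N -> ip x (e i) = 0) -> nrm (A x) <= q n * nrm x].

(** Greedy deflation: [attain_norm] on the complement of the vectors already found yields the next
    eigenpair; that complement is invariant because [A] is symmetric on [N]. *)
Lemma exists_eigenseq : exists e q, orthogonal_eigenseq e q.
Proof.
pose W (l : seq V) x := N x /\ forall v, v \in l -> ip x v = 0.
pose good (l : seq V) := forall v, v \in l -> N v /\ exists t : R, A v = t%:C *: v.
have hW l : closed_subspace ip (W l).
  apply: closed_subspaceI => //; split => [v _|a x y hx hy v vl|u m hu hm v vl].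
  - exact: ip0l.
  - by rewrite (ip_linear hip) hx // hy // mulr0 addr0.
  - by apply: (ip_lim_cst hip hm) => n; exact: hu.
(* The choice is made for all lists at once; it is meaningful only for lists of eigenvectors in [N],
   which [gL] maintains along the recursion. *)
have /choice [G hG] : forall l, exists p : V * R, good l ->
    [/\ 0 <= p.2, forall x, W l x -> nrm (A x) <= p.2 * nrm x, W l p.1,
        A p.1 = p.2%:C *: p.1 & (p.2 = 0 /\ p.1 = 0) \/ (0 < p.2 /\ nrm p.1 = 1)].
  move=> l; have [gl|] := pselect (good l); last by move=> ?; exists (0, 0).
  have [|||t [t0 ht ex]] := attain_norm hip Alin Acompact (hW l).
  - move=> x [Nx hx]; split; first exact: EN.
    move=> v vl; have [Nv [q qv]] := gl v vl.
    by rewrite Asym // qv ipZr // hx // mulr0.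
  - by move=> x y [Nx _] [Ny _]; exact: Asym.
  - by move=> x [Nx _]; rewrite Aip.
  have [t00|tn0] := eqVneq t 0.
    exists (0, 0) => _; rewrite /= scaler0 (linop0 Alin); split => //; last by left.
    + by move=> x /ht; rewrite t00.
    + exact: (cs0 (hW l)).
  have tp : 0 < t by rewrite lt0r tn0.
  by have [x [Wx nx Ax]] := ex tp; exists (x, t) => _; split => //; right.
pose fix L n := if n is m.+1 then rcons (L m) (G (L m)).1 else [::].
have gL n : good (L n).
  elim: n => [|n IH] v //=; rewrite mem_rcons inE => /orP[/eqP->|/IH//].
  by have [_ _ [Nv _] Av _] := hG _ IH; split => //; exists (G (L n)).2.
have eL i n : (i < n)%N -> (G (L i)).1 \in L n.
  elim: n => // n IH; rewrite ltnS leq_eqVlt => /orP[/eqP->|/IH h] /=.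
    by rewrite mem_rcons mem_head.
  by rewrite mem_rcons inE h orbT.
have Le v n : v \in L n -> exists2 i, (i < n)%N & v = (G (L i)).1.
  elim: n => // n IH /=; rewrite mem_rcons inE => /orP[/eqP->|/IH[i lin ->]].
    by exists n.
  by exists i => //; exact: ltnW.
exists (fun n => (G (L n)).1), (fun n => (G (L n)).2); split.
- by move=> n; have [h1 h2 [h3 _] h4 _] := hG _ (gL n); split.
- suff h i j : (i < j)%N -> ip (G (L j)).1 (G (L i)).1 = 0.
    by move=> i j; rewrite neq_ltn => /orP[/h/(ip_eq0C hip)|/h].
  by move=> ij; have [_ _ [_ h] _ _] := hG _ (gL j); apply: h; exact: eL.
- move=> n qn; have [_ _ _ _ [[qz _]|[_ ->//]]] := hG _ (gL n).
  by rewrite qz ltxx in qn.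
- move=> n qn; have [_ _ _ _ [[_ ->//]|[qp _]]] := hG _ (gL n).
  by rewrite qn ltxx in qp.
- move=> n x Nx hx; have [_ h _ _ _] := hG _ (gL n); apply: h; split => // v /Le[i lin ->].
  exact: hx.
Qed.

Section Eigenbasis.
Variables (e : nat -> V) (q : nat -> R).
Hypothesis heq : orthogonal_eigenseq e q.

Let Ne n : N (e n). Proof. by have [/(_ n)[]] := heq. Qed.
Let Ae n : A (e n) = (q n)%:C *: e n. Proof. by have [/(_ n)[]] := heq. Qed.
Let q0 n : 0 <= q n. Proof. by have [/(_ n)[]] := heq. Qed.
Let eo i j : i != j -> ip (e i) (e j) = 0. Proof. by have [_ h _ _ _] := heq; exact: h. Qed.

Lemma nrm_eigen_le1 n : sqn (e n) <= 1.
Proof.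
have [_ _ h1 h2 _] := heq; rewrite -sqr_nrm //; have [q00|qn0] := eqVneq (q n) 0.
  by rewrite (h2 n q00) nrm0 // expr0n ler01.
by rewrite h1 ?expr1n // lt0r qn0 q0.
Qed.

Lemma sqn_comb (P : pred nat) n (c : nat -> R[i]) :
  sqn (\sum_(i < n | P i) c i *: e i) = \sum_(i < n | P i) modulus (c i) ^+ 2 * sqn (e i).
Proof.
elim: n => [|n IH]; first by rewrite !big_ord0 /sqn ip0l.
rewrite big_mkcond [RHS]big_mkcond !big_ord_recr /= -!big_mkcond.
rewrite pythagoras //; first by rewrite IH; case: ifP => // _; rewrite ?sqnZ // /sqn ip0l.
case: ifP => _; last exact: ip0r.
rewrite ip_suml // big1 // => i _; rewrite ipZl // ipZr // eo ?mulr0 //.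
by rewrite neq_ltn ltn_ord.
Qed.

Lemma ip_comb (P : pred nat) n (c : nat -> R[i]) k :
  ip (\sum_(i < n | P i) c i *: e i) (e k) =
  if (k < n)%N && P k then c k * (sqn (e k))%:C else 0.
Proof.
rewrite ip_suml //; case: ifP => [/andP[kn Pk]|/negbT hk].
  rewrite (bigD1 (Ordinal kn)) //= ipZl // ip_sqn // big1 ?addr0 // => i /andP[_ ik].
  by rewrite ipZl // eo ?mulr0 //; apply: contra ik => /eqP ik; apply/eqP/val_inj.
rewrite big1 // => i Pi; rewrite ipZl // eo ?mulr0 //.
by apply: contra hk => /eqP <-; rewrite ltn_ord.
Qed.

Lemma N_comb (P : pred nat) n (c : nat -> R[i]) : N (\sum_(i < n | P i) c i *: e i).
Proof.
apply: (big_ind N) => [|x y hx hy|i _]; [exact: (cs0 hN)|exact: (csD hN)|exact: (csZ _ hN)].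
Qed.

Definition section_proj n y := \sum_(i < n) ip y (e i) *: e i.

Lemma sqn_section n y : sqn (section_proj n y) = \sum_(i < n) modulus (ip y (e i)) ^+ 2 * sqn (e i).
Proof. exact: (sqn_comb xpredT n (fun i => ip y (e i))). Qed.

(** [e n] is a unit vector or zero; carrying the factor [sqn (e n)] treats both cases at once. *)
Lemma eigen_unit n : (sqn (e n))%:C *: e n = e n.
Proof.
have [_ _ h1 h2 _] := heq; have [q00|qn0] := eqVneq (q n) 0; first by rewrite (h2 n q00) scaler0.
by rewrite -sqr_nrm // h1 ?expr1n ?scale1r // lt0r qn0 q0.
Qed.

Lemma ip_eigen_unit n y : ip y (e n) * (sqn (e n))%:C = ip y (e n).
Proof. by rewrite -{3}(eigen_unit n) ipZr // conjc_real mulrC. Qed.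

Lemma modulus_eigen_unit n y :
  modulus (ip y (e n)) ^+ 2 * sqn (e n) = modulus (ip y (e n)) ^+ 2.
Proof.
have [_ _ h1 h2 _] := heq; have [q00|qn0] := eqVneq (q n) 0.
  by rewrite (h2 n q00) ip0r // (modulusC 0) normr0 expr0n mul0r.
by rewrite -(sqr_nrm hip (e n)) h1 ?expr1n ?mulr1 // lt0r qn0 q0.
Qed.

Lemma bessel n y : \sum_(i < n) modulus (ip y (e i)) ^+ 2 <= sqn y.
Proof.
have h : ip (y - section_proj n y) (section_proj n y) = 0.
  rewrite [X in ip _ X]/section_proj ip_sumr // big1 // => i _.
  rewrite ipZr // ipBl // (ip_comb xpredT n (fun i => ip y (e i))) ltn_ord /=.
  by rewrite ip_eigen_unit subrr mulr0.
rewrite -[X in sqn X](subrK (section_proj n y)) pythagoras // sqn_section.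
rewrite [X in _ <= _ + X](eq_bigr (fun i : 'I_n => modulus (ip y (e i)) ^+ 2)) => [|i _]; last exact: modulus_eigen_unit.
by rewrite lerDr sqn_ge0.
Qed.

Lemma nrm_section n y : nrm (section_proj n y) <= nrm y.
Proof.
rewrite -(@ler_pXn2r _ 2) ?nnegrE ?nrm_ge0 // !sqr_nrm // sqn_section.
apply: le_trans (bessel n y); apply: ler_sum => i _.
by rewrite modulus_eigen_unit.
Qed.

Lemma sectionB n x y : section_proj n (x - y) = section_proj n x - section_proj n y.
Proof.
rewrite /section_proj -sumrB; apply: eq_bigr => i _.
by rewrite ipBl // scalerBl.
Qed.

Lemma q_noninc m n : (m <= n)%N -> q n <= q m.
Proof.
move=> mn; have [_ _ h1 h2 h3] := heq.
have [->|qn0] := eqVneq (q n) 0; first exact: q0.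
have qn : 0 < q n by rewrite lt0r qn0 q0.
have := h3 m (e n) (Ne n); rewrite Ae nrmZr // h1 // !mulr1; apply => i im.
by apply: eo; rewrite neq_ltn (leq_trans im mn) orbT.
Qed.

(* Min-max: some combination of [e 0, ..., e n] is orthogonal to the [n]
   vectors outside whose complement [Q] is not small. *)
Lemma q_le_approx (s : R) n (f : 'I_n -> V) : 0 <= s ->
  (forall x, (forall i, ip x (f i) = 0) -> nrm (Q x) <= s * nrm x) -> q n <= s.
Proof.
move=> s0 hs; have [_ _ h1 h2 h3] := heq.
have [->//|qn0] := eqVneq (q n) 0.
have qn : 0 < q n by rewrite lt0r qn0 q0.
pose Mx : 'M[R[i]]_(n.+1, n) := \matrix_(i, j) ip (e i) (f j).
have /rowV0Pn[c /sub_kermxP hcM c0] : kermx Mx != 0.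
  rewrite kermx_eq0 -row_leq_rank -ltnNge ltnS; exact: rank_leq_col.
pose cc (i : nat) : R[i] := if insub i is Some j then c 0 j else 0.
have ccE (i : 'I_n.+1) : cc i = c 0 i by rewrite /cc valK.
pose x := \sum_(i < n.+1) cc i *: e i.
have xf i : ip x (f i) = 0.
  have /rowP/(_ i) := hcM; rewrite !mxE => <-; rewrite ip_suml //.
  by apply: eq_bigr => k _; rewrite mxE ipZl // ccE.
have nx : sqn x = \sum_(i < n.+1) modulus (cc i) ^+ 2.
  rewrite (sqn_comb xpredT); apply: eq_bigr => i _.
  rewrite -sqr_nrm // h1 ?expr1n ?mulr1 //.
  by apply: lt_le_trans qn _; apply: q_noninc; rewrite -ltnS.
have x0 : 0 < sqn x.
  rewrite nx lt0r sumr_ge0 ?andbT; last by move=> i _; rewrite sqr_ge0.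
  rewrite psumr_eq0 => [|i _]; last by rewrite sqr_ge0.
  apply: contra c0 => /allP h; apply/eqP/rowP => i; rewrite mxE -ccE.
  by have := h i (mem_index_enum _); rewrite /= sqrf_eq0 => /eqP/modulus_eq0.
have Nx : N x by exact: (N_comb xpredT).
have Ax : ip (A x) x = (\sum_(i < n.+1) q i * modulus (cc i) ^+ 2)%:C.
  have -> : A x = \sum_(i < n.+1) cc i *: ((q i)%:C *: e i).
    rewrite /x (linop_sum _ _ _ Alin); apply: eq_bigr => i _.
    by rewrite (linopZ _ _ Alin) Ae.
  rewrite ip_suml // rmorph_sum /=; apply: eq_bigr => i _; rewrite !ipZl //.
  have -> : ip (e i) x = conjc (cc i).
    rewrite (ip_sym hip) (ip_comb xpredT) ltn_ord /= -sqr_nrm // h1 ?expr1n ?mulr1 //.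
    by apply: lt_le_trans qn _; apply: q_noninc; rewrite -ltnS.
  by rewrite mulrCA mulc_conj -rmorphM.
(* The chain to be closed is [q n |x|^2 <= (A x, x) = (Q x, x) <= |Q x| |x| <= s |x|^2]. *)
have : q n * sqn x <= complex.Re (ip (A x) x).
  rewrite Ax nx /= mulr_sumr; apply: ler_sum => i _.
  by rewrite ler_wpM2r ?sqr_ge0 //; apply: q_noninc; rewrite -ltnS.
rewrite Aip // => hq.
have := le_trans (ler_norm _) (le_trans (Re_le_modulus _) (cauchy_schwarz hip (Q x) x)).
have hQ := ler_wpM2r (nrm_ge0 ip x) (hs _ xf).
move=> /(le_trans hq)/le_trans/(_ hQ); rewrite -mulrA -expr2 sqr_nrm //.
by rewrite ler_pM2r.
Qed.

Section SchattenBound.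
Variables (h : nat) (K : R).
Hypotheses (h0 : (0 < h)%N) (hK : forall n, \sum_(i < n) q i ^+ h <= K).

(** A constant [c] below every [q n] would give [n c^h <= K] for every [n]. *)
Lemma eigenseq_small (c : R) : 0 <= c -> (forall n, c <= q n) -> c = 0.
Proof.
move=> c0 hcq; apply/eqP; apply: contraT => cn0.
have cp : 0 < c ^+ h by rewrite exprn_gt0 // lt0r cn0.
pose n := (Num.truncn (K / c ^+ h)).+1.
have : n%:R * c ^+ h <= K.
  apply: le_trans (hK n); rewrite mulr_natl -[X in _ *+ X]card_ord -sumr_const.
  by apply: ler_sum => i _; rewrite lerXn2r // nnegrE.
by rewrite -ler_pdivlMr // leNgt truncnS_gt.
Qed.

(** [|A x| <= q n |x|] holds for every [n], and the [q n] come arbitrarily close to [0]; so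
    [A x = 0], and [A] is injective on [N]. *)
Lemma eigenseq_complete x : N x -> (forall i, ip x (e i) = 0) -> x = 0.
Proof.
move=> Nx hx; have [_ _ _ _ h3] := heq.
apply: contrapT => /eqP x0; have nx := nrm_gt0 hip x0.
have : nrm (A x) / nrm x = 0.
  apply: eigenseq_small => [|n]; first by rewrite divr_ge0 ?nrm_ge0.
  by rewrite ler_pdivrMr // h3.
move=> /eqP; rewrite mulf_eq0 invr_eq0 (gt_eqF nx) orbF => /eqP/(nrm_eq0 hip).
by move=> /(A_eq0 Nx) /eqP; rewrite (negPf x0).
Qed.

(** Bessel's inequality makes the partial sums Cauchy. Their limit [l] lies in [N], so it is
    compared with [E y] rather than [y]: the difference is in [N] and orthogonal to every [e i],
    hence zero. *)
Lemma tends_section y : tends (section_proj^~ y) (E y).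
Proof.
pose b n := \sum_(i < n) modulus (ip y (e i)) ^+ 2.
have bmono m n : (m <= n)%N -> b m <= b n.
  elim: n => [|n IH]; first by rewrite leqn0 => /eqP->.
  rewrite leq_eqVlt => /orP[/eqP->//|/IH hb]; apply: (le_trans hb).
  by rewrite /b big_ord_recr /= lerDl sqr_ge0.
have diff m n : (m <= n)%N -> sqn (section_proj n y - section_proj m y) = b n - b m.
  elim: n => [|n IH]; first by rewrite leqn0 => /eqP->; rewrite !subrr /sqn ip0l.
  rewrite leq_eqVlt => /orP[/eqP->|]; first by rewrite !subrr /sqn ip0l.
  rewrite ltnS => mn; rewrite {1}/section_proj big_ord_recr /= -/(section_proj n y).
  rewrite addrAC pythagoras //.
    rewrite IH // /b big_ord_recr /= sqnZ // modulus_eigen_unit; ring.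
  rewrite ipZr // ipBl // !(ip_comb xpredT _ (fun i => ip y (e i))) ltnn.
  by rewrite ltnNge mn subrr mulr0.
pose D := [set b n | n in setT].
have hD : has_sup D by split; [exists (b 0%N); exists 0%N|exists (sqn y) => _ [n _ <-]; exact: bessel].
have [] := hc (u := section_proj^~ y).
  move=> d d0; have [|_ [k _ <-] hk] := @sup_adherent _ D (d ^+ 2) _ hD.
    by rewrite exprn_gt0.
  have bsup n : b n <= sup D by apply: sup_ubound; [by have [] := hD|exists n].
  have key m n : (k <= m)%N -> (m <= n)%N -> nrm (section_proj n y - section_proj m y) < d.
    move=> km mn; rewrite -(@ltr_pXn2r _ 2) ?nnegrE ?nrm_ge0 ?(ltW d0) // sqr_nrm //.
    rewrite diff //; have := bmono _ _ km; have := bsup n; lra.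
  exists k => m n km kn; have [mn|/ltnW nm] := leqP m n; last exact: key.
  by rewrite nrmBC //; exact: key.
move=> l hl; suff -> : E y = l by [].
have Nl : N l by apply: (cs_lim hN) hl => n; exact: (N_comb xpredT n (fun i => ip y (e i))).
apply/eqP; rewrite -subr_eq0; apply/eqP; apply: eigenseq_complete.
  by apply: (csB hN).
move=> k; rewrite ipBl // Eip //; apply/eqP; rewrite subr_eq0; apply/eqP/esym.
(* The shift makes every section of the subsequence contain the index [k]. *)
have hphi : {homo (fun n => (k + n.+1)%N) : m n / (m < n)%N}.
  by move=> m n mn; rewrite ltn_add2l.
apply: (ip_lim_cst hip (tends_subseq hphi hl)) => n /=.
rewrite (ip_comb xpredT _ (fun i => ip y (e i))) /= addnS ltnS leq_addr.
exact: ip_eigen_unit.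
Qed.

Variable delta : V -> V.
Hypotheses (dlin : linear delta) (dcompact : seq_compact ip delta).

(* Unit vectors orthogonal to more and more of the [e i] tend weakly to [0]. *)
Lemma compact_tail (d : R) : 0 < d -> exists k, forall x, N x ->
  (forall i, (i < k)%N -> ip x (e i) = 0) -> nrm (delta x) <= d * nrm x.
Proof.
move=> d0; apply: contrapT => hno.
have /choice [u hu] : forall k, exists x, [/\ N x, forall i, (i < k)%N -> ip x (e i) = 0,
    nrm x = 1 & d <= nrm (delta x)].
  move=> k; apply: contrapT => hk; apply: hno; exists k => x Nx hx.
  have [->|x0] := eqVneq x 0; first by rewrite linop0 // nrm0 // mulr0.
  rewrite leNgt; apply/negP => hlt; apply: hk; have nx := nrm_gt0 hip x0.
  exists (((nrm x)^-1)%:C *: x); split; first exact: (csZ _ hN).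
  - by move=> i /hx ix; rewrite ipZl // ix mulr0.
  - exact: nrm_normalize.
  - rewrite linopZ // nrmZr ?invr_ge0 ?nrm_ge0 // mulrC ler_pdivlMr //; exact: ltW.
have [|phi [hphi [l hl]]] := dcompact (u := u); first by move=> n; have [_ _ ->] := hu n.
have [M M0 hM] := compact_bounded hip dlin dcompact.
(* [z] stands for the adjoint of [delta] applied to [l]. *)
have [z hz] : exists z, forall x, ip (delta x) l = ip x z.
  apply: (riesz_representation hip hc (M := M * nrm l)) => [a x y|x].
    by rewrite dlin (ip_linear hip).
  apply: (le_trans (cauchy_schwarz hip _ _)); rewrite mulrAC ler_wpM2r ?nrm_ge0 //.
have l0 : ip l l = 0.
  apply: (ip_lim hip hl); apply: squeeze0 (tends_subseq hphi (tends_section z)) => n /=.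
  rewrite modulus_ge0 subr0 hz /=; have [Nu ou nu _] := hu (phi n).
  (* [u (phi n)] is orthogonal to the first [phi n] vectors, so only the tail of the expansion of
     [E z] is seen. *)
  have -> : ip (u (phi n)) z = ip (u (phi n)) (E z - section_proj (phi n) z).
    rewrite ipBr // [X in _ = _ - X]ip_sumr // big1 ?subr0 => [|i _]; last first.
      by rewrite ipZr // ou ?mulr0.
    by rewrite (ip_sym hip (E z)) Eip // -(ip_sym hip).
  apply: (le_trans (cauchy_schwarz hip _ _)).
  by rewrite nu mul1r nrmBC.
have l00 : l = 0 by apply: (sqn_eq0 hip); rewrite /sqn l0.
have : d = 0.
  apply: cvg0_const_le hl => n; rewrite (ltW d0) /= l00 subr0.
  by have [] := hu (phi n).
by move=> dd; rewrite dd ltxx in d0.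
Qed.

Lemma sectionZ n c x : section_proj n (c *: x) = c *: section_proj n x.
Proof.
rewrite /section_proj scaler_sumr; apply: eq_bigr => i _.
by rewrite ipZl // scalerA.
Qed.

Lemma hsnorm2_cvE n (x : 'cV[R[i]]_n) : hsnorm2 x = (\sum_i modulus (x i 0) ^+ 2)%:C.
Proof.
rewrite /hsnorm2 rmorph_sum; apply: eq_bigr => i _.
by rewrite big_ord1 modulusE rmorphXn.
Qed.

(* The substitution [x = (1 + t A)^-1 y] turns the pencil [z A x = (1 + P delta) x]
   on the span of [e 0, ..., e n] into [r y = mu (1 + F) y] with
   [r = q / (1 + t q)], [z = 1 / mu - t] and [F = P delta (1 + t A)^-1]; the norm
   of [F] is small for large [t], uniformly in [n]. *)
Lemma finite_sections a : h = (2 ^ a.+1)%N -> 0 < q 0 ->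
  exists Z, forall n, exists v (z : R[i]),
    [/\ N v, nrm v = 1, modulus z <= Z & v = z *: A v - section_proj n.+1 (delta v)].
Proof.
move=> hE q00; have [M M0 hM] := compact_bounded hip dlin dcompact.
have [_ _ h1 h2 _] := heq.
set H := h.*2; have H0 : (0 < H)%N by rewrite double_gt0.
(* The size that [pencil_eigenvalue] allows for [F]; there [2 d] bounds [(1 + F)^-1 - 1]. *)
pose d : R := (4 * H%:R * 2 ^+ H)^-1.
have d0 : 0 < d by rewrite invr_gt0 !mulr_gt0 ?ltr0n ?exprn_gt0.
have d1 : H%:R * 2 ^+ H * (2 * d) = 2^-1.
  by rewrite /d; field; rewrite expf_neq0 // pnatr_eq0 -lt0n H0.
have d2 : d <= 2^-1.
  have : 1 <= H%:R * 2 ^+ H :> R by rewrite mulr_ege1 ?ler1n // exprn_ege1 // ler1n.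
  clearbody d; move: (H%:R * 2 ^+ H) d1 => X d1 X1; have := mulr_ge0 (ltW d0) (_ : 0 <= X - 1).
  by rewrite subr_ge0 => /(_ X1); nra.
have dd0 : 0 < d / 2 by rewrite divr_gt0.
have [k hk] := compact_tail dd0.
(* [F] receives [d / 2] from the indices at least [k], where [delta] is small, and [M tau = d / 2]
   from the finitely many others, damped by weights [w i <= tau]. *)
pose tau := d / (2 * M); have tau0 : 0 < tau by rewrite divr_gt0 ?mulr_gt0.
have tauE : M * tau = d / 2 by rewrite /tau; field; rewrite gt_eqF.
clearbody tau.
(* A sum in place of a maximum: it gives [t >= 1 / (tau q i)] for each [i < k] with [q i > 0], and
   does not depend on the section. *)
pose t := \sum_(i < k) (if 0 < q i then (tau * q i)^-1 else 0).
have tt i : 0 <= (if 0 < q i then (tau * q i)^-1 else 0).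
  by case: ifP => // qi; rewrite invr_ge0 mulr_ge0 // ltW.
have t0 : 0 <= t by apply: sumr_ge0.
have tq i : 0 < 1 + t * q i by rewrite ltr_pwDl // mulr_ge0.
pose w i := (1 + t * q i)^-1.
have w0 i : 0 < w i by rewrite invr_gt0.
have w1 i : w i <= 1 by rewrite invf_le1 // lerDl mulr_ge0.
have wE i : w i * (1 + t * q i) = 1 by rewrite mulVf // gt_eqF.
have wtau i : (i < k)%N -> 0 < q i -> w i <= tau.
  move=> ik qi; rewrite -[leRHS]invrK /w lef_pV2 ?posrE ?invr_gt0 //.
  have : tau^-1 <= t * q i.
    have -> : tau^-1 = (tau * q i)^-1 * q i by rewrite [in RHS]invfM mulfVK // gt_eqF.
    rewrite ler_pM2r // /t (bigD1 (Ordinal ik)) //= qi lerDl; exact: sumr_ge0.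
  by move=> /le_trans -> //; rewrite lerDr.
have K0 : 0 < K.
  apply: lt_le_trans (hK 1); rewrite big_ord1 exprn_gt0 //.
(* The lower bound for [|mu|^h], free of [n]. It gives [|1 / mu| <= 1 + 1 / theta] whether or not
   [|mu| >= 1], and with [z = 1 / mu - t] the uniform bound announced below. *)
pose theta := (q 0 * w 0) ^+ H / (4 * 2 ^+ h * K).
have th0 : 0 < theta by rewrite divr_gt0 ?exprn_gt0 ?mulr_gt0 // exprn_gt0.
exists (1 + theta^-1 + t) => n.
pose r : 'rV[R[i]]_n.+1 := \row_i (q i * w i)%:C.
pose F : 'M[R[i]]_n.+1 := \matrix_(i, j) ((w j)%:C * ip (delta (e j)) (e i)).
pose ext (x : 'cV[R[i]]_n.+1) (j : nat) : R[i] := if insub j is Some i then x i 0 else 0.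
have extE (x : 'cV[R[i]]_n.+1) (j : 'I_n.+1) : ext x j = x j 0 by rewrite /ext valK.
pose comb (x : 'cV[R[i]]_n.+1) := \sum_(j < n.+1) ((w j)%:C * ext x j) *: e j.
have Fx (x : 'cV[R[i]]_n.+1) i : (F *m x) i 0 = ip (delta (comb x)) (e i).
  rewrite mxE /comb (linop_sum _ _ _ dlin) ip_suml //; apply: eq_bigr => j _.
  by rewrite mxE (linopZ _ _ dlin) ipZl // extE mulrAC.
have hF : mxbounded d%:C F.
  apply: mxbounded_col => x; rewrite !hsnorm2_cvE -rmorphXn -rmorphM lecR.
  under eq_bigr do rewrite Fx.
  apply: (le_trans (bessel n.+1 _)).
  set S := \sum_i _; have S0 : 0 <= S by apply: sumr_ge0 => i _; rewrite sqr_ge0.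
  pose c1 (j : nat) := (w j)%:C * ext x j.
  have split_comb : comb x = \sum_(j < n.+1 | (j < k)%N) c1 j *: e j +
      \sum_(j < n.+1 | ~~ (j < k)%N) c1 j *: e j by rewrite /comb (bigID (fun j : 'I_n.+1 => (j < k)%N)).
  have b1 : nrm (\sum_(j < n.+1 | (j < k)%N) c1 j *: e j) <= tau * Num.sqrt S.
    rewrite -(@ler_pXn2r _ 2) ?nnegrE ?nrm_ge0 ?mulr_ge0 ?sqrtr_ge0 ?(ltW tau0) //.
    rewrite sqr_nrm // (sqn_comb (fun j => (j < k)%N)) exprMn sqr_sqrtr // mulr_sumr big_mkcond.
    apply: ler_sum => j _; rewrite /c1 extE modulusM exprMn modulusC ger0_norm ?(ltW (w0 _)) //.
    have nn : 0 <= tau ^+ 2 * modulus (x j 0) ^+ 2 by rewrite mulr_ge0 ?sqr_ge0.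
    case: ifP => // jk; have [qz|qnz] := eqVneq (q j) 0.
      by rewrite (h2 _ qz) /sqn ip0l // mulr0.
    have qj : 0 < q j by rewrite lt0r qnz q0.
    rewrite -sqr_nrm // h1 // expr1n mulr1 ler_wpM2r ?sqr_ge0 //.
    by rewrite lerXn2r ?nnegrE ?(ltW tau0) ?(ltW (w0 _)) // wtau.
  have b2 : nrm (\sum_(j < n.+1 | ~~ (j < k)%N) c1 j *: e j) <= Num.sqrt S.
    rewrite -(@ler_pXn2r _ 2) ?nnegrE ?nrm_ge0 ?sqrtr_ge0 //.
    rewrite sqr_nrm // (sqn_comb (fun j => ~~ (j < k)%N)) sqr_sqrtr // big_mkcond.
    apply: ler_sum => j _; rewrite /c1 extE modulusM exprMn modulusC ger0_norm ?(ltW (w0 _)) //.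
    case: ifP => _; last by rewrite sqr_ge0.
    rewrite mulrAC ler_piMl ?sqr_ge0 //.
    by rewrite mulr_ile1 ?sqr_ge0 ?sqn_ge0 ?nrm_eigen_le1 // expr_le1 // ltW.
  have b3 : nrm (delta (comb x)) <= d * Num.sqrt S.
    rewrite split_comb linopD //; apply: (le_trans (nrmD hip _ _)).
    have b4 := le_trans (hM _) (ler_wpM2l (ltW M0) b1).
    (* The composed equality says that the second sum has no component along [e i] for [i < k]. *)
    have b5 := le_trans (hk _ (N_comb (fun j => ~~ (j < k)%N) n.+1 c1)
       (fun i ik => etrans (ip_comb (fun j => ~~ (j < k)%N) n.+1 c1 i)
         (ifF _ _ (etrans (congr1 (andb _) (congr1 negb ik)) (andbF _)))))
       (ler_wpM2l (ltW dd0) b2).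
    rewrite mulrA tauE in b4; apply: (le_trans (lerD b4 b5)); rewrite -mulrDl -splitr lexx //.
  rewrite -sqr_nrm // -(sqr_sqrtr S0) -exprMn lerXn2r // nnegrE ?nrm_ge0 //.
  by rewrite mulr_ge0 ?sqrtr_ge0 // ltW.
have rE i : r 0 i = (q i * w i)%:C by rewrite mxE.
have r0 i : 0 <= r 0 i by rewrite rE -(rmorph0 (real_complex R)) lecR mulr_ge0 // ltW.
have r00 : 0 < r 0 ord0 by rewrite rE -(rmorph0 (real_complex R)) ltcR mulr_gt0.
have [|||||mu [y [y0 hy]]] := @pencil_eigenvalue _ n.+1 a r F K%:C d%:C ord0 r0 r00.
- rewrite -hE; under eq_bigr do rewrite rE -rmorphXn.
  rewrite -rmorph_sum lecR; apply: le_trans (hK n.+1); apply: ler_sum => i _.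
  by rewrite lerXn2r ?nnegrE ?mulr_ge0 ?(ltW (w0 _)) // ler_piMr.
- by rewrite -(rmorph0 (real_complex R)) ltcR.
- by rewrite -(rmorph_nat (real_complex R)) -fmorphV lecR.
- rewrite -hE -/H -!(rmorph_nat (real_complex R)) -rmorphXn -!rmorphM -fmorphV lecR.
  by rewrite d1.
- exact: hF.
rewrite -hE -/H => hmu.
have {}hmu : theta <= modulus mu ^+ h.
  rewrite -lecR [X in _ <= X]rmorphXn /= -modulusE; apply: le_trans hmu.
  by rewrite rE /theta rmorphM fmorphV !rmorphM !rmorphXn !rmorphM !rmorph_nat.
have mu0 : mu != 0.
  apply: contraTneq hmu => ->; rewrite (modulusC 0) normr0 expr0n gtn_eqF //= -ltNge //.
have muV : modulus (mu^-1) <= 1 + theta^-1.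
  have m0 : 0 < modulus mu.
    by rewrite lt0r modulus_ge0 andbT; apply: contra mu0 => /eqP/modulus_eq0/eqP.
  have -> : modulus mu^-1 = (modulus mu)^-1.
    apply: (mulfI (lt0r_neq0 m0)); rewrite -modulusM (divff mu0) divff ?(lt0r_neq0 m0) //.
    by rewrite (modulusC 1) normr1.
  have [m1|m1] := leP 1 (modulus mu).
    apply: (@le_trans _ _ 1); first by rewrite invf_le1.
    by rewrite lerDl invr_ge0 ltW.
  have : theta <= modulus mu.
    apply: (le_trans hmu); rewrite -(prednK h0) exprS ler_piMr ?modulus_ge0 //.
    by rewrite exprn_ile1 ?modulus_ge0 // ltW.
  by rewrite -lef_pV2 ?posrE // => /le_trans -> //; rewrite lerDr ler01.
have eqi (i : 'I_n.+1) : (q i * w i)%:C * y i 0 = mu * (y i 0 + ip (delta (comb y)) (e i)).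
  have /matrixP/(_ i 0) := hy; rewrite mul_diag_mx mxE rE => ->.
  by rewrite [LHS]mxE [X in _ * X]mxE Fx.
set v0 := comb y in eqi.
pose z := mu^-1 - t%:C.
have v0E : v0 = z *: A v0 - section_proj n.+1 (delta v0).
  have -> : A v0 = \sum_(i < n.+1) (((w i)%:C * ext y i) * (q i)%:C) *: e i.
    rewrite /v0 (linop_sum _ _ _ Alin); apply: eq_bigr => i _.
    by rewrite (linopZ _ _ Alin) Ae scalerA.
  rewrite {1}/v0 /section_proj scaler_sumr -sumrB; apply: eq_bigr => i _.
  rewrite scalerA -scalerBl; congr (_ *: _); rewrite extE.
  have -> : ip (delta v0) (e i) = mu^-1 * ((q i * w i)%:C * y i 0) - y i 0.
    by rewrite eqi mulKf // addrAC subrr add0r.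
  (* The identity [w = 1 - t q w] cancels the shift by [t] contained in [z]. *)
  have hw : (w i)%:C = 1 - t%:C * (q i)%:C * (w i)%:C.
    by rewrite -!rmorphM -(rmorph1 (real_complex R)) -rmorphB -(wE i); congr (_%:C); ring.
  by rewrite /z rmorphM {1}hw; ring.
have v00 : v0 != 0.
  apply: contraNneq y0 => v00; apply/eqP/colP => i; rewrite mxE.
  have := congr1 sqn v00; rewrite (sqn_comb xpredT n.+1 (fun j => (w j)%:C * ext y j)).
  rewrite {2}/sqn ip0l // => /eqP; rewrite psumr_eq0; last first.
    by move=> j _; rewrite mulr_ge0 ?sqr_ge0 ?sqn_ge0.
  move=> /allP/(_ i (mem_index_enum _)) /=; rewrite mulf_eq0 sqrf_eq0 => /orP[|].
    move=> /eqP/modulus_eq0/eqP; rewrite mulf_eq0 extE => /orP[|/eqP//].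
    by rewrite -(rmorph0 (real_complex R)) (inj_eq (@complexI R)) gt_eqF.
  (* A coordinate with [e i = 0] is invisible in [v0]; but there [q i = 0], so its equation reads
     [0 = mu * y i 0], and [mu != 0] kills it. *)
  move=> /eqP/(sqn_eq0 hip) ei0; have := eqi i; rewrite ei0 ip0r // addr0.
  have -> : q i = 0.
    apply/eqP; apply: contraTT isT => qi; have := h1 i; rewrite lt0r qi q0 ei0 nrm0 //.
    by move=> /(_ isT)/esym/eqP; rewrite oner_eq0.
  by rewrite mul0r mul0r => /esym/eqP; rewrite mulf_eq0 (negPf mu0) => /eqP.
exists (((nrm v0)^-1)%:C *: v0), z; split.
- by apply: (csZ _ hN); exact: (N_comb xpredT n.+1 (fun j => (w j)%:C * ext y j)).
- exact: nrm_normalize.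
- apply: (le_trans (modulusD _ _)); rewrite modulusN modulusC ger0_norm // lerD2r //.
- by rewrite (linopZ _ _ Alin) (linopZ _ _ dlin) sectionZ scalerA mulrC -scalerA -scalerBr -v0E.
Qed.

(** The numbers [z] are bounded and the vectors pass through the compact [A] and [delta], so along a
    subsequence both terms on the right converge in norm. The unit vectors then converge in norm
    themselves, and their limit cannot degenerate to [0]. *)
Lemma pencil_solution a : h = (2 ^ a.+1)%N -> 0 < q 0 ->
  exists x (z : R[i]), [/\ N x, nrm x = 1 & x = z *: A x - E (delta x)].
Proof.
move=> hE q00; have [Z hZ] := finite_sections hE q00.
have /choice [vz hvz] : forall n, exists vz : V * R[i],
    [/\ N vz.1, nrm vz.1 = 1, modulus vz.2 <= Z
      & vz.1 = vz.2 *: A vz.1 - section_proj n.+1 (delta vz.1)].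
  by move=> n; have [v [z ?]] := hZ n; exists (v, z).
pose v n := (vz n).1; pose z n := (vz n).2.
have [|p1 [hp1 [zl hzl]]] := @cbounded_subseq R z Z; first by move=> n; have [] := hvz n.
have [|p2 [hp2 [l hl]]] := Acompact (u := v \o p1).
  by move=> n /=; have [_ -> _] := hvz (p1 n).
have [|p3 [hp3 [b hb]]] := dcompact (u := v \o p1 \o p2).
  by move=> n /=; have [_ -> _] := hvz (p1 (p2 n)).
pose p := p1 \o p2 \o p3.
have hp : {homo p : m n / (m < n)%N} by move=> m n mn; apply: hp1; apply: hp2; exact: hp3.
have hpS : {homo (fun n => (p n).+1) : m n / (m < n)%N} by move=> m n /hp; rewrite ltnS.
have hl' : tends (fun n => A (v (p n))) l := tends_subseq hp3 hl.
have hz : (fun n => modulus (z (p n) - zl)) @ \oo --> (0 : R).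
  by have := cvg0_subseq (phi := p2 \o p3) (fun m n mn => hp2 _ _ (hp3 _ _ mn)) hzl.
(* Sections are contractions converging pointwise to [E], so they may be applied to a convergent
   sequence. *)
have hPd : tends (fun n => section_proj (p n).+1 (delta (v (p n)))) (E b).
  have hs := tends_subseq hpS (tends_section b).
  apply: squeeze0 (cvg0D hb hs) => n; rewrite nrm_ge0 /=.
  rewrite (_ : _ - E b = section_proj (p n).+1 (delta (v (p n)) - b) +
      (section_proj (p n).+1 b - E b)); last by rewrite sectionB addrA subrK.
  by apply: (le_trans (nrmD hip _ _)); rewrite lerD2r nrm_section.
have [B hB] := tends_bounded hip hl'.
have hzA : tends (fun n => z (p n) *: A (v (p n))) (zl *: l).
  apply: squeeze0 (cvg0D (cvg0Ml B hz) (cvg0Ml (modulus zl) hl')) => n.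
  rewrite nrm_ge0 /= (_ : _ - zl *: l = (z (p n) - zl) *: A (v (p n)) + zl *: (A (v (p n)) - l)).
    by apply: (le_trans (nrmD hip _ _)); rewrite !nrmZ // lerD2r mulrC ler_wpM2r ?modulus_ge0.
  by rewrite scalerBl scalerBr addrA subrK.
set x := zl *: l - E b.
have hv : tends (fun n => v (p n)) x.
  have := tendsB hip hzA hPd; congr tends; apply/funext => n.
  by have [_ _ _ ev] := hvz (p n); rewrite [RHS]ev.
exists x, zl; split.
- by apply: (cs_lim hN) hv => n; have [] := hvz (p n).
- by apply: (nrm_lim hip hv) => n; have [] := hvz (p n).
have -> : A x = l := tends_unique hip (tends_op hip Alin Acompact hv) hl'.
by have -> : delta x = b := tends_unique hip (tends_op hip dlin dcompact hv) hb.
Qed.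

End SchattenBound.
End Eigenbasis.
End Keldysh.

(** * From a solution of the pencil to a new root vector *)

Section Completeness.
Variables (R : realType) (V : lmodType R[i]) (ip : V -> V -> R[i]).
Hypothesis hip : inner_product ip.
Hypothesis hc : hcomplete ip.

(** The decomposition along [M] and its complement is unique, which makes the chosen component
    linear. *)
Lemma orthogonal_projector (M : V -> Prop) : closed_subspace ip M ->
  exists E : V -> V, [/\ linear E, forall x, orth ip M (E x), forall x, M (x - E x)
    & forall x y, orth ip M y -> ip (E x) y = ip x y].
Proof.
move=> hM; have /choice [F hF] : forall x, exists y, M y /\ orth ip M (x - y).
  by move=> x; have [y] := projection hip x hc hM; exists y.
have hO := orth_closed hip M.
have uniq w : M w -> orth ip M w -> w = 0.
  by move=> Mw ow; apply: (sqn_eq0 hip); rewrite /sqn ow.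
exists (fun x => x - F x); split.
- move=> a x y; apply/eqP; rewrite -subr_eq0; apply/eqP; apply: uniq.
    have -> : (a *: x + y - F (a *: x + y)) - (a *: (x - F x) + (y - F y)) =
        (a *: F x + F y) - F (a *: x + y).
      rewrite scalerBr (addrACA (a *: x)) -opprD opprB.
      by rewrite [LHS]addrC addrA subrK.
    by apply: (csB hM); [apply: (cs_lin hM); apply: (hF _).1|apply: (hF _).1].
  by apply: (csB hO); [apply: (hF _).2|apply: (cs_lin hO); apply: (hF _).2].
- by move=> x; have [] := hF x.
- by move=> x; rewrite subKr; have [] := hF x.
- by move=> x y oy; rewrite ipBl // (ip_eq0C hip (oy _ (hF x).1)) subr0.
Qed.

(* If [x = z E Q x - E delta x] with [E] the projector onto the complement of
   [M], then [y = x + delta x] satisfies [y - z P y \in M]; stabilisation of the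
   ranges of [(P - 1/z)^k] on [M] forces [y \in M], hence [Q x = P y \in M]. *)
Theorem keldysh (Q delta P : V -> V) (M : V -> Prop) (s : nat -> R) (a : nat) (K : R) :
  linear Q -> seq_compact ip Q -> (forall x y, ip (Q x) y = ip x (Q y)) ->
  (forall x, 0 <= ip (Q x) x) -> (forall x, ip (Q x) x = 0 -> x = 0) ->
  linear delta -> seq_compact ip delta -> linear P -> seq_compact ip P ->
  (forall x, P (x + delta x) = Q x) ->
  closed_subspace ip M -> (forall x, M x -> M (P x)) ->
  (forall (lam : R[i]) m u, lam != 0 -> iter m (fun w => P w - lam *: w) u = 0 -> M u) ->
  (forall n, 0 <= s n) ->
  (forall n, exists f : 'I_n -> V, forall x, (forall i, ip x (f i) = 0) ->
     nrm ip (Q x) <= s n * nrm ip x) ->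
  (forall n, \sum_(i < n) s i ^+ (2 ^ a.+1) <= K) ->
  forall x, M x.
Proof.
move=> Qlin Qcpt Qsym Qge0 Qinj dlin dcpt Plin Pcpt PQ hM PM root s0 hs hK.
have [E [Elin EN EM Eip]] := orthogonal_projector hM.
have hN := orth_closed hip M.
suff EQ0 x : orth ip M x -> x = 0.
  by move=> x; have := EM x; rewrite (EQ0 (E x)) ?subr0.
move=> ox.
have [e [q heq]] := exists_eigenseq hip Qlin Qcpt Qsym Qge0 hN Elin EN Eip.
have [h1 _ h2 h3 h4] := heq.
have q0 n : 0 <= q n by have [] := h1 n.
have qs n : q n <= s n.
  have [f hf] := hs n.
  exact: (q_le_approx hip Qlin hN Elin Eip heq (s0 n) hf).
have hq n : \sum_(i < n) q i ^+ (2 ^ a.+1) <= K.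
  by apply: le_trans (hK n); apply: ler_sum => i _; rewrite lerXn2r // nnegrE.
(* If [q 0] vanishes, [E Q] is zero on the complement of [M], so [(Q x, x) = 0] there. *)
have [q00|qn0] := eqVneq (q 0%N) 0.
  apply: Qinj; rewrite -Eip //.
  have : nrm ip (E (Q x)) <= q 0%N * nrm ip x by exact: h4.
  rewrite q00 mul0r => h; rewrite (nrm_eq0 hip (x := E (Q x))) ?ip0l //.
  by apply/eqP; rewrite eq_le h nrm_ge0.
exfalso; have q00 : 0 < q 0%N by rewrite lt0r qn0 q0.
have hh : (0 < 2 ^ a.+1)%N by rewrite expn_gt0.
have [u [z [Nu nu eu]]] := pencil_solution hip hc Qlin Qcpt Qinj hN Elin EN Eip
  heq hh hq dlin dcpt erefl q00.
pose y := u + delta u.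
have Py : P y = Q u by exact: PQ.
(* The equation for [u] says exactly that [E (y - z P y) = 0]. *)
have Mw : M (y - z *: P y).
  have -> : y - z *: P y = (y - z *: P y) - E (y - z *: P y).
    rewrite (linopB _ _ Elin) (linopZ _ _ Elin) (linopD _ _ Elin) Py.
    rewrite (E_id hip hN EN Eip Nu) [X in X + E (delta u)]eu.
    by rewrite subrK subrr subr0.
  exact: EM.
(* For then [Q u = P y] is in [M] while [u] is orthogonal to [M]: [(Q u, u) = 0] contradicts
   [|u| = 1]. *)
suff My : M y.
  have : M (Q u) by rewrite -Py; exact: PM.
  move=> /Nu /(ip_eq0C hip)/Qinj u0; move: nu; rewrite u0 nrm0 // => /esym/eqP.
  by rewrite oner_eq0.
have [z0|z0] := eqVneq z 0; first by move: Mw; rewrite z0 scale0r subr0.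
have l0 : z^-1 != 0 by rewrite invr_eq0.
pose B w := P w - z^-1 *: w.
have Blin : linear B by exact: linear_shift.
have MB : M (B y).
  have -> : B y = - (z^-1) *: (y - z *: P y).
    by rewrite scalerBr !scaleNr scalerA mulVf // scale1r opprK addrC.
  exact: (csZ _ hM).
have [k hk] := shift_descent hip hc Plin Pcpt l0 hM PM.
have [w Mw' hw] := hk _ MB.
have iterB n x1 x2 : iter n B (x1 - x2) = iter n B x1 - iter n B x2.
  by elim: n => //= n ->; rewrite (linopB _ _ Blin).
(* [B^(k+1) y = B^k (B y) = B^(k+1) w], so [y - w] is annihilated by a power of [P - 1 / z]. *)
have Myw : M (y - w).
  apply: (root z^-1 k.+1) => //; rewrite -/B iterB.
  by rewrite {1}iterSr hw subrr.
by rewrite -(subrK w y); apply: (csD hM).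
Qed.

End Completeness.

(** * Real-valued norms and the bounded inverse theorem *)

Section RealNorm.
Variable R : realType.

Definition rnorm (V : normedModType R[i]) (x : V) : R := complex.Re `|x|.

Section OneSpace.
Variable V : normedModType R[i].
Implicit Types (x y : V) (u : nat -> V).

Lemma rnormE x : `|x| = (rnorm x)%:C.
Proof.
have := normr_ge0 x; rewrite lecE /rnorm => /andP[/eqP + _].
by case: `|x| => a b /= ->.
Qed.

Lemma rnorm_ge0 x : 0 <= rnorm x.
Proof. by rewrite -lecR -rnormE rmorph0. Qed.

Lemma rnormD x y : rnorm (x + y) <= rnorm x + rnorm y.
Proof. by rewrite -lecR rmorphD /= -!rnormE ler_normD. Qed.

Lemma rnormN x : rnorm (- x) = rnorm x.
Proof. by rewrite /rnorm normrN. Qed.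

Lemma rnormB x y : rnorm (x - y) <= rnorm x + rnorm y.
Proof. by rewrite -(rnormN y) rnormD. Qed.

Lemma rnormBC x y : rnorm (x - y) = rnorm (y - x).
Proof. by rewrite -opprB rnormN. Qed.

Lemma rnormZ (a : R[i]) x : rnorm (a *: x) = modulus a * rnorm x.
Proof. by apply: complexI; rewrite rmorphM /= -modulusE -!rnormE normrZ. Qed.

Lemma rnorm0 : rnorm (0 : V) = 0.
Proof. by rewrite /rnorm normr0. Qed.

Lemma rnorm_eq0 x : rnorm x = 0 -> x = 0.
Proof. by move=> h; apply/eqP; rewrite -normr_eq0 rnormE h. Qed.

Lemma rnorm_gt0 x : x != 0 -> 0 < rnorm x.
Proof. by rewrite lt0r rnorm_ge0 andbT; apply: contra => /eqP/rnorm_eq0/eqP. Qed.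

Lemma norm_lt_rnorm x (a : R) : (`|x| < a%:C) = (rnorm x < a).
Proof. by rewrite rnormE ltcR. Qed.

Lemma norm_le_rnorm x (a : R) : (`|x| <= a%:C) = (rnorm x <= a).
Proof. by rewrite rnormE lecR. Qed.

Lemma gt0_complex (e : R[i]) : 0 < e -> exists2 a : R, 0 < a & e = a%:C.
Proof.
by case: e => a b; rewrite ltcE /= => /andP[/eqP -> h]; exists a.
Qed.

Lemma cvg_rnorm u x : u @ \oo --> x <-> (fun n => rnorm (u n - x)) @ \oo --> (0 : R).
Proof.
split=> [/cvgrPdist_lt h|/cvg0P h].
  apply/cvg0P => e e0; have [|N _ hN] := h e%:C; first by rewrite ltcR.
  by exists N => n /hN /=; rewrite norm_lt_rnorm rnormBC ger0_norm ?rnorm_ge0.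
apply/cvgrPdist_lt => e /gt0_complex[a a0 ->]; have [N hN] := h a a0.
by exists N => // n /= /hN; rewrite norm_lt_rnorm rnormBC ger0_norm ?rnorm_ge0.
Qed.

Lemma closure_rnorm (A : set V) x :
  closure A x <-> forall e, 0 < e -> exists2 y, A y & rnorm (x - y) < e.
Proof.
split=> [h e e0|h B /nbhs_ballP[e /= /gt0_complex[a a0 ->]] hB].
  have [|y [Ay]] := h (ball x e%:C); first by apply: nbhsx_ballx; rewrite ltcR.
  by rewrite -ball_normE /= norm_lt_rnorm; exists y.
have [y Ay hy] := h a a0; exists y; split => //; apply: hB.
by rewrite -ball_normE /= norm_lt_rnorm.
Qed.

End OneSpace.

Lemma rnorm_complete (V : completeNormedModType R[i]) (u : nat -> V) :
  (forall e, 0 < e -> exists N, forall m n, (N <= m)%N -> (N <= n)%N -> rnorm (u m - u n) < e) ->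
  exists l, (fun n => rnorm (u n - l)) @ \oo --> (0 : R).
Proof.
move=> h; suff /cvg_ex[l /cvg_rnorm] : cvg (u @ \oo) by exists l.
apply/cauchy_cvgP/cauchy_exP => e /gt0_complex[a a0 ->].
have [N hN] := h a a0; exists (u N); exists N => // n /= Nn.
by rewrite -ball_normE /= norm_lt_rnorm; exact: hN.
Qed.

Lemma continuous_rbounded (V W : normedModType R[i]) (f : V -> W) : linear f ->
  continuous f -> exists2 M, 0 < M & forall x, rnorm (f x) <= M * rnorm x.
Proof.
move=> flin fc.
have f0 := linop0 flin.
have /cvgrPdist_lt/(_ 1 ltr01) := fc 0.
move=> /nbhs_ballP[e /= /gt0_complex[a a0 ->]] h.
exists (2 / a); first by rewrite divr_gt0.
move=> x; have [->|x0] := eqVneq x 0; first by rewrite f0 !rnorm0 mulr0.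
have nx := rnorm_gt0 x0.
have : rnorm (f ((a / 2 / rnorm x)%:C *: x)) < 1.
  have := h ((a / 2 / rnorm x)%:C *: x); rewrite f0 sub0r normrN (norm_lt_rnorm _ 1); apply.
  rewrite -ball_normE /= sub0r normrN norm_lt_rnorm rnormZ modulusC ger0_norm; last first.
    by rewrite !divr_ge0 // ltW.
  by rewrite divfK ?gt_eqF //; lra.
rewrite linopZ // rnormZ modulusC ger0_norm; last by rewrite !divr_ge0 // ltW.
have -> : a / 2 / rnorm x * rnorm (f x) = rnorm (f x) / (2 / a * rnorm x).
  by field; rewrite !gt_eqF.
by rewrite ltr_pdivrMr ?mulr_gt0 ?invr_gt0 // mul1r => /ltW.
Qed.

Lemma rbounded_continuous (V W : normedModType R[i]) (f : V -> W) (M : R) : linear f ->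
  (forall x, rnorm (f x) <= M * rnorm x) -> continuous f.
Proof.
move=> flin hM x; apply/cvgrPdist_lt => e /gt0_complex[a a0 ->].
have M1 : 0 < `|M| + 1 by rewrite ltr_wpDl.
apply/nbhs_ballP; exists (a / (`|M| + 1))%:C; first by rewrite /= ltcR divr_gt0.
move=> y; rewrite -ball_normE /= !norm_lt_rnorm ltr_pdivlMr // => h.
rewrite -linopB //; apply: (le_lt_trans (hM _)); apply: le_lt_trans h; rewrite mulrC ler_wpM2l ?rnorm_ge0 //.
by rewrite (le_trans (ler_norm _)) // lerDl.
Qed.

(* Baire: the sets [rnorm (T y) <= n] cover [Y], so one of them is dense in some
   ball; then every [y] is approximated with a controlled [T], and the errors
   are summed as a geometric series. *)
Lemma bounded_inverse (X Y : completeNormedModType R[i]) (S : X -> Y) (T : Y -> X) (B : R) :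
  linear S -> linear T -> cancel S T -> cancel T S ->
  (forall x, rnorm (S x) <= B * rnorm x) ->
  exists2 C, 0 < C & forall y, rnorm (T y) <= C * rnorm y.
Proof.
move=> Slin Tlin SK TK hB.
have T0 := linop0 Tlin.
have TB y z : T (y - z) = T y - T z := linopB y z Tlin.
have SB x y : S (x - y) = S x - S y := linopB x y Slin.
have [n [y0 [r [r0 dense_r]]]] : exists (n : nat) (y0 : Y) (r : R), 0 < r /\
    forall y, rnorm (y - y0) < r -> forall d, 0 < d ->
      exists a, rnorm (T a) <= n%:R /\ rnorm (y - a) < d.
  apply: contrapT => hno.
  (* [np] holds a stage [n] and a ball, as centre and radius. If the set [rnorm (T a) <= n] is not
     dense in the ball, some smaller closed ball avoids that set. *)
  have step (np : nat * (Y * R)) : exists p : Y * R, 0 < np.2.2 ->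
      [/\ 0 < p.2, p.2 <= np.2.2 / 2 & forall z, rnorm (z - p.1) <= p.2 ->
        rnorm (z - np.2.1) <= np.2.2 /\ np.1%:R < rnorm (T z)].
    case: np => n [y0 r] /=; apply: contrapT => hp; apply: hno.
    have [r0|r0] := ltP 0 r; last by exfalso; apply: hp; exists (0, 0) => h; have := lt_le_trans h r0; rewrite ltxx.
    exists n, y0, r; split => // y hy d d0; apply: contrapT => ha; apply: hp.
    (* The three bounds keep the new closed ball off the set, inside the old ball, and at most half
       as large. *)
    pose r1 := Num.min (d / 2) (Num.min ((r - rnorm (y - y0)) / 2) (r / 2)).
    exists (y, r1) => _ /=; have h1 : 0 < r1.
      by rewrite /r1 !lt_min !divr_gt0 ?subr_gt0.
    have h2 : r1 <= d / 2 by rewrite /r1 ge_min lexx.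
    have h3 : r1 <= (r - rnorm (y - y0)) / 2 by rewrite /r1 !ge_min lexx !orbT.
    have h4 : r1 <= r / 2 by rewrite /r1 !ge_min lexx !orbT.
    split => // z hz; split.
      have := rnormD (z - y) (y - y0); rewrite addrA subrK.
      move: hz h3 hy (rnorm_ge0 (z - y)); lra.
    rewrite ltNge; apply/negP => hTz; apply: ha; exists z; split => //.
    rewrite rnormBC; move: hz h2; lra.
  have [G hG] := choice step.
  pose fix p n : Y * R := if n is m.+1 then G (m, p m) else (0, 1).
  have p0 n : 0 < (p n).2.
    by elim: n => [|n IH] //=; have [] := hG (n, p n) IH.
  have pS n : (p n.+1).2 <= (p n).2 / 2 by have [] := hG (n, p n) (p0 n).
  have nest n k z : rnorm (z - (p (n + k)%N).1) <= (p (n + k)%N).2 ->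
      rnorm (z - (p n).1) <= (p n).2.
    elim: k => [|k IH]; rewrite ?addn0 // addnS => hz; apply: IH.
    by have [_ _ /(_ z hz)[]] := hG ((n + k)%N, p (n + k)%N) (p0 _).
  have psmall n : (p n).2 <= n.+1%:R^-1.
    elim: n => [|n IH]; first by rewrite invr1.
    apply: (le_trans (pS n)); rewrite ler_pdivrMr //; apply: (le_trans IH).
    rewrite mulrC -ler_pdivrMr ?invr_gt0 ?ltr0n // invrK mulrC ler_pdivrMr ?ltr0n //.
    by rewrite -natrM ler_nat mulnC; lia.
  have near m n : (n <= m)%N -> rnorm ((p m).1 - (p n).1) <= (p n).2.
    move=> nm; apply: (nest n (m - n)%N); rewrite subnKC // subrr rnorm0; exact: ltW.
  have [|l hl] := @rnorm_complete Y (fun n => (p n).1).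
    move=> e e0; have e20 : 0 < e / 2 by rewrite divr_gt0.
    have [N hN] := (cvg0P _).1 (@cvg0_invn R) _ e20.
    exists N => m n Nm Nn; have h1 := near m N Nm; have h2 := near n N Nn.
    have := rnormD ((p m).1 - (p N).1) ((p N).1 - (p n).1); rewrite addrA subrK.
    rewrite (rnormBC (p N).1); have := psmall N; have := hN N (leqnn N).
    rewrite ger0_norm ?invr_ge0 ?ler0n //.
    move: h1 h2; move: (N.+1%:R^-1) => q; lra.
  have lnear n : rnorm (l - (p n).1) <= (p n).2.
    rewrite leNgt; apply/negP => hlt; have e0 : 0 < rnorm (l - (p n).1) - (p n).2 by lra.
    have [N hN] := (cvg0P _).1 hl _ e0.
    have := hN (maxn N n) (leq_maxl _ _); rewrite ger0_norm ?rnorm_ge0 // rnormBC.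
    have := near _ _ (leq_maxr N n).
    have := rnormD (l - (p (maxn N n)).1) ((p (maxn N n)).1 - (p n).1).
    rewrite addrA subrK; lra.
  have big n : n%:R < rnorm (T l).
    by have [_ _ /(_ l (lnear n.+1))[]] := hG (n, p n) (p0 n).
  have := big (Num.truncn (rnorm (T l))).+1.
  by apply/negP; rewrite -leNgt ltW // truncnS_gt.
(* With [s |y| = r / 2], both [y0 + s y] and [y0] lie in the ball. Approximating each within [r / 8]
   and dividing the difference by [s] leaves an error [|y| / 2], and [T] of the result is at most
   [2 n / s = 4 n |y| / r]; [n.+1] keeps [D] positive. *)
pose D := 4 * n.+1%:R / r.
have D0 : 0 < D by rewrite divr_gt0 // mulr_gt0 // ltr0n.
have /choice[f hf] : forall y, exists a, rnorm (T a) <= D * rnorm y /\ rnorm (y - a) <= rnorm y / 2.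
  move=> y; have [->|yn0] := eqVneq y 0.
    by exists 0; rewrite T0 subr0 !rnorm0 mulr0 mul0r.
  have ny := rnorm_gt0 yn0; pose s := r / (2 * rnorm y).
  have s0 : 0 < s by rewrite divr_gt0 // mulr_gt0.
  have sr : s * rnorm y = r / 2 by rewrite /s; field; rewrite gt_eqF.
  have r80 : 0 < r / 8 by rewrite divr_gt0.
  have hy1 : rnorm (y0 + s%:C *: y - y0) < r.
    by rewrite addrC addKr rnormZ modulusC gtr0_norm // sr; lra.
  have hy2 : rnorm (y0 - y0) < r by rewrite subrr rnorm0.
  have [a1 [Ta1 ha1]] := dense_r _ hy1 _ r80.
  have [a2 [Ta2 ha2]] := dense_r _ hy2 _ r80.
    exists ((s^-1)%:C *: (a1 - a2)); split.
      rewrite linopZ // TB rnormZ modulusC gtr0_norm ?invr_gt0 //.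
      rewrite mulrC ler_pdivrMr // -mulrA [rnorm y * s]mulrC sr.
      apply: (le_trans (rnormB _ _)); apply: (le_trans (lerD Ta1 Ta2)).
      rewrite (_ : D * (r / 2) = 2 * n.+1%:R); last by rewrite /D; field; rewrite gt_eqF.
      by rewrite -natrD -natrM ler_nat; lia.
    have -> : y - (s^-1)%:C *: (a1 - a2) = (s^-1)%:C *: (s%:C *: y - (a1 - a2)).
      by rewrite [RHS]scalerBr scalerA -rmorphM /= mulVf ?gt_eqF // scale1r.
    rewrite rnormZ modulusC gtr0_norm ?invr_gt0 // mulrC ler_pdivrMr //.
    rewrite mulrAC [rnorm y * s]mulrC sr.
    have -> : s%:C *: y - (a1 - a2) = (y0 + s%:C *: y - a1) - (y0 - a2).
      by rewrite !opprB addrACA [- a1 - y0]addrC -(addrA y0) addrACA subrr add0r addrA.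
    by apply: (le_trans (rnormB _ _)); move: ha1 ha2; lra.
clearbody D; exists (2 * D); first by rewrite mulr_gt0.
move=> y; pose fix res k := if k is j.+1 then res j - f (res j) else y.
have hres k : rnorm (res k) <= rnorm y / 2 ^+ k.
  elim: k => [|k IH]; first by rewrite expr0 divr1.
  have [_ h] := hf (res k); apply: (le_trans h); rewrite ler_pdivrMr //.
  by apply: (le_trans IH); rewrite exprSr invfM mulrA divfK ?pnatr_eq0.
pose x k := T (y - res k).
have xS k : rnorm (x k.+1 - x k) <= D * (rnorm y / 2 ^+ k).
  have -> : x k.+1 - x k = T (f (res k)).
    have sub3 (p q : Y) : (y - p) - (y - q) = q - p by rewrite opprB addrC subrKA.
    by rewrite /x -TB sub3 /= subKr.
  by have [h _] := hf (res k); apply: (le_trans h); rewrite ler_pM2l.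
(* The tail of the geometric series that majorises the increments of [x]. *)
pose c k := 2 * D * (rnorm y / 2 ^+ k).
have cS k : c k = D * (rnorm y / 2 ^+ k) + c k.+1.
  by rewrite /c exprS; field; rewrite expf_neq0.
have c0 k : 0 <= c k.
  by rewrite mulr_ge0 ?divr_ge0 ?rnorm_ge0 ?exprn_ge0 // mulr_ge0 // ltW.
have xdist k m : rnorm (x (k + m)%N - x k) <= c k - c (k + m)%N.
  elim: m => [|m IH]; first by rewrite addn0 !subrr rnorm0.
  have := rnormD (x (k + m).+1 - x (k + m)%N) (x (k + m)%N - x k).
  rewrite addrA subrK addnS; have := xS (k + m)%N; have := cS (k + m)%N.
  by move: IH; lra.
have csmall : c @ \oo --> (0 : R).
  apply: squeeze0 (cvg0Ml (2 * D * rnorm y) (@cvg0_invn R)) => k; rewrite c0 /=.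
  rewrite /c mulrA ler_wpM2l ?mulr_ge0 ?rnorm_ge0 ?(ltW D0) //.
  rewrite lef_pV2 ?posrE ?exprn_gt0 // ?ltr0n // -natrX ler_nat; exact: ltn_expl.
have [|l hl] := @rnorm_complete X x.
  move=> e e0; have e20 : 0 < e / 2 by rewrite divr_gt0.
  have [N hN] := (cvg0P _).1 csmall _ e20; exists N => m k Nm Nk.
  have h1 := xdist N (m - N)%N; have h2 := xdist N (k - N)%N.
  rewrite subnKC // in h1; rewrite subnKC // in h2.
  have := rnormD (x m - x N) (x N - x k); rewrite addrA subrK (rnormBC (x N)).
  have := hN N (leqnn N); rewrite ger0_norm //.
  have := c0 m; have := c0 k; move: h1 h2; lra.
have Sx k : S (x k) = y - res k by rewrite /x TK.
have Sl : S l = y.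
  apply/eqP; rewrite -subr_eq0; apply/eqP/rnorm_eq0.
  have D20 : 0 < (2 * D)^-1 by rewrite invr_gt0 mulr_gt0.
  apply: cvg0_const_le (cvg0D (cvg0Ml B hl) (cvg0Ml (2 * D)^-1 csmall)) => k.
  rewrite rnorm_ge0 /=; have -> : S l - y = S (l - x k) - res k.
    have sub3 (p q : Y) : p - y = (p - (y - q)) - q by rewrite opprB addrA addrAC addrK.
    by rewrite SB Sx -sub3.
  apply: (le_trans (rnormB _ _)); apply: lerD; first by rewrite (rnormBC (x k)) hB.
  by rewrite /c mulKf ?gt_eqF ?mulr_gt0 // hres.
have -> : T y = l by rewrite -Sl SK.
rewrite leNgt; apply/negP => hlt.
have e0 : 0 < rnorm l - 2 * D * rnorm y by lra.
have [N /(_ N (leqnn N))] := (cvg0P _).1 hl _ e0; rewrite ger0_norm ?rnorm_ge0 //.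
have := xdist 0%N N; rewrite add0n [x 0%N]/x /= subrr T0 subr0.
have := rnormD (l - x N) (x N); rewrite subrK (rnormBC l).
have := c0 N; have : c 0%N = 2 * D * rnorm y by rewrite /c expr0 divr1.
lra.
Qed.

End RealNorm.

(** * Hilbert spaces and s-numbers *)

Section HilbertSpaces.
Variable R : realType.

Lemma dot_inner_product (V : lmodType R[i]) (dotV : {dot V for Num.conj}) :
  inner_product dotV.
Proof.
split=> [a x y z|x y|x x0].
- by rewrite linearDl linearZl_LR.
- by rewrite hermC expr0 mul1r.
- by rewrite dnorm_gt0.
Qed.

Lemma pullback_inner_product (V W : lmodType R[i]) (ip : W -> W -> R[i]) (L : V -> W) :
  inner_product ip -> linear L -> injective L -> inner_product (fun x y => ip (L x) (L y)).
Proof.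
move=> hip Llin Linj; split=> [a x y z|x y|x x0].
- by rewrite Llin (ip_linear hip).
- exact: (ip_sym hip).
- apply: (ip_gt0 hip); apply: contra x0 => /eqP e; apply/eqP; apply: Linj.
  by rewrite e (linop0 Llin).
Qed.

Lemma hilbert_nrm (V : completeNormedModType R[i]) (dotV : {dot V for Num.conj}) :
  is_hilbert dotV -> forall x, nrm dotV x = rnorm x.
Proof.
move=> hV x; rewrite /nrm /sqn -hV rnormE -rmorphXn /= sqrtr_sqr ger0_norm //.
exact: rnorm_ge0.
Qed.

Lemma hilbert_complete (V : completeNormedModType R[i]) (dotV : {dot V for Num.conj}) :
  is_hilbert dotV -> hcomplete dotV.
Proof.
move=> hV u hu; have [|l hl] := @rnorm_complete _ V u.
  move=> e e0; have [N hN] := hu e e0; exists N => m n hm hn.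
  by rewrite -(hilbert_nrm hV) hN.
exists l; rewrite /tends (_ : (fun n => _) = fun n => rnorm (u n - l)) //.
by apply/funext => n; rewrite (hilbert_nrm hV).
Qed.

Lemma incr_geq (phi : nat -> nat) : {homo phi : m n / (m < n)%N} -> forall n, (n <= phi n)%N.
Proof. by move=> h; elim=> // n IH; apply: (leq_ltn_trans IH); exact: h. Qed.

(** Compactness gives a cluster point of [K (u n)]; indices are then picked one after another, each
    beyond the preceding one, within [1 / (k + 1)] of it. *)
Lemma compact_op_subseq (V W : normedModType R[i]) (K : V -> W) (u : nat -> V) :
  compact_op K -> (forall n, rnorm (u n) <= 1) ->
  exists phi : nat -> nat, {homo phi : m n / (m < n)%N} /\
  exists l, (fun n => rnorm (K (u (phi n)) - l)) @ \oo --> (0 : R).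
Proof.
rewrite /compact_op precompactE => cK hu.
pose F := (K \o u) @ \oo.
have [|l [_ hl]] := cK F _.
  exists 0%N => // n _ /=; apply: subset_closure; exists (u n) => //=.
  by rewrite (norm_le_rnorm _ 1).
have step (p : nat * nat) : exists n, (p.2 <= n)%N /\ rnorm (K (u n) - l) < p.1.+1%:R^-1.
  case: p => k N /=.
  have [||_ [[n Nn <-]]] := hl [set K (u n) | n in [set n | (N <= n)%N]] (ball l (k.+1%:R^-1)%:C).
  - by exists N => // n /= Nn; exists n.
  - by apply: nbhsx_ballx; rewrite ltcR invr_gt0 ltr0n.
  - by rewrite -ball_normE /= norm_lt_rnorm rnormBC; exists n.
have [g hg] := choice step.
pose fix phi k := if k is m.+1 then g (k, (phi m).+1) else g (0%N, 0%N).
exists phi; split.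
  apply: homo_ltn => // [x y z|k]; first exact: ltn_trans.
  by have [h _] := hg (k.+1, (phi k).+1).
exists l; apply: squeeze0 (@cvg0_invn R) => k; rewrite rnorm_ge0 /=.
by case: k => [|k]; apply: ltW; [have [_] := hg (0%N, 0%N)|have [_] := hg (k.+1, (phi k).+1)].
Qed.

Lemma compact_op_bounded (V W : normedModType R[i]) (K : {linear V -> W}) :
  compact_op K -> exists2 M, 0 < M & forall x, rnorm (K x) <= M * rnorm x.
Proof.
move=> cK; apply: contrapT => hM.
have /choice [u hu] : forall n : nat, exists x, rnorm x <= 1 /\ n%:R < rnorm (K x).
  move=> n; apply: contrapT => hn; apply: hM; exists n.+1%:R => // x.
  have [->|x0] := eqVneq x 0; first by rewrite linear0 !rnorm0 mulr0.
  rewrite leNgt; apply/negP => h; apply: hn; have nx := rnorm_gt0 x0.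
  exists (((rnorm x)^-1)%:C *: x).
  rewrite linearZ !rnormZ modulusC gtr0_norm ?invr_gt0 // mulVf ?gt_eqF //; split => //.
  by rewrite mulrC ltr_pdivlMr //; apply: le_lt_trans h; rewrite ler_pM2r // ler_nat.
have [|phi [hphi [l hl]]] := compact_op_subseq (u := u) cK; first by move=> n; have [] := hu n.
have [N hN] := (cvg0P _).1 hl 1 ltr01.
pose m := maxn N (Num.truncn (1 + rnorm l)).+1.
have := hN m (leq_maxl _ _); rewrite ger0_norm ?rnorm_ge0 //.
have [_] := hu (phi m).
have := rnormD (K (u (phi m)) - l) l; rewrite subrK.
have : (1 + rnorm l) < (phi m)%:R.
  apply: (lt_le_trans (truncnS_gt _)); rewrite ler_nat.
  exact: leq_trans (leq_maxr _ _) (incr_geq hphi m).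
lra.
Qed.

(* Linear combinations of eigenvectors of [(K^* K)^(1/2)] for the first [n]
   s-numbers span the exceptional subspace. *)
Lemma s_numbers_approx (V : normedModType R[i]) (ip : V -> V -> R[i])
    (K : {linear V -> V}) (s : nat -> R) : inner_product ip -> hcomplete ip ->
  seq_compact ip K -> (forall x y, ip (K x) y = ip x (K y)) -> s_numbers ip K s ->
  forall n, exists f : 'I_n -> V, forall x, (forall i, ip x (f i) = 0) ->
    nrm ip (K x) <= s n * nrm ip x.
Proof.
move=> hip hc cK symK [s0 smono [A [Acont Apos [_ Asym] [K' [_ adjK] A2]] eig]] n.
have KK' x : K' x = K x.
  apply/eqP; rewrite -subr_eq0; apply/eqP/(sqn_eq0 hip).
  by rewrite /sqn ipBr // -adjK symK subrr.
have Alin : linear A by move=> a x y; rewrite linearP.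
have Klin : linear K by move=> a x y; rewrite linearP.
have nA x : nrm ip (A x) = nrm ip (K x).
  by rewrite /nrm /sqn Asym A2 KK' symK.
have cA : seq_compact ip A.
  move=> u /cK[phi [hphi [l hl]]]; exists phi; split => //.
  apply: hc => e e0; have [N hN] := tends_cauchy hip hl e0.
  exists N => k m hk hm /=; rewrite -linearB nA linearB; exact: hN.
have /choice[I hI] : forall t : R, exists d : {idx : seq nat & 'I_(size idx) -> V}, 0 < t ->
    [/\ uniq (projT1 d), forall k, (k \in projT1 d) = (s k == t) &
    [set u | A u = t%:C *: u] =
    [set x | exists c, x = \sum_(i < size (projT1 d)) c i *: projT2 d i]].
  move=> t; have [t0|_] := ltP 0 t; last first.
    by exists (existT (fun idx : seq nat => 'I_(size idx) -> V) [::] (fun=> 0)).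
  have [idx [uidx hidx [b [_ hb]]]] := eig t t0.
  exists (existT (fun idx : seq nat => 'I_(size idx) -> V) idx b) => _; split => //= k.
  by apply/idP/eqP => /hidx.
(* The position of [k] among the indices with value [s k] selects a member of the basis of that
   eigenspace, so equal s-numbers receive distinct basis vectors. *)
pose g k := if insub (index k (projT1 (I (s k)))) is Some i then projT2 (I (s k)) i else 0.
have gA k : 0 < s k -> A (g k) = (s k)%:C *: g k.
  move=> sk; rewrite /g; case: insubP => [i _ _|_]; last by rewrite linear0 scaler0.
  have [_ _ hE] := hI _ sk.
  have : [set x | exists c, x = \sum_(i < size (projT1 (I (s k)))) c i *: projT2 (I (s k)) i]
      (projT2 (I (s k)) i).
    exists (fun j => (j == i)%:R); rewrite (bigD1 i) //= eqxx scale1r big1 ?addr0 //.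
    by move=> j /negPf ->; rewrite scale0r.
  by rewrite -hE.
pose h k := if 0 < s k then g k else 0.
have hA k : A (h k) = (s k)%:C *: h k.
  by rewrite /h; case: ifP => [/gA //|_]; rewrite linear0 scaler0.
exists (fun i => h i) => x hx; rewrite -nA.
pose W y := forall i : 'I_n, ip y (h i) = 0.
have hW : closed_subspace ip W.
  split=> [i|a y z hy hz i|u l hu hl i]; first exact: ip0l.
  - by rewrite (ip_linear hip) hy hz mulr0 addr0.
  - by apply: (ip_lim_cst hip hl) => m; exact: hu.
have [|||t [t0 ht ex]] := attain_norm hip Alin cA hW.
- by move=> y hy i; rewrite Asym hA ipZr // hy mulr0.
- by move=> y z _ _; exact: Asym.
- by move=> y _; exact: Apos.
(* If the norm [t] of [A] on the complement exceeded [s n], it would be attained at an eigenvector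
   [y]. All indices with [s k = t] are below [n] by monotonicity, so [y] would be orthogonal to a
   basis of its own eigenspace. *)
apply: (le_trans (ht x hx)); rewrite ler_wpM2r ?nrm_ge0 // leNgt; apply/negP => hlt.
have tp : 0 < t by apply: le_lt_trans hlt.
have [y [Wy ny Ay]] := ex tp; have [uidx hidx hE] := hI t tp.
have : [set u | A u = t%:C *: u] y by [].
rewrite hE => -[c yE].
suff : ip y y = 0 by rewrite ip_nrm // ny expr1n => /(congr1 (@complex.Re R))/eqP; rewrite /= oner_eq0.
rewrite [X in ip X _]yE ip_suml // big1 // => i _; rewrite ipZl //.
pose k := nth 0%N (projT1 (I t)) i.
have kin : k \in projT1 (I t) by rewrite mem_nth.
have sk : s k = t by apply/eqP; rewrite -hidx.
have kn : (k < n)%N.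
  by rewrite ltnNge; apply/negP => /smono; rewrite sk leNgt hlt.
have gE : g k = projT2 (I t) i by rewrite /g sk index_uniq ?valK.
have := Wy (Ordinal kn); rewrite /h /= sk tp gE => /(ip_eq0C hip) ->.
by rewrite mulr0.
Qed.

(** For a power of two [h >= p], monotonicity gives [s i ^ h <= s 0 ^ (h - p) * s i ^ p]. This
    passes from the Schatten exponent to one that the trace estimates can handle. *)
Lemma powers_summable (s : nat -> R) (p : R) : 0 < p -> (forall k, 0 <= s k) ->
  (forall k l, (k <= l)%N -> s l <= s k) -> (\sum_(0 <= k <oo) (s k `^ p)%:E < +oo)%E ->
  exists a K, forall n, \sum_(i < n) s i ^+ (2 ^ a.+1) <= K.
Proof.
move=> p0 s0 smono hs.
pose a := (Num.truncn p).+1; set h := (2 ^ a.+1)%N.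
have ph : p <= h%:R.
  apply: (le_trans (ltW (truncnS_gt p))); rewrite ler_nat.
  by apply: leq_trans (ltnW (ltn_expl a.+1 (ltnSn 1))); rewrite /a.
pose c := s 0%N `^ (h%:R - p).
have c0 : 0 <= c by exact: powR_ge0.
pose S := fine (\sum_(0 <= k <oo) (s k `^ p)%:E)%E.
have S0 : (0 <= \sum_(0 <= k <oo) (s k `^ p)%:E)%E.
  by apply: nneseries_ge0 => k _ _; rewrite lee_fin powR_ge0.
have partial n : \sum_(i < n) s i `^ p <= S.
  rewrite -lee_fin /S fineK ?ge0_fin_numE //.
  rewrite -(big_mkord xpredT (fun i => s i `^ p)) -sumEFin.
  by apply: nneseries_lim_ge => k _ _; rewrite lee_fin powR_ge0.
exists a, (c * S) => n; apply: le_trans (ler_wpM2l c0 (partial n)).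
rewrite mulr_sumr; apply: ler_sum => i _; rewrite -/h.
have [->|si] := eqVneq (s i) 0.
  by rewrite expr0n gtn_eqF ?expn_gt0 // mulr_ge0 ?powR_ge0.
rewrite -powR_mulrn // -[X in _ `^ X](subrK p) powRD ?si ?implybT //.
by rewrite ler_wpM2r ?powR_ge0 // ge0_ler_powR ?nnegrE ?subr_ge0 // smono.
Qed.

End HilbertSpaces.

(** * Completeness in the three spaces *)

Section LinearSpan.
Variable R : realType.

Lemma lin_span0 (V : lmodType R[i]) (E : set V) : lin_span E 0.
Proof.
exists 0%N, (fun=> 0), (fun=> 0); split; first by case.
by rewrite big_ord0.
Qed.

Lemma sub_lin_span (V : lmodType R[i]) (E : set V) : E `<=` lin_span E.
Proof. by move=> x Ex; exists 1%N, (fun=> 1), (fun=> x); split=> //; rewrite big_ord1 scale1r. Qed.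

Lemma lin_spanP (V : lmodType R[i]) (E : set V) (a : R[i]) x y :
  lin_span E x -> lin_span E y -> lin_span E (a *: x + y).
Proof.
move=> [k [c [e [He ->]]]] [l [d [f [Hf ->]]]].
exists (k + l)%N, (fun i : 'I_(k + l) => match fintype.split i with inl j => a * c j | inr j => d j end),
  (fun i : 'I_(k + l) => match fintype.split i with inl j => e j | inr j => f j end); split.
  by move=> i; case: fintype.split.
rewrite big_split_ord scaler_sumr; congr (_ + _); apply: eq_bigr => i _.
  by rewrite (unsplitK (inl i)) scalerA.
by rewrite (unsplitK (inr i)).
Qed.

Lemma lin_span_image (V W : lmodType R[i]) (E : set V) (F : set W) (f : V -> W) x :
  linear f -> (forall y, E y -> F (f y)) -> lin_span E x -> lin_span F (f x).
Proof.
move=> flin EF [k [c [e [He ->]]]]; exists k, c, (f \o e); split=> [i|]; first exact: EF.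
elim/big_rec2: _ => [|i y z _ <-].
  by rewrite (linop0 flin).
by rewrite flin.
Qed.

Lemma compact_op_subseq_bounded (V W : normedModType R[i]) (K : {linear V -> W})
    (u : nat -> V) (M : R) : compact_op K -> (forall n, rnorm (u n) <= M) ->
  exists phi : nat -> nat, {homo phi : m n / (m < n)%N} /\
  exists l, (fun n => rnorm (K (u (phi n)) - l)) @ \oo --> (0 : R).
Proof.
move=> cK hu; have M1 : 0 < `|M| + 1 by rewrite ltr_wpDl.
have [|phi [hphi [l hl]]] := compact_op_subseq (u := fun n => ((`|M| + 1)^-1)%:C *: u n) cK.
  move=> n; rewrite rnormZ modulusC gtr0_norm ?invr_gt0 // mulrC ler_pdivrMr // mul1r.
  by rewrite (le_trans (hu n)) // (le_trans (ler_norm _)) // lerDl.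
exists phi; split => //; exists ((`|M| + 1)%:C *: l).
apply: squeeze0 (cvg0Ml (`|M| + 1) hl) => n; rewrite rnorm_ge0 /=.
rewrite (_ : K (u (phi n)) - _ =
    (`|M| + 1)%:C *: (K (((`|M| + 1)^-1)%:C *: u (phi n)) - l)).
  by rewrite rnormZ modulusC gtr0_norm.
by rewrite [RHS]scalerBr [K (_ *: _)]linearZ /= scalerA -rmorphM /= divff ?(lt0r_neq0 M1) // scale1r.
Qed.

End LinearSpan.

Section RootFunctions.
Variables (R : realType) (V : lmodType R[i]) (P : V -> V).
Hypothesis Plin : linear P.

Lemma iter_shift_comm (lam : R[i]) m u :
  iter m (fun w => P w - lam *: w) (P u) = P (iter m (fun w => P w - lam *: w) u).
Proof.
elim: m => //= m ->; set w := iter _ _ _.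
by rewrite (linopB _ _ Plin) (linopZ _ _ Plin).
Qed.

Lemma root_functionsM u : root_functions P u -> root_functions P (P u).
Proof.
move=> [lam [m [el hu]]]; exists lam, m; split => //.
by rewrite iter_shift_comm hu (linop0 Plin).
Qed.

(** The last nonzero iterate is an eigenvector, which supplies the eigenvalue clause of
    [root_functions]. *)
Lemma iter_root (lam : R[i]) m u :
  iter m (fun w => P w - lam *: w) u = 0 -> u = 0 \/ root_functions P u.
Proof.
move=> hu; have [->|u0] := eqVneq u 0; [by left|right].
exists lam, m; split => //; elim: m hu => [/= /eqP|m IH hu]; first by rewrite (negPf u0).
have [|w0] := eqVneq (iter m (fun w => P w - lam *: w) u) 0; first exact: IH.
exists (iter m (fun w => P w - lam *: w) u) => //.
by apply/eqP; rewrite -subr_eq0; move: hu => /= ->.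
Qed.

(** Injectivity makes the eigenvalue nonzero, so [(P - lam) u = P w] yields
    [u = P (lam^-1 (u - w))]. This places the root functions of [P1] in the smaller spaces. *)
Lemma root_functions_range u : injective P -> root_functions P u -> exists w, u = P w.
Proof.
move=> Pinj [lam [m [[v v0 Pv] hu]]].
have l0 : lam != 0.
  apply: contra v0 => /eqP l0; apply/eqP; apply: Pinj.
  by rewrite Pv l0 scale0r (linop0 Plin).
elim: m u hu => [|m IH] u; first by move=> /= ->; exists 0; rewrite (linop0 Plin).
rewrite iterSr => /IH[w hw]; exists (lam^-1 *: (u - w)).
rewrite (linopZ _ _ Plin) (linopB _ _ Plin) -hw opprB addrC subrK scalerA.
by rewrite mulVf // scale1r.
Qed.

End RootFunctions.

(** The pairing acts through two identities: against [iota'] it is the product of [L2], against [L0]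
    that of [H]. Density comes from [keldysh] in [Hm], is carried to [H] by [Linv] and from there to
    [L2] by [iota]. *)
Lemma perturbation_complete (R : realType) (H L2 Hm : completeNormedModType R[i])
  (dotH : {dot H for Num.conj}) (dotL2 : {dot L2 for Num.conj})
  (pair : H -> Hm -> R[i]) (iota : {linear H -> L2}) (iota' : {linear L2 -> Hm})
  (L0 : {linear H -> Hm}) (L0inv : Hm -> H) (dL : {linear H -> Hm}) (Linv : Hm -> H) :
  is_hilbert dotH -> is_hilbert dotL2 ->
  continuous iota -> injective iota -> continuous iota' -> injective iota' ->
  (forall v f, pair v (iota' f) = dotL2 (iota v) f) ->
  (forall u v, pair v (L0 u) = dotH v u) ->
  cancel L0 L0inv -> cancel L0inv L0 ->
  finite_order (fun u v => pair (L0inv u) v) (iota' \o iota \o L0inv) ->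
  compact_op dL -> continuous Linv ->
  cancel (fun u => L0 u + dL u) Linv -> cancel Linv (fun u => L0 u + dL u) ->
  let P1 : Hm -> Hm := iota' \o iota \o Linv in
  [/\ compact_op P1, complete_in id (root_functions P1),
      complete_in iota' (root_functions P1)
    & complete_in (iota' \o iota) (root_functions P1)].
Proof.
move=> hilH hilL iota_cont iota_inj iota'_cont iota'_inj iota'E L0E L0K L0invK hQ1
  cdL Linv_cont LK LinvK P1.
have iotalin : linear iota by move=> a x y; rewrite linearP.
have iota'lin : linear iota' by move=> a x y; rewrite linearP.
have L0lin : linear L0 by move=> a x y; rewrite linearP.
pose T u := L0 u + dL u.
have Tlin : linear T by move=> a x y; rewrite /T !linearP scalerDr addrACA.
have Linvlin : linear Linv by move=> a x y; rewrite -[RHS]LK -/(T _) Tlin /T !LinvK.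
have L0invlin : linear L0inv by move=> a x y; rewrite -[RHS]L0K linearP !L0invK.
have [ML ML0 hML] := continuous_rbounded Linvlin Linv_cont.
have [Md Md0 hMd] := compact_op_bounded cdL.
have [Mi Mi0 hMi] := continuous_rbounded iotalin iota_cont.
(* [T = L0 + dL] is bounded as the inverse of [Linv]; so is [L0 = T - dL], and then [L0inv]. *)
have [CT CT0 hCT] := bounded_inverse Linvlin Tlin LinvK LK hML.
have hL0 u : rnorm (L0 u) <= (CT + Md) * rnorm u.
  have -> : L0 u = T u - dL u by rewrite /T addrK.
  by rewrite (le_trans (rnormB _ _)) // mulrDl lerD.
have [C0 C00 hC0] := bounded_inverse L0lin L0invlin L0K L0invK hL0.
set CL := CT + Md in hL0; have CL0 : 0 < CL by rewrite addr_gt0.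
pose ip u v := dotH (L0inv u) (L0inv v).
have hdH := dot_inner_product dotH.
have hdL := dot_inner_product dotL2.
have hip : inner_product ip.
  by apply: pullback_inner_product => //; exact: can_inj L0invK.
have nrmE w : nrm ip w = rnorm (L0inv w) by exact: (hilbert_nrm hilH (L0inv w)).
have nrm_le w : nrm ip w <= C0 * rnorm w by rewrite nrmE.
have rnorm_le w : rnorm w <= CL * nrm ip w by rewrite nrmE -{1}(L0invK w) hL0.
have L0invB x y : L0inv (x - y) = L0inv x - L0inv y := linopB x y L0invlin.
have hc : hcomplete ip.
  move=> u hu; have [|l hl] := hilbert_complete hilH (u := L0inv \o u).
    move=> e e0; have [N hN] := hu e e0; exists N => m n Nm Nn /=.
    by rewrite -L0invB; exact: hN.
  exists (L0 l); move: hl; rewrite /tends => hl.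
  by apply: squeeze0 hl => n /=; rewrite nrm_ge0 nrmE L0invB L0K (hilbert_nrm hilH) lexx.
have cvg_ip (u : nat -> Hm) l : (fun n => rnorm (u n - l)) @ \oo --> (0 : R) -> tends ip u l.
  by move=> hu; apply: squeeze0 (cvg0Ml C0 hu) => n; rewrite nrm_ge0 nrm_le.
pose Q := iota' \o iota \o L0inv.
pose delta := dL \o L0inv.
have Qlin : linear Q by move=> a x y; rewrite /Q /= L0invlin !linearP.
have dlin : linear delta by move=> a x y; rewrite /delta /= L0invlin linearP.
have Plin : linear P1 by move=> a x y; rewrite /P1 /= Linvlin !linearP.
have [p p0 [cQ [K1 QK1 [s hs hsum]]]] := hQ1.
have QE : Q = K1 :> (_ -> _) by apply/funext.
have cK1 : compact_op K1 by move: cQ; rewrite -/Q QE.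
have ipE : (fun u v => pair (L0inv u) v) = ip.
  by apply/funext => u; apply/funext => v; rewrite -{1}(L0invK v) L0E.
rewrite ipE in hs.
have Qcpt : seq_compact ip Q.
  move=> u hu; have [|phi [hphi [l hl]]] := compact_op_subseq_bounded (u := u) (M := CL) cK1.
    move=> n; apply: (le_trans (rnorm_le _)).
    by rewrite -[leRHS]mulr1 ler_pM2l.
  by exists phi; split => //; exists l; apply: cvg_ip; rewrite QE.
have dcpt : seq_compact ip delta.
  move=> u hu; have [|phi [hphi [l hl]]] :=
    compact_op_subseq_bounded (u := L0inv \o u) (M := 1) cdL.
    by move=> n /=; rewrite -nrmE.
  by exists phi; split => //; exists l; exact: cvg_ip.
(* Factoring [P1] through [Q] by the bounded map [L0 Linv] transfers compactness. *)
have PW w : P1 w = Q (L0 (Linv w)) by rewrite /Q /= L0K.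
have hW w : rnorm (L0 (Linv w)) <= CL * ML * rnorm w.
  by rewrite (le_trans (hL0 _)) // -mulrA ler_pM2l.
have Pcpt : seq_compact ip P1.
  move=> u hu; have [|phi [hphi [l hl]]] := compact_op_subseq_bounded
     (u := fun n => L0 (Linv (u n))) (M := CL * ML * CL) cK1.
    move=> n; apply: (le_trans (hW _)); rewrite ler_pM2l ?mulr_gt0 //.
    by apply: (le_trans (rnorm_le _)); rewrite -[leRHS]mulr1 ler_pM2l.
  exists phi; split => //; exists l; apply: cvg_ip.
  rewrite (_ : (fun n => _) = fun n => rnorm (K1 (L0 (Linv (u (phi n)))) - l)) //.
  by apply/funext => n /=; rewrite -QE -PW.
have ipQ u v : ip u (Q v) = dotL2 (iota (L0inv u)) (iota (L0inv v)).
  by rewrite -ipE -iota'E.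
have Qsym u v : ip (Q u) v = ip u (Q v).
  by rewrite (ip_sym hip v) !ipQ -(ip_sym hdL).
have Qip u : ip (Q u) u = dotL2 (iota (L0inv u)) (iota (L0inv u)) by rewrite Qsym ipQ.
have Qge0 u : 0 <= ip (Q u) u by rewrite Qip dnorm_ge0.
have Qinj u : ip (Q u) u = 0 -> u = 0.
  rewrite Qip => /eqP; rewrite dnorm_eq0 => /eqP h.
  by apply: (can_inj L0invK); apply: iota_inj; rewrite h (linop0 L0invlin) linear0.
pose Rt := root_functions P1.
pose M w := forall e, 0 < e -> exists2 v, lin_span Rt v & nrm ip (w - v) < e.
have M0 : M 0 by move=> e e0; exists 0; [exact: lin_span0 | rewrite subrr nrm0].
have hM : closed_subspace ip M.
  split => //.
    move=> a x y Mx My e e0; have a1 : 0 < modulus a + 1 by rewrite ltr_wpDl ?modulus_ge0.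
    have e1 : 0 < e / 2 / (modulus a + 1) by rewrite !divr_gt0.
    have e2 : 0 < e / 2 by rewrite divr_gt0.
    have [v sv hv] := Mx _ e1; have [w sw hw] := My _ e2.
    exists (a *: v + w); first exact: lin_spanP.
    rewrite opprD addrACA -scalerBr (le_lt_trans (nrmD hip _ _)) // [e]splitr.
    apply: ler_ltD => //; rewrite nrmZ //; move: hv; rewrite ltr_pdivlMr // => /ltW.
    by apply: le_trans; rewrite mulrC ler_wpM2l ?nrm_ge0 // lerDl.
  move=> u l hu hl e e0; have e2 : 0 < e / 2 by rewrite divr_gt0.
  have [N /(_ N (leqnn N))] := (cvg0P _).1 hl _ e2; rewrite ger0_norm ?nrm_ge0 // => h1.
  have [v sv hv] := hu N _ e2; exists v => //.
  have := nrmD hip (l - u N) (u N - v); rewrite addrA subrK (nrmBC hip l (u N)); lra.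
have [MP MP0 hMP] := compact_bounded hip Plin Pcpt.
have PM w : M w -> M (P1 w).
  move=> Mw e e0; have [v sv hv] := Mw _ (divr_gt0 e0 MP0).
  exists (P1 v); first by apply: lin_span_image sv => // y; exact: root_functionsM.
  rewrite -(linopB _ _ Plin) (le_lt_trans (hMP _)) //.
  by rewrite mulrC -ltr_pdivlMr.
have rootM (lam : R[i]) m u : lam != 0 -> iter m (fun w => P1 w - lam *: w) u = 0 -> M u.
  move=> _ /iter_root[->//|ru] e e0; exists u; first exact: sub_lin_span.
  by rewrite subrr nrm0.
have [s0 smono _] := hs.
have approx n : exists f : 'I_n -> Hm, forall x, (forall i, ip x (f i) = 0) ->
    nrm ip (Q x) <= s n * nrm ip x.
  rewrite QE; apply: s_numbers_approx hs n => //; first by rewrite -QE.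
  by move=> x y; rewrite -QE.
have [a [K hK]] := powers_summable p0 s0 smono hsum.
have PQ w : P1 (w + delta w) = Q w.
  by rewrite /P1 /Q /delta /= -{1}(L0invK w) LK.
have allM := keldysh hip hc Qlin Qcpt Qsym Qge0 Qinj dlin dcpt Plin Pcpt PQ hM PM rootM s0
  approx hK.
have dense w e : 0 < e -> exists2 v, lin_span Rt v & rnorm (w - v) < e.
  move=> e0; have [v sv hv] := allM w _ (divr_gt0 e0 CL0); exists v => //.
  by rewrite (le_lt_trans (rnorm_le _)) // mulrC -ltr_pdivlMr.
have Pinj : injective P1.
  move=> x y /iota'_inj/iota_inj h.
  by rewrite -[x]LinvK h LinvK.
(* [T x] is approximated in [Hm] and [Linv] is applied. The vector [Linv v] is admissible because it
   embeds into [Hm] as [P1 v], again in the span of root functions. *)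
have densH (x : H) e : 0 < e -> exists2 v, lin_span Rt v & rnorm (x - Linv v) < e.
  move=> e0; have [v sv hv] := dense (T x) _ (divr_gt0 e0 ML0); exists v => //.
  rewrite -{1}(LK x) -/(T x) -(linopB _ _ Linvlin).
  by rewrite (le_lt_trans (hML _)) // mulrC -ltr_pdivlMr.
have rangeP u : Rt u -> exists w, u = P1 w by exact: root_functions_range.
split.
- have cK' : compact (closure (K1 @` [set x | `|x| <= 1])) by rewrite -precompactE.
  have CW0 : 0 < CL * ML by rewrite mulr_gt0.
  apply: (@precompact_subset _ _
    ((fun w => (CL * ML)%:C *: w) @` closure (K1 @` [set x | `|x| <= 1]))); last first.
    apply: compact_precompact; first exact: norm_hausdorff.
    apply: continuous_compact => //; apply: continuous_subspaceT.
    apply: (@rbounded_continuous _ _ _ _ (CL * ML)).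
      by move=> b x y; rewrite scalerDr !scalerA mulrC.
    by move=> x; rewrite rnormZ modulusC gtr0_norm.
  move=> _ [x /= nx <-]; exists (K1 (((CL * ML)^-1)%:C *: L0 (Linv x))).
    apply: subset_closure; exists (((CL * ML)^-1)%:C *: L0 (Linv x)) => //=.
    rewrite (norm_le_rnorm _ 1) rnormZ modulusC gtr0_norm ?invr_gt0 // mulrC ler_pdivrMr //.
    rewrite mul1r (le_trans (hW _)) // -[leRHS]mulr1 ler_pM2l //.
    by rewrite -(norm_le_rnorm _ 1).
  by rewrite linearZ scalerA -rmorphM /= divff ?gt_eqF // scale1r -QE -PW.
- split; first by move=> u _; exists u.
  by apply/seteqP; split => // w _; apply/closure_rnorm => e; exact: dense.
- split; first by move=> u /rangeP[w ->]; exists (iota (Linv w)).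
  apply/seteqP; split => // f _; apply/closure_rnorm => e e0.
  have e2 : 0 < e / 2 by rewrite divr_gt0.
  (* The range of [iota] is dense: if [g' = f - g] is orthogonal to it, then [x = L0inv (iota' g')]
     has [dotH x x = dotL2 (iota x) g' = 0], hence [iota' g' = L0 x = 0]. *)
  have [x hx] : exists x, rnorm (f - iota x) < e / 2.
    pose Y g := forall d, 0 < d -> exists x, rnorm (g - iota x) < d.
    have hY : closed_subspace dotL2 Y.
      split.
      - by move=> d d0; exists 0; rewrite linear0 subrr rnorm0.
      - move=> b g h Yg Yh d d0; have a1 : 0 < modulus b + 1 by rewrite ltr_wpDl ?modulus_ge0.
        have d1 : 0 < d / 2 / (modulus b + 1) by rewrite !divr_gt0.
        have d2 : 0 < d / 2 by rewrite divr_gt0.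
        have [x hx] := Yg _ d1; have [y hy] := Yh _ d2.
        exists (b *: x + y); rewrite linearP opprD addrACA -scalerBr.
        rewrite (le_lt_trans (rnormD _ _)) // [d]splitr.
        apply: ler_ltD => //; rewrite rnormZ; move: hx; rewrite ltr_pdivlMr // => /ltW.
        by apply: le_trans; rewrite mulrC ler_wpM2l ?rnorm_ge0 // lerDl.
      - move=> u l hu hl d d0; have d2 : 0 < d / 2 by rewrite divr_gt0.
        have [N /(_ N (leqnn N))] := (cvg0P _).1 hl _ d2.
        rewrite ger0_norm ?nrm_ge0 // (hilbert_nrm hilL) => h1.
        have [x hx] := hu N _ d2; exists x.
        have := rnormD (l - u N) (u N - iota x); rewrite addrA subrK (rnormBC l (u N)); lra.
    have [g Yg og] := projection hdL f (hilbert_complete hilL) hY.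
    suff fg : f - g = 0 by have [x hx] := Yg _ e2; exists x; move/eqP: fg; rewrite subr_eq0 => /eqP ->.
    apply: iota'_inj; rewrite linear0 -(L0invK (iota' (f - g))).
    suff -> : L0inv (iota' (f - g)) = 0 by rewrite linear0.
    apply/eqP; rewrite -(dnorm_eq0 dotH) -L0E L0invK iota'E; apply/eqP.
    rewrite (ip_sym hdL) og ?rmorph0 // => d d0.
    by exists (L0inv (iota' (f - g))); rewrite subrr rnorm0.
  have [v sv hv] := densH x _ (divr_gt0 e2 Mi0).
  exists (iota (Linv v)).
    apply: (lin_span_image (f := iota \o Linv)) sv.
      by move=> b y z /=; rewrite Linvlin linearP.
    by move=> y ry; exact: root_functionsM.
  have := rnormD (f - iota x) (iota x - iota (Linv v)); rewrite addrA subrK => h.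
  apply: (le_lt_trans h); rewrite [e]splitr ltrD // -linearB (le_lt_trans (hMi _)) //.
  by rewrite mulrC -ltr_pdivlMr.
- split; first by move=> u /rangeP[w ->]; exists (Linv w).
  apply/seteqP; split => // x _; apply/closure_rnorm => e e0.
  have [v sv hv] := densH x e e0; exists (Linv v) => //.
  by apply: (lin_span_image (f := Linv)) sv => // y ry; exact: root_functionsM.
Qed.

Theorem theorem3p2 (R : realType) (d : nat)
  (* Lebesgue measure and surface measure in R^n, n = d + 1 *)
  (lam sigma : {measure set (borelRn R d.+1) -> \bar R})
  (hlam : is_lebesgue lam) (hsigma : is_surface_measure sigma)
  (X : SL_data R d) (hX : SL_assumptions lam sigma X)
  (hnorm : SL_norm_is_norm lam sigma X)
  (* H_SL(D), L^2(D), H^-_SL(D) *)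
  (H : completeNormedModType R[i]) (dotH : {dot H for Num.conj})
  (j : ('rV[R]_d.+1 -> R[i]) -> H) (hH : is_HSL lam sigma X dotH j)
  (L2 : completeNormedModType R[i]) (dotL2 : {dot L2 for Num.conj})
  (cls : ('rV[R]_d.+1 -> R[i]) -> L2) (hL2 : is_L2 lam X dotL2 cls)
  (Hm : completeNormedModType R[i])
  (jm : ('rV[R]_d.+1 -> R[i]) -> Hm) (hHm : is_HSL_neg lam sigma X jm)
  (iota : {linear H -> L2})
  (iota_cont : continuous iota) (iota_inj : injective iota)
  (iotaE : forall u, H1S lam sigma X u -> iota (j u) = cls u)
  (iota' : {linear L2 -> Hm})
  (iota'_cont : continuous iota') (iota'_inj : injective iota')
  (iota'E : forall v f,
     pairing lam sigma X dotL2 cls jm iota v (iota' f) = dotL2 (iota v) f)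
  (L0 : {linear H -> Hm})
  (L0E : forall u v, pairing lam sigma X dotL2 cls jm iota v (L0 u) = dotH v u)
  (L0inv : Hm -> H) (L0K : cancel L0 L0inv) (L0invK : cancel L0inv L0)
  (* Q_1 is of finite order, for the scalar product (L_0^{-1} u, v) of H^-_SL *)
  (hQ1 : finite_order
     (fun u v => pairing lam sigma X dotL2 cls jm iota (L0inv u) v)
     (iota' \o iota \o L0inv))
  (dL : {linear H -> Hm}) (hdL : compact_op dL)
  (Linv : Hm -> H) (Linv_cont : continuous Linv)
  (LK : cancel (fun u => L0 u + dL u) Linv)
  (LinvK : cancel Linv (fun u => L0 u + dL u)) :
  let P1 : Hm -> Hm := iota' \o iota \o Linv in
  [/\ compact_op P1,
      complete_in id (root_functions P1),
      complete_in iota' (root_functions P1)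
    & complete_in (iota' \o iota) (root_functions P1)].
Proof.
have [hilH _ _] := hH; have [hilL _ _ _] := hL2.
exact: (perturbation_complete hilH hilL iota_cont iota_inj iota'_cont iota'_inj
  iota'E L0E L0K L0invK hQ1 hdL Linv_cont LK LinvK).
Qed.
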